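(* Let $n \ge 3$ and let $A \subset \mathbb{R}^n$ be a subanalytic set such that $0 \in \overline{A}$. Suppose that $2 \le m_0(A) \le n$. Then, with $d := n - (m_0(A) - 1)$, $\mathcal{GD}$ is stabilised at degree $d$ for $A$, i.e. $$\mathcal{GD}^{d}(A) = \mathcal{GD}^{d+1}(A) = \mathcal{GD}^{d+2}(A) = \cdots .$$
   Context: Subanalytic is in the sense of Hironaka; $\overline{\,\cdot\,}$ denotes closure. For $A \subset \mathbb{R}^n$ and $p \in \overline{A}$, the direction set of $A$ at $p$ is $$D_p(A) := \{a \in S^{n-1} \mid \exists \{x_i\} \subset A \setminus \{p\},\ x_i \to p,\ \tfrac{x_i-p}{\|x_i-p\|} \to a\}.$$ Put $D_A(A) := \bigcup_{p \in A} \{p\} \times D_p(A) \subset \mathbb{R}^n \times S^{n-1}$. The geometric directional bundle of $A$ at $0$ is $$\mathcal{GD}(A) := \{a \in S^{n-1} \mid (0,a) \in \overline{D_A(A)}\},$$ closure in $\mathbb{R}^n \times S^{n-1}$, and $L\mathcal{GD}(A) := \{tv \in \mathbb{R}^n \mid v \in \mathcal{GD}(A),\ t \ge 0\}$. Set $\mathcal{GD}^1 := \mathcal{GD}$ and, for $m \ge 2$, $\mathcal{GD}^m(A) := \mathcal{GD}(L\mathcal{GD}^{m-1}(A))$, where $L\mathcal{GD}^{m}(A) := \{tv \mid v \in \mathcal{GD}^{m}(A),\ t \ge 0\}$. For a subanalytic set $A$ and $p \in A$, the local dimension of $A$ at $p$ is the integer $k$ such that $\dim (A \cap B_\epsilon(p))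 = k$ for all sufficiently small $\epsilon > 0$, where $B_\epsilon(p)$ is the open ball of radius $\epsilon$ about $p$. Let $A_i := \{p \in A \mid \text{the local dimension of } A \text{ at } p \text{ is } i\}$ for $0 \le i \le \dim A$, let $\Lambda_0(A) := \{0 \le i \le \dim A \mid 0 \in \overline{A_i}\}$ (non-empty since $0 \in \overline{A}$), and $m_0(A) := \min \Lambda_0(A)$. *)

(* Defs.v *)
From HB Require Import structures.
From mathcomp Require Import all_boot all_order all_algebra.
From mathcomp Require Import all_classical all_reals all_analysis.
Set Implicit Arguments.
Unset Strict Implicit.
Unset Printing Implicit Defensive.
Import Order.TTheory GRing.Theory Num.Theory.
Import numFieldNormedType.Exports.
Local Open Scope classical_set_scope.
Local Open Scope ring_scope.

(* R^n is 'rV[R]_n. Its library topology is the usual one, but its library norm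
   and balls are those of the sup norm, so the Euclidean norm, which matters for
   normalised directions, is defined here. *)
Definition enorm (R : realType) (n : nat) (x : 'rV[R]_n) : R :=
  Num.sqrt (\sum_(i < n) x 0 i ^+ 2).

Definition usphere (R : realType) (n : nat) : set 'rV[R]_n :=
  [set a | enorm a = 1].

Definition eball (R : realType) (n : nat) (p : 'rV[R]_n) (e : R) : set 'rV[R]_n :=
  [set x | enorm (x - p) < e].

Definition monomial (R : realType) (n : nat) (x : 'rV[R]_n)
    (alpha : {ffun 'I_n -> nat}) : R :=
  \prod_(i < n) x 0 i ^+ alpha i.

(* On a polydisc around a, f is the sum of an absolutely convergent power series
   in x - a; by absolute convergence the sum may be computed along the boxes of
   exponents [0, N)^n. *)
Definition analytic_at (R : realType) (n : nat) (f : 'rV[R]_n -> R)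
    (a : 'rV[R]_n) : Prop :=
  exists (c : {ffun 'I_n -> nat} -> R) (r : R), 0 < r /\
    forall x : 'rV[R]_n, (forall i, `|x 0 i - a 0 i| < r) ->
      summable setT (fun alpha => (c alpha * monomial (x - a) alpha)%:E) /\
      (fun N : nat => \sum_(b : {ffun 'I_n -> 'I_N})
         let alpha := [ffun i => val (b i)] in
         c alpha * monomial (x - a) alpha) @ \oo --> f x.

Definition analytic_on (R : realType) (n : nat) (U : set 'rV[R]_n)
    (f : 'rV[R]_n -> R) : Prop :=
  forall a, U a -> analytic_at f a.

Definition analytic_map_on (R : realType) (n m : nat) (U : set 'rV[R]_n)
    (h : 'rV[R]_n -> 'rV[R]_m) : Prop :=
  forall j : 'I_m, analytic_on U (fun x => h x 0 j).

(* Locally a finite union (over i) of finite intersections (over j) of sets of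
   the form {f = 0} (when s i j) or {f > 0} (otherwise), f analytic. *)
Definition semianalytic (R : realType) (n : nat) (X : set 'rV[R]_n) : Prop :=
  forall a : 'rV[R]_n, exists U : set 'rV[R]_n, [/\ open U, U a &
    exists (p q : nat) (f : 'I_p -> 'I_q -> 'rV[R]_n -> R)
           (s : 'I_p -> 'I_q -> bool),
      (forall i j, analytic_on U (f i j)) /\
      forall x, U x ->
        (X x <-> exists i, forall j,
                   if s i j then f i j x = 0 else 0 < f i j x)].

(* Locally the projection to R^n of a relatively compact semianalytic subset of
   R^n x R^k. *)
Definition subanalytic (R : realType) (n : nat) (A : set 'rV[R]_n) : Prop :=
  forall a : 'rV[R]_n, exists U : set 'rV[R]_n, [/\ open U, U a &
    exists (k : nat) (B : set 'rV[R]_(n + k)),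
      [/\ semianalytic B, compact (closure B) &
          A `&` U = (@lsubmx R 1 n k) @` B]].

(* Around each point of M some analytic diffeomorphism h : U -> V (with inverse
   g) straightens M to V `&` (R^k x {0}). *)
Definition analytic_submanifold (R : realType) (n k : nat)
    (M : set 'rV[R]_n) : Prop :=
  (k <= n)%N /\
  forall p, M p ->
    exists (U V : set 'rV[R]_n) (h g : 'rV[R]_n -> 'rV[R]_n),
      [/\ open U, U p & open V] /\
      [/\ analytic_map_on U h, analytic_map_on V g,
          (forall x, U x -> V (h x) /\ g (h x) = x) &
          (forall y, V y -> U (g y) /\ h (g y) = y)] /\
      forall x, U x ->
        (M x <-> forall j : 'I_n, (k <= j)%N -> h x 0 j = 0).

Definition contains_submanifold (R : realType) (n : nat) (A : set 'rV[R]_n)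
    (k : nat) : Prop :=
  exists M : set 'rV[R]_n, [/\ M !=set0, M `<=` A & analytic_submanifold k M].

(* The largest dimension of a nonempty analytic submanifold contained in A; the
   value at the empty set is 0 by convention. *)
Definition sdim (R : realType) (n : nat) (A : set 'rV[R]_n) : nat :=
  \max_(k < n.+1 | `[< contains_submanifold A k >]) k.

Definition has_local_dim (R : realType) (n : nat) (A : set 'rV[R]_n)
    (p : 'rV[R]_n) (k : nat) : Prop :=
  exists2 e0 : R, 0 < e0 &
    forall e : R, 0 < e -> e < e0 -> sdim (A `&` eball p e) = k.

Definition local_dim_stratum (R : realType) (n : nat) (A : set 'rV[R]_n)
    (i : nat) : set 'rV[R]_n :=
  [set p | A p /\ has_local_dim A p i].

Definition Lambda0 (R : realType) (n : nat) (A : set 'rV[R]_n) : set nat :=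
  [set i | (i <= sdim A)%N /\ closure (local_dim_stratum A i) 0].

(* min (Lambda0 A), with the junk value 0 should Lambda0 A be empty. *)
Definition m0 (R : realType) (n : nat) (A : set 'rV[R]_n) : nat :=
  xget 0%N [set m | Lambda0 A m /\ forall i, Lambda0 A i -> (m <= i)%N].

Definition direction_set (R : realType) (n : nat) (A : set 'rV[R]_n)
    (p : 'rV[R]_n) : set 'rV[R]_n :=
  [set a | usphere a /\
     exists x : nat -> 'rV[R]_n,
       [/\ forall i, (A `\ p) (x i),
           x @ \oo --> p &
           (fun i => (enorm (x i - p))^-1 *: (x i - p)) @ \oo --> a]].

Definition direction_bundle (R : realType) (n : nat) (A : set 'rV[R]_n) :
    set ('rV[R]_n * 'rV[R]_n) :=
  [set pa | A pa.1 /\ direction_set A pa.1 pa.2].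

(* The closure in R^n x S^(n-1) is the trace there of the closure in R^n x R^n. *)
Definition GD (R : realType) (n : nat) (A : set 'rV[R]_n) : set 'rV[R]_n :=
  [set a | usphere a /\ closure (direction_bundle A) (0, a)].

Definition half_cone (R : realType) (n : nat) (S : set 'rV[R]_n) :
    set 'rV[R]_n :=
  [set y | exists t v, [/\ 0 <= t, S v & y = t *: v]].

(* GD^m(A) for m >= 1; the value at m = 0 is junk (GD A). *)
Fixpoint GDm (R : realType) (n m : nat) (A : set 'rV[R]_n) : set 'rV[R]_n :=
  match m with
  | (m'.+1 as k).+1 => GD (half_cone (GDm k A))
  | _ => GD A
  end.

(* Main.v *)
Require Import Defs.
From HB Require Import structures.
From mathcomp Require Import all_boot all_order all_algebra.
From mathcomp Require Import all_classical all_reals all_analysis.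
From mathcomp Require Import ring lra zify.
Set Implicit Arguments.
Unset Strict Implicit.
Unset Printing Implicit Defensive.
Import Order.TTheory GRing.Theory Num.Theory.
Import numFieldNormedType.Exports.
Local Open Scope classical_set_scope.
Local Open Scope ring_scope.

(* Write C for the cone over GD A. The theorem follows from: (1) every a in GD A lies in a linear
   space of dimension at least m0 A contained in C; (2) by induction, each application of GD
   enlarges by one the dimension of such spaces through the directions that are new, because
   secants of a cone that leave the limit of the linear spaces span, together with that limit,
   directions of the next cone. Dimension n + 1 being impossible, the sequence stops.

   For (1), fix a direction a of A at p. Near 0 every point of A has local dimension at least
   m = m0 A, so some ultrafilter on A converges to p in direction a and avoids all sets of box
   dimension less than m. Lift it to the semianalytic set over A and parametrise it by analytic
   germs in the least number d of variables. By minimality, any nonzero germ along it becomes,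
   after an analytic substitution, a monomial times a unit (local uniformisation of a single
   point, by the Tschirnhaus transform and toric substitutions), so all defining functions have
   constant sign on an open cube, which is thus mapped into A by an analytic map g. Then
   d >= m by thinness, and g has rank d somewhere: otherwise, moving along the fibres of g to
   the maximum of a bump function would put the points on a proper analytic subset and lower d.
   Along a ray in the cube the velocity of g tends to the direction a, and the image of the
   Jacobian of g is a linear space of directions of A. A limit of these spaces gives (1). *)

(** * Convergent power series and analytic germs *)

Section AN.
Context {R : realType}.
Implicit Types (r s C D : R).

(** The ultrafilter replaces case distinctions: along it a quantity has a definite sign, a bounded
    one has a limit, and a finite disjunction is decided. Only one infinitely near point has to be
    resolved, so no blow-up centres are chosen and no charts are glued. Minimality of d serves the
    same end: a nonzero germ vanishing along the point would give a parametrisation in fewer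
    variables, so equations hold identically and inequalities keep their sign.

    The obstacle is that the ultrafilter could sit on a small subset of A, such as a curve. Box
    dimension guards against it by counting alone: a Lipschitz image of a cube of dimension below m
    is covered by O(N^(m-1)) boxes of side 1/N, while a submanifold of dimension k >= m contains N^k
    points separated by a constant times 1/N.

    The bound d is an index count: with [GD] as first iterate, the new elements of the j-th iterate
    lie in linear spaces of dimension m + j - 1, which exceeds n for j = n - m + 2 = d + 1. *)

Definition box n r (x : 'rV[R]_n) := forall i, `|x 0 i| <= r.

Definition mon n (m : 'I_n -> nat) (x : 'rV[R]_n) : R := \prod_i x 0 i ^+ m i.

(* AN r f C: on the polydisc of radius r, f is the sum of a convergent series of monomials whose
   values at (r, ..., r) have absolute sum at most C. Closing under such series spares all
   rearrangements of power series. *)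
Inductive AN n r : ('rV[R]_n -> R) -> R -> Prop :=
| AN_mono f c (m : 'I_n -> nat) C : `|c| * \prod_i r ^+ m i <= C ->
    (forall x, box r x -> f x = c * mon m x) -> AN r f C
| AN_series f (F : nat -> 'rV[R]_n -> R) (K : nat -> R) C :
    (forall k, AN r (F k) (K k)) ->
    (forall N, \sum_(k < N) K k <= C) ->
    (forall x, box r x -> (fun N => \sum_(k < N) F k x) @ \oo --> f x) -> AN r f C.

Lemma AN_ind' n r (P : ('rV[R]_n -> R) -> R -> Prop) :
  (forall f c (m : 'I_n -> nat) C, `|c| * \prod_i r ^+ m i <= C ->
    (forall x, box r x -> f x = c * mon m x) -> P f C) ->
  (forall f (F : nat -> 'rV[R]_n -> R) (K : nat -> R) C,
    (forall k, AN r (F k) (K k)) -> (forall k, P (F k) (K k)) ->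
    (forall N, \sum_(k < N) K k <= C) ->
    (forall x, box r x -> (fun N => \sum_(k < N) F k x) @ \oo --> f x) -> P f C) ->
  forall f C, AN r f C -> P f C.
Proof.
move=> Pm Ps; fix IH 3 => f C [{}f c m {}C hC hf|{}f F K {}C hF hK hf].
  exact: Pm hC hf.
by apply: (Ps f F K C) => // k; apply: IH.
Qed.

Lemma prod_exp_ge0 n r (m : 'I_n -> nat) : 0 <= r -> 0 <= \prod_i r ^+ m i.
Proof. by move=> r0; apply: prodr_ge0 => i _; rewrite exprn_ge0. Qed.

Lemma AN_ge0 n r (f : 'rV[R]_n -> R) C : 0 <= r -> AN r f C -> 0 <= C.
Proof.
move=> r0; elim/AN_ind' => {f C} [f c m C hC _|f F K C _ K0 hK _].
  by apply: le_trans hC; rewrite mulr_ge0 ?normr_ge0 ?prod_exp_ge0.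
by apply: le_trans (hK 0%N); rewrite big_ord0.
Qed.

Lemma mon_bound n r (m : 'I_n -> nat) (x : 'rV[R]_n) :
  box r x -> `|mon m x| <= \prod_i r ^+ m i.
Proof.
move=> bx; rewrite normr_prod ler_prod // => i _.
by rewrite normr_ge0 normrX lerXn2r ?nnegrE // (le_trans _ (bx i)).
Qed.

Lemma AN_bound n r (f : 'rV[R]_n -> R) C x : AN r f C -> box r x -> `|f x| <= C.
Proof.
move=> + bx; elim/AN_ind' => {f C} [f c m C hC ->//|f F K C _ IH hK hf].
  by apply: le_trans hC; rewrite normrM ler_wpM2l ?normr_ge0 ?mon_bound.
have fl : (fun N => `|\sum_(k < N) F k x|) @ \oo --> `|f x|.
  by apply: cvg_norm; apply: hf.
rewrite -(cvg_lim _ fl) //; apply: limr_le; first by apply/cvg_ex; eexists; exact: fl.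
apply: nearW => N; apply: le_trans (hK N); apply: le_trans (ler_norm_sum _ _ _) _.
exact: ler_sum.
Qed.

Lemma AN_eq n r (f g : 'rV[R]_n -> R) C :
  AN r f C -> (forall x, box r x -> f x = g x) -> AN r g C.
Proof.
case=> {f C} [f c m C hC hf|f F K C hF hK hf] fg.
  by apply: (AN_mono hC) => x bx; rewrite -fg ?hf.
by apply: (AN_series hF hK) => x bx; rewrite -fg //; apply: hf.
Qed.

Lemma AN_le n r (f : 'rV[R]_n -> R) C D : AN r f C -> C <= D -> AN r f D.
Proof.
case=> {f C} [f c m C hC hf|f F K C hF hK hf] CD.
  by apply: (AN_mono (le_trans hC CD)).
by apply: (AN_series hF _ hf) => N; apply: le_trans CD.
Qed.

Lemma AN_cst n r c : AN r (fun _ : 'rV[R]_n => c) `|c|.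
Proof.
apply: (@AN_mono _ _ _ c (fun=> 0%N)) => [|x _].
  by rewrite big1 ?mulr1.
by rewrite /mon big1 ?mulr1.
Qed.

Lemma AN_0 n r : AN r (fun _ : 'rV[R]_n => 0) 0.
Proof. by have := @AN_cst n r 0; rewrite normr0. Qed.

Lemma prod_delta n (i : 'I_n) (F : 'I_n -> R) :
  \prod_j F j ^+ (j == i) = F i.
Proof.
rewrite (bigD1 i) //= eqxx expr1 big1 ?mulr1 // => j /negbTE ->.
by rewrite expr0.
Qed.

Lemma AN_coord n r i : AN r (fun x : 'rV[R]_n => x 0 i) r.
Proof.
apply: (@AN_mono _ _ _ 1 (fun j => j == i)) => [|x _].
  by rewrite normr1 mul1r prod_delta.
by rewrite mul1r /mon prod_delta.
Qed.

Lemma AN_scale n r (f : 'rV[R]_n -> R) C a : AN r f C -> AN r (fun x => a * f x) (`|a| * C).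
Proof.
elim/AN_ind' => {f C} [f c m C hC hf|f F K C _ IH hK hf].
  apply: (@AN_mono _ _ _ (a * c) m) => [|x bx]; last by rewrite hf // mulrA.
  by rewrite normrM -mulrA ler_wpM2l.
apply: (AN_series IH) => [N|x bx].
  by rewrite -mulr_sumr ler_wpM2l.
under eq_fun do rewrite -mulr_sumr.
by apply: cvgMr; apply: hf.
Qed.

Lemma AN_add n r (f g : 'rV[R]_n -> R) C D : 0 <= r -> AN r f C -> AN r g D ->
  AN r (fun x => f x + g x) (C + D).
Proof.
move=> r0 hf hg.
pose F k := if k is 0%N then f else if k is 1%N then g else fun=> 0.
pose K k := if k is 0%N then C else if k is 1%N then D else 0.
have E (T : nat -> R) : (forall k, T k.+2 = 0) ->
    forall N, \sum_(k < N.+2) T k = T 0%N + T 1%N.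
  move=> T0 N; rewrite !big_ord_recl /= big1 ?addr0 //.
have C0 := AN_ge0 r0 hf; have D0 := AN_ge0 r0 hg.
apply: (@AN_series n r _ F K); first by case=> [|[|k]] //=; exact: AN_0.
  case=> [|[|N]]; last by rewrite E.
    by rewrite big_ord0 addr_ge0.
  by rewrite big_ord1 lerDl.
move=> x bx; rewrite -(cvg_shiftn 2).
under eq_fun do rewrite addn2 (E (fun k => F k x)) //.
exact: cvg_cst.
Qed.

Lemma AN_opp n r (f : 'rV[R]_n -> R) C : AN r f C -> AN r (fun x => - f x) C.
Proof.
move=> h; have := AN_scale (-1) h; rewrite normrN1 mul1r => /AN_eq; apply => x _.
by rewrite mulN1r.
Qed.

Lemma AN_sub n r (f g : 'rV[R]_n -> R) C D : 0 <= r -> AN r f C -> AN r g D ->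
  AN r (fun x => f x - g x) (C + D).
Proof. by move=> r0 hf hg; apply: AN_add => //; apply: AN_opp. Qed.

Lemma AN_mul n r (f g : 'rV[R]_n -> R) C D : 0 <= r -> AN r f C -> AN r g D ->
  AN r (fun x => f x * g x) (C * D).
Proof.
move=> r0 + hg; have D0 := AN_ge0 r0 hg.
elim/AN_ind' => {f C} [f c m C hC hf|f F K C hF IH hK hf].
  have C0 : 0 <= C by apply: le_trans hC; rewrite mulr_ge0 ?normr_ge0 ?prod_exp_ge0.
  elim/AN_ind': hg D0 => {g D} [g c' m' D hD hg|g F K D hF IH hK hg] D0.
    apply: (@AN_mono _ _ _ (c * c') (fun i => m i + m' i)%N) => [|x bx].
      have -> : \prod_i r ^+ (m i + m' i) = \prod_i r ^+ m i * \prod_i r ^+ m' i.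
        by rewrite -big_split; apply: eq_bigr => i _; rewrite exprD.
      by rewrite normrM mulrACA ler_pM // mulr_ge0 ?normr_ge0 ?prod_exp_ge0.
    rewrite hf // hg // mulrACA; congr (_ * _).
    by rewrite /mon -big_split; apply: eq_bigr => i _; rewrite exprD.
  apply: (AN_series (K := fun k => C * K k) (F := fun k x => f x * F k x)) => [k|N|x bx].
  - by apply: IH; apply: AN_ge0 (hF k).
  - by rewrite -mulr_sumr ler_wpM2l.
  - under eq_fun do rewrite -mulr_sumr.
    by apply: cvgMr; apply: hg.
apply: (AN_series IH) => [N|x bx].
  by rewrite -mulr_suml ler_wpM2r.
under eq_fun do rewrite -mulr_suml.
by apply: cvgMl; apply: hf.
Qed.

Lemma AN_sum n r (I : Type) (s : seq I) (f : I -> 'rV[R]_n -> R) (C : I -> R) :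
  0 <= r -> (forall i, AN r (f i) (C i)) ->
  AN r (fun x => \sum_(i <- s) f i x) (\sum_(i <- s) C i).
Proof.
move=> r0 h; elim: s => [|i s IH].
  by rewrite big_nil; apply: AN_eq (AN_0 n r) _ => x _; rewrite big_nil.
rewrite big_cons; apply: AN_eq (AN_add r0 (h i) IH) _ => x _.
by rewrite big_cons.
Qed.

Lemma AN_exp n r (f : 'rV[R]_n -> R) C k : 0 <= r -> AN r f C ->
  AN r (fun x => f x ^+ k) (C ^+ k).
Proof.
move=> r0 h; elim: k => [|k IH].
  by rewrite expr0 -[X in AN _ _ X]normr1; apply: AN_cst.
rewrite exprS; apply: AN_eq (AN_mul r0 h IH) _ => x _; by rewrite exprS.
Qed.

Lemma AN_prod n r (I : Type) (s : seq I) (f : I -> 'rV[R]_n -> R) (C : I -> R) :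
  0 <= r -> (forall i, AN r (f i) (C i)) ->
  AN r (fun x => \prod_(i <- s) f i x) (\prod_(i <- s) C i).
Proof.
move=> r0 h; elim: s => [|i s IH].
  rewrite big_nil -[X in AN _ _ X]normr1; apply: AN_eq (AN_cst n r 1) _ => x _.
  by rewrite big_nil.
rewrite big_cons; apply: AN_eq (AN_mul r0 (h i) IH) _ => x _.
by rewrite big_cons.
Qed.

Lemma AN_radius n r s (f : 'rV[R]_n -> R) C : 0 <= s -> s <= r -> AN r f C -> AN s f C.
Proof.
move=> s0 sr; have bsr x : box s x -> box r x.
  by move=> bx i; apply: le_trans sr.
elim/AN_ind' => {f C} [f c m C hC hf|f F K C hF IH hK hf].
  apply: (@AN_mono _ _ _ c m) => [|x /bsr]; last exact: hf.
  apply: le_trans hC; rewrite ler_wpM2l ?normr_ge0 // ler_prod // => i _.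
  by rewrite exprn_ge0 //= lerXn2r ?nnegrE // (le_trans s0).
by apply: (AN_series IH hK) => x /bsr; apply: hf.
Qed.

(** Majorants do the work: if the coordinates of q have norm at most r at radius s, a monomial
    composed with q has norm at most that of the monomial at radius r, so nothing is expanded
    again. *)
Lemma AN_comp n k r s (f : 'rV[R]_n -> R) C (q : 'rV[R]_k -> 'rV[R]_n) :
  0 <= s -> AN r f C -> (forall i, AN s (fun x => q x 0 i) r) ->
  AN s (fun x => f (q x)) C.
Proof.
move=> s0 + hq.
have bq x : box s x -> box r (q x) by move=> bx i; apply: AN_bound (hq i) bx.
elim/AN_ind' => {f C} [f c m C hC hf|f F K C hF IH hK hf].
  have := AN_scale c (AN_prod (index_enum 'I_n) s0 (fun i => AN_exp (m i) s0 (hq i))).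
  move=> /AN_le /(_ hC) /AN_eq; apply => x bx.
  by rewrite hf //; apply: bq.
by apply: (AN_series IH hK) => x /bq; apply: hf.
Qed.

Definition fsum n (F : nat -> 'rV[R]_n -> R) x := limn (fun N => \sum_(k < N) F k x).

Lemma nondecr_psum (K : nat -> R) : (forall k, 0 <= K k) ->
  nondecreasing_seq (fun N => \sum_(k < N) K k).
Proof.
by move=> K0; apply/nondecreasing_seqP => N; rewrite big_ord_recr lerDl.
Qed.

Lemma fsum_cvg n r (F : nat -> 'rV[R]_n -> R) (K : nat -> R) C x :
  0 <= r -> (forall k, AN r (F k) (K k)) -> (forall N, \sum_(k < N) K k <= C) ->
  box r x -> (fun N => \sum_(k < N) F k x) @ \oo --> fsum F x.
Proof.
move=> r0 hF hK bx; have K0 k := AN_ge0 r0 (hF k).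
have E (T : nat -> R) : series T = (fun N => \sum_(k < N) T k).
  by apply/funext => N; rewrite seriesEord.
suff: cvgn (series (fun k => F k x)) by rewrite E.
apply: normed_cvg; rewrite /normed_series_of /= E.
apply: nondecreasing_is_cvgn; first exact: (@nondecr_psum (fun k => `|F k x|)).
exists C => _ [N _ <-]; apply: le_trans (hK N); apply: ler_sum => k _.
exact: AN_bound (hF k) bx.
Qed.

Lemma AN_fsum n r (F : nat -> 'rV[R]_n -> R) (K : nat -> R) C :
  0 <= r -> (forall k, AN r (F k) (K k)) -> (forall N, \sum_(k < N) K k <= C) ->
  AN r (fsum F) C.
Proof.
move=> r0 hF hK; apply: (AN_series hF hK) => x bx; exact: fsum_cvg hF hK bx.
Qed.

Definition zeroc n (i : 'I_n) (x : 'rV[R]_n) : 'rV[R]_n :=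
  \row_j if j == i then 0 else x 0 j.

(** Monomials free of x_i cancel in the difference; the others lose one factor x_i, which divides
    their norm by r. *)
Lemma AN_divc n r (f : 'rV[R]_n -> R) C i : 0 < r -> AN r f C ->
  exists2 g, AN r g (C / r) & forall x, box r x -> f x - f (zeroc i x) = x 0 i * g x.
Proof.
move=> r0; have r0' := ltW r0.
have bz x : box r x -> box r (zeroc i x).
  by move=> bx j; rewrite mxE; case: eqP => _ //; rewrite normr0.
elim/AN_ind' => {f C} [f c m C hC hf|f F K C hF IH hK hf].
  have [mi0|mi0] := posnP (m i).
    exists (fun=> 0) => [|x bx].
      apply: AN_le (AN_0 n r) _; rewrite divr_ge0 //.
      by apply: le_trans hC; rewrite mulr_ge0 ?normr_ge0 ?prod_exp_ge0.
    rewrite mulr0; apply/eqP; rewrite subr_eq0; apply/eqP.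
    rewrite !hf //; last exact: bz.
    congr (_ * _); apply: eq_bigr => j _; rewrite mxE; case: eqP => // ->.
    by rewrite mi0 !expr0.
  pose m' j := if j == i then (m j).-1 else m j.
  have E (X : 'I_n -> R) : \prod_j X j ^+ m j = X i * \prod_j X j ^+ m' j.
    rewrite (bigD1 i) //= [in RHS](bigD1 i) //= {1}/m' eqxx mulrA -exprS prednK //.
    by congr (_ * _); apply: eq_bigr => j /negbTE ji; rewrite /m' ji.
  exists (fun x => c * mon m' x) => [|x bx].
    apply: (@AN_mono _ _ _ c m') => //.
    by rewrite ler_pdivlMr // -mulrA [_ * r]mulrC -E.
  rewrite (hf _ bx) (hf _ (bz _ bx)) {2}/mon E mxE eqxx mul0r mulr0 subr0.
  by rewrite /mon E mulrCA.
have /choice[G hG] k : exists g, AN r g (K k / r) /\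
    forall x, box r x -> F k x - F k (zeroc i x) = x 0 i * g x.
  by have [g g1 g2] := IH k; exists g.
have hG1 k : AN r (G k) (K k / r) by have [] := hG k.
have hGC N : \sum_(k < N) K k / r <= C / r by rewrite -mulr_suml ler_wpM2r ?invr_ge0.
exists (fsum G); first by exact: (AN_fsum r0' hG1 hGC).
move=> x bx.
have h1 : (fun N => \sum_(k < N) (F k x - F k (zeroc i x))) @ \oo --> f x - f (zeroc i x).
  under eq_fun do rewrite sumrB.
  by apply: cvgB; apply: hf => //; apply: bz.
have h2 : (fun N => \sum_(k < N) (F k x - F k (zeroc i x))) @ \oo --> x 0 i * fsum G x.
  rewrite (_ : (fun N => _) = fun N => x 0 i * \sum_(k < N) G k x); last first.
    apply/funext => N; rewrite mulr_sumr; apply: eq_bigr => k _.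
    by have [_ ->] := hG k.
  by apply: cvgMr; exact: (fsum_cvg r0' hG1 hGC bx).
exact: cvg_unique h1 h2.
Qed.

(** Constants cancel, and any other monomial has a factor that shrinks by s / r. Germs vanishing at
    0 thus have arbitrarily small norm on small polydiscs, which composition and fixed points rely
    on. *)
Lemma AN_sub0 n r s (f : 'rV[R]_n -> R) C : 0 < r -> 0 <= s <= r -> AN r f C ->
  AN s (fun x => f x - f 0) (C * (s / r)).
Proof.
move=> r0 /andP[s0 sr]; have r0' := ltW r0.
have b0 : box s (0 : 'rV[R]_n) by move=> i; rewrite mxE normr0.
have b0' : box r (0 : 'rV[R]_n) by move=> i; rewrite mxE normr0.
elim/AN_ind' => {f C} [f c m C hC hf|f F K C hF IH hK hf].
  have hs x : box s x -> box r x by move=> bx i; apply: le_trans sr.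
  have C0 : 0 <= C by apply: le_trans hC; rewrite mulr_ge0 ?normr_ge0 ?prod_exp_ge0.
  have sr0 : 0 <= s / r by rewrite divr_ge0.
  have [m0|/existsNP[i mi0]] := pselect (forall i, m i = 0%N).
    apply: AN_le (_ : AN s _ 0) _; last by rewrite mulr_ge0.
    apply: AN_eq (AN_0 n s) _ => x /hs bx; rewrite !hf // /mon.
    by rewrite -mulrBr ![\prod_i _]big1 ?subrr ?mulr0 // => i _; rewrite m0 expr0.
  apply: (@AN_mono _ _ _ c m) => [|x /hs bx]; last first.
    rewrite !hf //; suff -> : mon m (0 : 'rV[R]_n) = 0 by rewrite mulr0 subr0.
    rewrite /mon (bigD1 i) //= mxE expr0n; case: (m i) mi0 => //= k _.
    by rewrite mul0r.
  apply: (@le_trans _ _ (`|c| * \prod_i r ^+ m i * (s / r))); last by rewrite ler_wpM2r.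
  rewrite -mulrA ler_wpM2l ?normr_ge0 //.
  rewrite (bigD1 i) //= [in leRHS](bigD1 i) //= mulrAC ler_pM //.
  - by rewrite exprn_ge0.
  - by apply: prodr_ge0 => j _; rewrite exprn_ge0.
  - case: (m i) mi0 => // k _; rewrite !exprSr -mulrA (mulrC r) divfK ?gt_eqF //.
    by rewrite ler_wpM2r // lerXn2r // nnegrE.
  - apply: ler_prod => j _; rewrite exprn_ge0 //=.
    by rewrite lerXn2r // nnegrE.
apply: (AN_series IH) => [N|x bx].
  by rewrite -mulr_suml ler_wpM2r // divr_ge0.
under eq_fun do rewrite sumrB.
apply: cvgB; apply: hf => // i; exact: le_trans (bx i) sr.
Qed.

End AN.

(** * Analytic germs at 0 *)

Section Germs.
Context {R : realType}.
Implicit Types (r s C D e : R).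

Definition near0 n (P : 'rV[R]_n -> Prop) := exists2 r : R, 0 < r & forall x, box r x -> P x.

Definition an n (f : 'rV[R]_n -> R) := exists r C, 0 < r /\ AN r f C.

Definition anmap n k (q : 'rV[R]_n -> 'rV[R]_k) := forall i, an (fun x => q x 0 i).

Lemma box_le n r s (x : 'rV[R]_n) : box r x -> r <= s -> box s x.
Proof. by move=> b rs i; apply: le_trans rs. Qed.

Lemma box0 n r : 0 <= r -> box r (0 : 'rV[R]_n).
Proof. by move=> r0 i; rewrite mxE normr0. Qed.

Lemma near0_0 n (P : 'rV[R]_n -> Prop) : near0 P -> P 0.
Proof. by case=> r r0; apply; apply/box0/ltW. Qed.

Lemma near0_T n (P : 'rV[R]_n -> Prop) : (forall x, P x) -> near0 P.
Proof. by move=> h; exists 1 => // x _; apply: h. Qed.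

Lemma near0_imp n (P Q : 'rV[R]_n -> Prop) : (forall x, P x -> Q x) -> near0 P -> near0 Q.
Proof. by move=> PQ [r r0 h]; exists r => // x /h /PQ. Qed.

Lemma near0_and n (P Q : 'rV[R]_n -> Prop) : near0 P -> near0 Q -> near0 (fun x => P x /\ Q x).
Proof.
move=> [r r0 hP] [s s0 hQ]; exists (Num.min r s); first by rewrite lt_min r0.
by move=> x b; split; [apply: hP|apply: hQ]; apply: box_le b _; rewrite ge_min lexx ?orbT.
Qed.

Lemma near0_imp2 n (P Q S : 'rV[R]_n -> Prop) :
  (forall x, P x -> Q x -> S x) -> near0 P -> near0 Q -> near0 S.
Proof. by move=> h hP hQ; apply: near0_imp (near0_and hP hQ) => x []; exact: h. Qed.

Lemma near0_all n (I : finType) (P : I -> 'rV[R]_n -> Prop) :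
  (forall i, near0 (P i)) -> near0 (fun x => forall i, P i x).
Proof.
move=> h; suff: near0 (fun x => forall i, i \in enum I -> P i x).
  by apply: near0_imp => x hx i; apply: hx; rewrite mem_enum.
elim: (enum I) => [|i s IH]; first exact: near0_T.
apply: near0_imp2 (h i) IH => x Pi hs j; rewrite inE => /orP[/eqP -> //|]; exact: hs.
Qed.

Lemma near0_box n r : 0 < r -> near0 (@box R n r).
Proof. by exists r. Qed.

Lemma an_AN n (f : 'rV[R]_n -> R) r C : 0 < r -> AN r f C -> an f.
Proof. by exists r, C. Qed.

Lemma an_eq n (f g : 'rV[R]_n -> R) : an f -> near0 (fun x => f x = g x) -> an g.
Proof.
move=> [r [C [r0 hf]]] [s s0 fg]; exists (Num.min r s), C; split.
  by rewrite lt_min r0.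
have m0 : 0 < Num.min r s by rewrite lt_min r0.
apply: AN_eq (AN_radius (ltW m0) _ hf) _; first by rewrite ge_min lexx.
by move=> x b; apply: fg; apply: box_le b _; rewrite ge_min lexx orbT.
Qed.

Lemma an_ext n (f g : 'rV[R]_n -> R) : an f -> f =1 g -> an g.
Proof. by move=> hf fg; apply: an_eq hf _; apply: near0_T. Qed.

Lemma an_cst n c : an (fun _ : 'rV[R]_n => c).
Proof. by exists 1, `|c|; split=> //; apply: AN_cst. Qed.

Lemma an_coord n i : an (fun x : 'rV[R]_n => x 0 i).
Proof. by exists 1, 1; split=> //; apply: AN_coord. Qed.

Lemma an_2 n (f g h : 'rV[R]_n -> R) :
  (forall r C D, 0 < r -> AN r f C -> AN r g D -> an h) -> an f -> an g -> an h.
Proof.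
move=> H [r [C [r0 hf]]] [s [D [s0 hg]]].
have m0 : 0 < Num.min r s by rewrite lt_min r0.
apply: (H (Num.min r s) C D m0).
  by apply: AN_radius (ltW m0) _ hf; rewrite ge_min lexx.
by apply: AN_radius (ltW m0) _ hg; rewrite ge_min lexx orbT.
Qed.

Lemma an_add n (f g : 'rV[R]_n -> R) : an f -> an g -> an (fun x => f x + g x).
Proof. by apply: an_2 => r C D r0 hf hg; exact: an_AN (AN_add (ltW r0) hf hg). Qed.

Lemma an_mul n (f g : 'rV[R]_n -> R) : an f -> an g -> an (fun x => f x * g x).
Proof. by apply: an_2 => r C D r0 hf hg; exact: an_AN (AN_mul (ltW r0) hf hg). Qed.

Lemma an_opp n (f : 'rV[R]_n -> R) : an f -> an (fun x => - f x).
Proof. by move=> [r [C [r0 hf]]]; exact: an_AN (AN_opp hf). Qed.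

Lemma an_sub n (f g : 'rV[R]_n -> R) : an f -> an g -> an (fun x => f x - g x).
Proof. by move=> hf hg; apply/an_add/an_opp. Qed.

Lemma an_exp n (f : 'rV[R]_n -> R) k : an f -> an (fun x => f x ^+ k).
Proof. by move=> [r [C [r0 hf]]]; exact: an_AN (AN_exp k (ltW r0) hf). Qed.

Lemma an_sum n (I : Type) (s : seq I) (f : I -> 'rV[R]_n -> R) :
  (forall i, an (f i)) -> an (fun x => \sum_(i <- s) f i x).
Proof.
move=> h; elim: s => [|i s IH].
  by apply: an_ext (an_cst n 0) _ => x; rewrite big_nil.
by apply: an_ext (an_add (h i) IH) _ => x; rewrite big_cons.
Qed.

Lemma an_prod n (I : Type) (s : seq I) (f : I -> 'rV[R]_n -> R) :
  (forall i, an (f i)) -> an (fun x => \prod_(i <- s) f i x).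
Proof.
move=> h; elim: s => [|i s IH].
  by apply: an_ext (an_cst n 1) _ => x; rewrite big_nil.
by apply: an_ext (an_mul (h i) IH) _ => x; rewrite big_cons.
Qed.

Lemma an_mon n m : an (@mon R n m).
Proof. by apply: an_prod => i; apply/an_exp/an_coord. Qed.

Lemma an_small n (f : 'rV[R]_n -> R) : an f -> forall e, 0 < e ->
  exists2 s, 0 < s & AN s (fun x => f x - f 0) e.
Proof.
move=> [r [C [r0 hf]]] e e0; have C0 := AN_ge0 (ltW r0) hf.
have C1 : 0 < C + 1 by rewrite ltr_wpDl.
exists (Num.min r (e * r / (C + 1))).
  by rewrite lt_min r0 divr_gt0 ?mulr_gt0.
set s := Num.min _ _.
have s0 : 0 <= s by rewrite le_min ltW //= divr_ge0 // ?ltW // mulr_gt0.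
apply: AN_le (AN_sub0 r0 _ hf) _; first by rewrite s0 ge_min lexx.
have : s <= e * r / (C + 1) by rewrite ge_min lexx orbT.
rewrite mulrA ler_pdivrMr //; rewrite ler_pdivlMr // => h.
by apply: le_trans h; rewrite mulrC ler_wpM2l // lerDl.
Qed.

Lemma an_cont n (f : 'rV[R]_n -> R) : an f -> forall e, 0 < e ->
  near0 (fun x => `|f x - f 0| < e).
Proof.
move=> hf e e0; have e2 : 0 < e / 2 by lra.
have [s s0 hs] := an_small hf e2.
exists s => // x bx; have := AN_bound hs bx => /le_lt_trans; apply; lra.
Qed.

Lemma an_neq0 n (f : 'rV[R]_n -> R) : an f -> f 0 != 0 -> near0 (fun x => f x != 0).
Proof.
move=> hf f0; have f0' : 0 < `|f 0| by rewrite normr_gt0.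
apply: near0_imp (an_cont hf f0') => x; apply: contraTneq => ->.
by rewrite sub0r normrN ltxx.
Qed.

Lemma an_gt0 n (f : 'rV[R]_n -> R) : an f -> 0 < f 0 -> near0 (fun x => 0 < f x).
Proof.
move=> hf f0; apply: near0_imp (an_cont hf f0) => x.
rewrite ltr_norml => /andP[+ _]; lra.
Qed.

Lemma anmap_small n k (q : 'rV[R]_n -> 'rV[R]_k) : anmap q -> q 0 = 0 ->
  forall e, 0 < e -> exists2 s, 0 < s & forall i, AN s (fun x => q x 0 i) e.
Proof.
move=> hq q0 e e0.
suff [s s0 hs] : exists2 s, 0 < s & forall i, i \in enum 'I_k -> AN s (fun x => q x 0 i) e.
  by exists s => // i; apply: hs; rewrite mem_enum.
elim: (enum 'I_k) => [|i t [s s0 IH]]; first by exists 1.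
have [s' s'0 hs'] := an_small (hq i) e0.
have m0 : 0 < Num.min s s' by rewrite lt_min s0.
exists (Num.min s s') => // j; rewrite inE => /orP[/eqP -> |jt].
  apply: AN_eq (AN_radius (ltW m0) _ hs') _; first by rewrite ge_min lexx orbT.
  by move=> x _; rewrite q0 mxE subr0.
by apply: AN_radius (ltW m0) _ (IH j jt); rewrite ge_min lexx.
Qed.

Lemma near0_comp n k (q : 'rV[R]_n -> 'rV[R]_k) (P : 'rV[R]_k -> Prop) :
  anmap q -> q 0 = 0 -> near0 P -> near0 (fun x => P (q x)).
Proof.
move=> hq q0 [r r0 hP]; have [s s0 hs] := anmap_small hq q0 r0.
exists s => // x bx; apply: hP => i; exact: AN_bound (hs i) bx.
Qed.

Lemma an_comp n k (q : 'rV[R]_n -> 'rV[R]_k) (f : 'rV[R]_k -> R) :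
  anmap q -> q 0 = 0 -> an f -> an (fun x => f (q x)).
Proof.
move=> hq q0 [r [C [r0 hf]]]; have [s s0 hs] := anmap_small hq q0 r0.
by exists s, C; split => //; apply: AN_comp (ltW s0) hf hs.
Qed.

Lemma anmap_comp n k l (q : 'rV[R]_n -> 'rV[R]_k) (p : 'rV[R]_k -> 'rV[R]_l) :
  anmap q -> q 0 = 0 -> anmap p -> anmap (fun x => p (q x)).
Proof. by move=> hq q0 hp i; apply: (an_comp hq q0 (hp i)). Qed.

Lemma AN_recenter n r s (f : 'rV[R]_n -> R) C w : 0 <= s -> AN (r + s) f C -> box r w ->
  AN s (fun x => f (w + x)) C.
Proof.
move=> s0 hf bw; apply: (AN_comp s0 hf) => i.
apply: AN_le (AN_eq (AN_add s0 (AN_cst _ _ (w 0 i)) (AN_coord s i)) _) _.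
  by move=> x _; rewrite mxE.
by rewrite lerD2r.
Qed.

Lemma an_divc n (f : 'rV[R]_n -> R) i : an f ->
  exists2 g, an g & near0 (fun x => f x - f (zeroc i x) = x 0 i * g x).
Proof.
move=> [r [C [r0 /(AN_divc i r0)[g hg1 hg2]]]]; exists g; first exact: an_AN hg1.
by exists r.
Qed.

Lemma AN_geo : @AN R 1 2^-1 (fun x : 'rV[R]_1 => (1 - x 0 0)^-1) 2.
Proof.
have h2 : (2^-1 : R) >= 0 by rewrite invr_ge0.
apply: (@AN_series _ _ _ _ (fun k (x : 'rV[R]_1) => x 0 0 ^+ k) (fun k => 2^-1 ^+ k)) => [k|N|x bx].
- exact/AN_exp/AN_coord.
- have := @subrX1 R 2^-1 N; rewrite [X in _ = X * _](_ : _ = - 2^-1); last by lra.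
  have : 0 <= (2^-1 : R) ^+ N by rewrite exprn_ge0.
  set S := \sum_(i < N) _; lra.
- have x1 : `|x 0 0| < 1 by apply: le_lt_trans (bx 0) _; lra.
  have := @cvg_geometric_series R 1 (x 0 0) x1; rewrite mul1r.
  rewrite (_ : series _ = fun N : nat => \sum_(k < N) x 0 0 ^+ k) //.
  apply/funext => N; rewrite seriesEord; apply: eq_bigr => k _; by rewrite /geometric /= mul1r.
Qed.

Lemma an_inv n (f : 'rV[R]_n -> R) : an f -> f 0 != 0 -> an (fun x => (f x)^-1).
Proof.
move=> hf f0.
pose t : 'rV[R]_n -> 'rV[R]_1 := fun x => \row_i (1 - f x / f 0).
have ht : anmap t.
  move=> i; apply: an_ext (an_sub (an_cst n 1) (an_mul hf (an_cst n (f 0)^-1))) _ => x.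
  by rewrite mxE.
have t0 : t 0 = 0 by apply/rowP => i; rewrite !mxE divff // subrr.
have hg : an (fun x => (1 - t x 0 0)^-1).
  by apply: (an_comp ht t0 (f := fun x : 'rV[R]_1 => (1 - x 0 0)^-1)); exact: an_AN AN_geo.
apply: an_ext (an_mul (an_cst n (f 0)^-1) hg) _ => x.
by rewrite mxE subKr invf_div mulrA mulVf // mul1r.
Qed.

(** Divide by x as long as the quotient vanishes at 0. If this never stops, |f x| <= C (|x| / r)^d
    for every d, so f is 0. *)
Lemma AN_order1 r (f : 'rV[R]_1 -> R) C : 0 < r -> AN r f C ->
  (forall x : 'rV[R]_1, `|x 0 0| < r -> f x = 0) \/
  exists d u, [/\ AN r u (C / r ^+ d), u 0 != 0 & forall x : 'rV[R]_1, box r x -> f x = x 0 0 ^+ d * u x].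
Proof.
move=> r0 hf; have C0 := AN_ge0 (ltW r0) hf.
have [|/asboolPn/forallp_asboolPn hno] := pselect (exists d u, [/\ AN r u (C / r ^+ d), u 0 != 0 &
    forall x : 'rV[R]_1, box r x -> f x = x 0 0 ^+ d * u x]); first by right.
left.
have step d : exists2 u, AN r u (C / r ^+ d) & forall x : 'rV[R]_1, box r x -> f x = x 0 0 ^+ d * u x.
  elim: d => [|d [u hu1 hu2]].
    by exists f => [|x _]; rewrite expr0 ?divr1 // mul1r.
  have u0 : u 0 = 0.
    by apply/eqP; apply: contrapT => /negP un; apply: (hno d); exists u.
  have [g hg1 hg2] := AN_divc 0 r0 hu1; exists g.
    by rewrite exprS [r * _]mulrC invfM mulrA.
  move=> x bx; rewrite hu2 // exprSr -mulrA -hg2 // (_ : zeroc 0 x = 0) ?u0 ?subr0 //.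
  by apply/rowP => i; rewrite !mxE ord1 eqxx.
move=> x xr; have bx : box r x by move=> i; rewrite ord1 ltW.
have q0 : 0 <= `|x 0 0| / r by rewrite divr_ge0 // ltW.
have q1 : `|x 0 0| / r < 1 by rewrite ltr_pdivrMr // mul1r.
apply/eqP; rewrite -normr_le0.
have hl : (fun d => C * (`|x 0 0| / r) ^+ d) @ \oo --> C * 0.
  by apply: cvgMr; apply: cvg_expr; rewrite ger0_norm.
rewrite mulr0 in hl; apply: (cvgr_to_ge hl).
- apply: nearW => d; have [u hu ->] := step d; last exact: bx.
  rewrite normrM normrX exprMn exprVn mulrCA ler_wpM2l ?exprn_ge0 //.
  exact: AN_bound hu bx.
Qed.

End Germs.

(** * The identity theorem, and germs that are monomials times units *)

Section Ident.
Context {R : realType}.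
Implicit Types (r s C D e : R).

(** Vanishing near t spreads to the interval of radius r - |t| about t, by recentring and the order
    dichotomy. Moves of t towards 0 multiply r - |t| by 3/2, so after finitely many of them this
    interval contains 0, and a last recentring at 0 covers everything. *)
Lemma AN_ident1 r (f : 'rV[R]_1 -> R) C t0 e : 0 < r -> AN r f C -> `|t0| < r -> 0 < e ->
  (forall x : 'rV[R]_1, `|x 0 0 - t0| < e -> f x = 0) ->
  forall x : 'rV[R]_1, `|x 0 0| < r -> f x = 0.
Proof.
move=> r0 hf.
have key t (e' : R) : `|t| < r -> 0 < e' -> (forall x : 'rV[R]_1, `|x 0 0 - t| < e' -> f x = 0) ->
    forall x : 'rV[R]_1, `|x 0 0 - t| < r - `|t| -> f x = 0.
  move=> tr e'0 h0; pose w : 'rV[R]_1 := const_mx t.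
  have s0 : 0 < r - `|t| by rewrite subr_gt0.
  have hs : AN (r - `|t|) (fun x => f (w + x)) C.
    apply: (AN_recenter (r := `|t|)) => //; first exact: ltW.
      by rewrite addrC subrK.
    by move=> i; rewrite mxE.
  have wK x : w + (x - w) = x by rewrite addrC subrK.
  have [h|[d [u [hu u0 h]]]] := AN_order1 s0 hs.
    by move=> x hx; rewrite -[x]wK; apply: h; rewrite !mxE.
  exfalso; have [e1 e10 he1] := an_neq0 (an_AN s0 hu) u0.
  pose e2 := Num.min (e' / 2) (Num.min e1 (r - `|t|)).
  have e20 : 0 < e2 by rewrite /e2 !lt_min e10 s0 divr_gt0.
  have e2n : `|e2| = e2 by rewrite gtr0_norm.
  have E := h (const_mx e2); have be : box (r - `|t|) (const_mx e2 : 'rV[R]_1).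
    by move=> i; rewrite mxE e2n /e2 !ge_min lexx !orbT.
  have be1 : box e1 (const_mx e2 : 'rV[R]_1).
    by move=> i; rewrite mxE e2n /e2 !ge_min lexx !orbT.
  have := E be; rewrite h0.
    move/esym/eqP; rewrite mulf_eq0 (negbTE (he1 _ be1)) orbF expf_eq0 mxE.
    by rewrite (gt_eqF e20) andbF.
  rewrite (_ : _ - t = e2); last by rewrite !mxE; ring.
  rewrite e2n; apply: (@le_lt_trans _ _ (e' / 2)); last lra.
  by rewrite /e2 ge_min lexx.
have fin t (e' : R) : `|t| < r -> 0 < e' -> (forall x : 'rV[R]_1, `|x 0 0 - t| < e' -> f x = 0) ->
    `|t| < r - `|t| -> forall x : 'rV[R]_1, `|x 0 0| < r -> f x = 0.
  move=> tr e'0 h0 tt x xr.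
  apply: (key 0 (r - `|t| - `|t|)); rewrite ?normr0 ?subr0 //; first by lra.
  move=> y; rewrite subr0 => hy; apply: (key t e') => //.
  by apply: le_lt_trans (ler_normB _ _) _; lra.
move=> t0r e0 h0.
have [k] : exists k, r <= (3 / 2) ^+ k * (r - `|t0|).
  have d0 : 0 < r - `|t0| by rewrite subr_gt0.
  have : exists k, r / (r - `|t0|) <= (3 / 2) ^+ k.
    have q0 : 0 <= r / (r - `|t0|) by rewrite divr_ge0 // ltW.
    pose N := (Num.truncn (r / (r - `|t0|))).+1; exists (2 * N)%N.
    have hN : r / (r - `|t0|) < N%:R by rewrite /N; exact: truncnS_gt.
    move: N hN => N hN.
    apply: (le_trans (ltW hN)); elim: N {hN} => [|N IH]; first by rewrite exprn_ge0.
    rewrite mulnS exprD -natr1 addrC; have : 1 <= ((3 / 2 : R) ^+ (2 * N)).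
      by rewrite exprn_ege1 //; lra.
    set a := _ ^+ (2 * N) in IH *; rewrite expr2; nra.
  by move=> [k hk]; exists k; rewrite -ler_pdivrMr.
elim: k t0 e t0r e0 h0 => [|k IH] t e' tr e'0 h0.
  rewrite expr0 mul1r => hk; apply: (fin t e') => //.
  have := normr_ge0 t; lra.
have [hh _|hh hk] := ltP `|t| (r - `|t|); first exact: (fin t e').
have tp : 0 < `|t| by lra.
(* t is moved towards 0 by half the radius r - |t| of the interval on which f is known to vanish. *)
pose t1 := t * (1 - (r - `|t|) / (2 * `|t|)).
have q1 : (r - `|t|) / (2 * `|t|) <= 2^-1.
  by rewrite ler_pdivrMr ?mulr_gt0 //; lra.
have t1n : `|t1| = `|t| - (r - `|t|) / 2.
  rewrite normrM [X in _ * X]ger0_norm; last by lra.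
  by field; rewrite gt_eqF.
have tt1 : `|t1 - t| = (r - `|t|) / 2.
  rewrite (_ : t1 - t = - (t * ((r - `|t|) / (2 * `|t|)))); last by rewrite /t1; ring.
  have q0 : 0 <= (r - `|t|) / (2 * `|t|) by rewrite divr_ge0 //; lra.
  rewrite normrN normrM [X in _ * X]ger0_norm //.
  by field; rewrite gt_eqF.
apply: (IH t1 ((r - `|t|) / 2)) => [|||]; rewrite ?t1n; try lra.
- move=> x hx; apply: (key t e') => //.
  rewrite (_ : _ - t = (x 0 0 - t1) + (t1 - t)); last by ring.
  by apply: le_lt_trans (ler_normD _ _) _; lra.
- rewrite (_ : r - _ = 3 / 2 * (r - `|t|)); last by lra.
  by rewrite mulrA -exprSr.
Qed.

Lemma box_lt n r (x : 'rV[R]_n) : 0 < r -> (forall i, `|x 0 i| < r) ->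
  exists2 r', 0 <= r' < r & box r' x.
Proof.
move=> r0 h; exists (\big[Num.max/0]_i `|x 0 i|); last by move=> i; exact: le_bigmax.
by rewrite bigmax_ge_id /= bigmax_lt.
Qed.

(** Restriction to the line through w and x, parametrised with w at -1 and x at 1. Both points lie
    in a box of radius r' < r, which leaves room for a domain of radius rho > 1. *)
Lemma AN_ident n r (f : 'rV[R]_n -> R) C (w : 'rV[R]_n) e : 0 < r -> AN r f C -> 0 < e ->
  (forall i, `|w 0 i| < r) ->
  (forall x : 'rV[R]_n, box e (x - w) -> f x = 0) ->
  forall x : 'rV[R]_n, (forall i, `|x 0 i| < r) -> f x = 0.
Proof.
move=> r0 hf e0 wr h0 x xr.
have [r1 /andP[r10 r1r] b1] := box_lt r0 wr.
have [r2 /andP[r20 r2r] b2] := box_lt r0 xr.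
pose r' := Num.max r1 r2.
have r'r : r' < r by rewrite gt_max r1r.
have r'0 : 0 <= r' by rewrite le_max r10.
have bw : box r' w by apply: box_le b1 _; rewrite le_max lexx.
have bx : box r' x by apply: box_le b2 _; rewrite le_max lexx orbT.
pose rho := 1 + (r - r') / r.
have q0 : 0 < (r - r') / r by rewrite divr_gt0 // subr_gt0.
have rho0 : 0 < rho by rewrite /rho; lra.
pose q (t : 'rV[R]_1) : 'rV[R]_n := \row_i ((w 0 i + x 0 i) / 2 + (x 0 i - w 0 i) / 2 * t 0 0).
have hq i : AN rho (fun t => q t 0 i) r.
  have := AN_add (ltW rho0) (AN_cst 1 rho ((w 0 i + x 0 i) / 2))
     (AN_scale ((x 0 i - w 0 i) / 2) (AN_coord rho (0 : 'I_1))).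
  move=> /AN_le; set K := _ + _; suff Kr : K <= r.
    by move=> /(_ _ Kr) /AN_eq; apply => t _; rewrite mxE.
  have h1 : `|(w 0 i + x 0 i) / 2| + `|(x 0 i - w 0 i) / 2| <= r'.
    have := bw i; have := bx i.
    rewrite !ler_norml => /andP[? ?] /andP[? ?].
    by case: (ger0P ((w 0 i + x 0 i) / 2)); case: (ger0P ((x 0 i - w 0 i) / 2)); lra.
  have h2 : `|(x 0 i - w 0 i) / 2| <= r.
    by have := normr_ge0 ((w 0 i + x 0 i) / 2); lra.
  rewrite /K /rho mulrDr mulr1 addrA.
  have : `|(x 0 i - w 0 i) / 2| * ((r - r') / r) <= r * ((r - r') / r).
    by rewrite ler_wpM2r // ltW.
  rewrite [r * _]mulrC divfK ?gt_eqF //; lra.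
have hphi := AN_comp (ltW rho0) hf hq.
have qm1 : q (const_mx 1) = x by apply/rowP => i; rewrite !mxE; field.
rewrite -qm1.
apply: (AN_ident1 (r := rho) (t0 := -1) (e := e / r) rho0 hphi) => //.
- by rewrite normrN1 /rho; lra.
- by rewrite divr_gt0.
- move=> t ht; apply: h0 => i; rewrite !mxE.
  rewrite (_ : _ - w 0 i = (x 0 i - w 0 i) / 2 * (t 0 0 - -1)); last by field.
  rewrite normrM; have : `|(x 0 i - w 0 i) / 2| <= r.
    have := bw i; have := bx i.
    by rewrite !ler_norml => /andP[? ?] /andP[? ?]; apply/andP; split; lra.
  move=> hh; apply: (@le_trans _ _ (r * (e / r))); first by rewrite ler_pM // ltW.
  by rewrite mulrC divfK ?gt_eqF.
- by rewrite mxE normr1 /rho; lra.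
Qed.

(** A point w close to 0 with f w nonzero has a neighbourhood on which g vanishes, and the identity
    theorem carries this back to a box around 0. *)
Lemma near0_domain n (f g : 'rV[R]_n -> R) : an f -> an g ->
  near0 (fun x => f x * g x = 0) -> near0 (fun x => f x = 0) \/ near0 (fun x => g x = 0).
Proof.
move=> [r [C [r0 hf]]] [s [D [s0 hg]]] [t h0 ht].
have [|nf] := pselect (near0 (fun x => f x = 0)); first by left.
right; pose p := Num.min r (Num.min s t).
have p0 : 0 < p by rewrite !lt_min r0 s0.
have [pr [ps pt]] : p <= r /\ p <= s /\ p <= t by rewrite /p !ge_min !lexx !orbT.
have [w bw fw] : exists2 w, box (p / 2) w & f w != 0.
  apply: contrapT => hn; apply: nf; exists (p / 2); first by rewrite divr_gt0.
  move=> x bx; apply/eqP; apply: contrapT => /negP fx; apply: hn; by exists x.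
have pp : p / 2 + p / 2 = p by lra.
have hfw : an (fun x => f (w + x)).
  apply: (@an_AN _ _ _ (p / 2) C); first by rewrite divr_gt0.
  apply: (AN_recenter (r := p / 2)) bw; first by lra.
  by rewrite pp; apply: AN_radius hf => //; exact: ltW.
have fw0 : f (w + 0) != 0 by rewrite addr0.
have [e e0 he] := an_neq0 hfw fw0.
have hg' : AN p g D by apply: AN_radius hg => //; exact: ltW.
have hz : forall x, box (Num.min e (p / 2)) (x - w) -> g x = 0.
  move=> x bx; have xw : w + (x - w) = x by rewrite addrC subrK.
  have : f x * g x = 0.
    apply: ht => i; apply: le_trans pt; rewrite -xw !mxE.
    apply: le_trans (ler_normD _ _) _; rewrite -pp; apply: lerD; first exact: bw.
    have := bx i; rewrite !mxE => /le_trans; apply; by rewrite ge_min lexx orbT.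
  move/eqP; rewrite mulf_eq0 => /orP[|/eqP //] /eqP fx.
  have := he (x - w); rewrite xw fx eqxx => hc; have : false; last by [].
  apply: hc; apply: box_le bx _; by rewrite ge_min lexx.
exists (p / 2); first by lra.
move=> x bx; apply: (AN_ident (w := w) (e := Num.min e (p / 2)) p0 hg') => //.
- by rewrite lt_min e0 divr_gt0.
- by move=> i; apply: le_lt_trans (bw i) _; lra.
- by move=> i; apply: le_lt_trans (bx i) _; lra.
Qed.

Definition ger0 n (f : 'rV[R]_n -> R) := near0 (fun x => f x = 0).

Lemma near0_neq0_mul n (f g : 'rV[R]_n -> R) : an f -> an g ->
  ~ ger0 f -> ~ ger0 g -> ~ ger0 (fun x => f x * g x).
Proof. by move=> hf hg nf ng /(near0_domain hf hg) []. Qed.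

Definition monoE n (m : 'I_n -> nat) (f : 'rV[R]_n -> R) :=
  exists u, [/\ an u, u 0 != 0 & near0 (fun x => f x = mon m x * u x)].

Definition mono n (f : 'rV[R]_n -> R) := exists m, monoE m f.

Lemma monD n (m m' : 'I_n -> nat) (x : 'rV[R]_n) :
  mon (fun i => m i + m' i)%N x = mon m x * mon m' x.
Proof. by rewrite /mon -big_split; apply: eq_bigr => i _; rewrite exprD. Qed.

Lemma monM n k (m : 'I_n -> nat) (x : 'rV[R]_n) :
  mon (fun i => k * m i)%N x = mon m x ^+ k.
Proof. by rewrite /mon -prodrXl; apply: eq_bigr => i _; rewrite mulnC exprM. Qed.

Lemma mon0 n (x : 'rV[R]_n) : mon (fun=> 0%N) x = 1.
Proof. by rewrite /mon big1. Qed.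

Lemma mon_delta n i (x : 'rV[R]_n) : mon (fun j => j == i : nat) x = x 0 i.
Proof. exact: prod_delta. Qed.

Lemma eq_mon n (m m' : 'I_n -> nat) (x : 'rV[R]_n) : m =1 m' -> mon m x = mon m' x.
Proof. by move=> mm; apply: eq_bigr => i _; rewrite mm. Qed.

Lemma monoE_eq n m (f g : 'rV[R]_n -> R) : monoE m f -> near0 (fun x => f x = g x) -> monoE m g.
Proof.
move=> [u [hu u0 h]] fg; exists u; split=> //; apply: near0_imp2 h fg.
by move=> x -> ->.
Qed.

Lemma monoE_eqm n m m' (f : 'rV[R]_n -> R) : m =1 m' -> monoE m f -> monoE m' f.
Proof.
move=> mm [u [hu u0 h]]; exists u; split=> //; apply: near0_imp h => x ->.
by rewrite (eq_mon _ mm).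
Qed.

Lemma monoE_mul n m m' (f g : 'rV[R]_n -> R) : monoE m f -> monoE m' g ->
  monoE (fun i => m i + m' i)%N (fun x => f x * g x).
Proof.
move=> [u [hu u0 h]] [v [hv v0 h']]; exists (fun x => u x * v x); split.
- exact: an_mul.
- by rewrite mulf_neq0.
- by apply: near0_imp2 h h' => x -> ->; rewrite monD mulrACA.
Qed.

Lemma monoE_unit n (u : 'rV[R]_n -> R) : an u -> u 0 != 0 -> monoE (fun=> 0%N) u.
Proof. by move=> hu u0; exists u; split=> //; apply: near0_T => x; rewrite mon0 mul1r. Qed.

Lemma monoE_exp n m (f : 'rV[R]_n -> R) k : monoE m f ->
  monoE (fun i => k * m i)%N (fun x => f x ^+ k).
Proof.
move=> [u [hu u0 h]]; exists (fun x => u x ^+ k); split; first exact: an_exp.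
  by rewrite expf_neq0.
by apply: near0_imp h => x ->; rewrite monM exprMn.
Qed.

Lemma monoE_prod n (I : Type) (s : seq I) (m : I -> 'I_n -> nat) (f : I -> 'rV[R]_n -> R) :
  (forall i, monoE (m i) (f i)) ->
  monoE (fun j => \sum_(i <- s) m i j)%N (fun x => \prod_(i <- s) f i x).
Proof.
move=> h; elim: s => [|i s IH].
  apply: (@monoE_eqm _ (fun=> 0%N)); first by move=> j; rewrite big_nil.
  apply: monoE_eq (monoE_unit (an_cst n 1) (oner_neq0 _)) _.
  by apply: near0_T => x; rewrite big_nil.
apply: (@monoE_eqm _ (fun j => m i j + \sum_(i <- s) m i j)%N).
  by move=> j; rewrite big_cons.
apply: monoE_eq (monoE_mul (h i) IH) _.
by apply: near0_T => x; rewrite big_cons.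
Qed.

Lemma monoE_coord n i : monoE (fun j => j == i : nat) (fun x : 'rV[R]_n => x 0 i).
Proof.
exists (fun=> 1); split; [exact: an_cst|exact: oner_neq0|].
by apply: near0_T => x; rewrite mon_delta mulr1.
Qed.

(* Pulling back x^m along a map with monomial coordinates. *)
Definition pullm n k (M : 'I_n -> 'I_k -> nat) (m : 'I_n -> nat) (j : 'I_k) : nat :=
  (\sum_i m i * M i j)%N.

Lemma monoE_comp n k (M : 'I_n -> 'I_k -> nat) m (f : 'rV[R]_n -> R) (q : 'rV[R]_k -> 'rV[R]_n) :
  anmap q -> q 0 = 0 -> (forall i, monoE (M i) (fun x => q x 0 i)) -> monoE m f ->
  monoE (pullm M m) (fun x => f (q x)).
Proof.
move=> hq q0 hM [u [hu u0 h]].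
have h1 : monoE (pullm M m) (fun x => mon m (q x)).
  exact: (monoE_prod _ (fun i => monoE_exp (m i) (hM i))).
have h2 : monoE (fun=> 0%N) (fun x => u (q x)).
  by apply: monoE_unit; [exact: an_comp | rewrite q0].
apply: monoE_eq (monoE_eqm _ (monoE_mul h1 h2)) _; first by move=> j; rewrite addn0.
by apply: near0_imp (near0_comp hq q0 h) => x ->.
Qed.

Lemma mono_comp n k (f : 'rV[R]_n -> R) (q : 'rV[R]_k -> 'rV[R]_n) :
  anmap q -> q 0 = 0 -> (forall i, mono (fun x => q x 0 i)) -> mono f -> mono (fun x => f (q x)).
Proof.
move=> hq q0 /choice[M hM] [m hm]; exists (pullm M m); exact: monoE_comp.
Qed.

Lemma mono_mul n (f g : 'rV[R]_n -> R) : mono f -> mono g -> mono (fun x => f x * g x).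
Proof. by move=> [m hm] [m' hm']; eexists; apply: monoE_mul; eassumption. Qed.

Lemma mono_eq n (f g : 'rV[R]_n -> R) : mono f -> near0 (fun x => f x = g x) -> mono g.
Proof. by move=> [m hm] fg; exists m; apply: monoE_eq hm fg. Qed.

(** The only piece of unique factorisation that is used. If x_k divides the product, one of the
    factors vanishes on x_k = 0 because germs form a domain, and x_k is divided out of it; the
    degree of the monomial drops. *)
Lemma mono_factor n (f g : 'rV[R]_n -> R) : an f -> an g -> mono (fun x => f x * g x) -> mono f.
Proof.
move=> + + [m]; move: {2}(\sum_i m i)%N (leqnn (\sum_i m i)%N) => d.
elim: d m f g => [|d IH] m f g hd hf hg [u [hu u0 h]].
  have m0 i : m i = 0%N.
    apply/eqP; rewrite -leqn0; apply: leq_trans hd; by rewrite (bigD1 i) //= leq_addr.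
  have := near0_0 h; rewrite (eq_mon _ m0) mon0 mul1r => E.
  exists (fun=> 0%N); apply: monoE_unit => //.
  by apply: contraNneq u0 => f0; rewrite -E f0 mul0r.
have [m0|/existsNP[k /eqP mk]] := pselect (forall i, m i = 0%N).
  by apply: (IH m f g) => //; [rewrite big1|exists u].
pose m' j := if j == k then (m j).-1 else m j.
have Em x : mon m x = x 0 k * mon m' x.
  rewrite /mon (bigD1 k) //= [in RHS](bigD1 k) //= {1}/m' eqxx mulrA -exprS prednK ?lt0n //.
  by congr (_ * _); apply: eq_bigr => j /negbTE jk; rewrite /m' jk.
have hd' : (\sum_i m' i <= d)%N.
  rewrite -ltnS; apply: leq_trans hd.
  have -> : (\sum_i m i = (\sum_i m' i).+1)%N; last exact: leqnn.
  rewrite (bigD1 k) //= [in RHS](bigD1 k) //= -addSn (_ : m' k = (m k).-1) ?prednK ?lt0n //; last by rewrite /m' eqxx.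
  by congr (_ + _)%N; apply: eq_bigr => j /negbTE jk; rewrite /m' jk.
have hz : anmap (@zeroc R n k).
  move=> j; apply: an_ext (_ : an (fun x : 'rV[R]_n => if j == k then 0 else x 0 j)) _.
    by case: (j == k); [exact: an_cst|exact: an_coord].
  by move=> x; rewrite mxE.
have z0 : zeroc k 0 = 0 :> 'rV[R]_n by apply/rowP => j; rewrite !mxE; case: ifP.
have hfz := an_comp hz z0 hf; have hgz := an_comp hz z0 hg.
have : near0 (fun x => f (zeroc k x) * g (zeroc k x) = 0).
  apply: near0_imp (near0_comp hz z0 h) => x ->.
  by rewrite Em mxE eqxx !mul0r.
have dens (a b : 'rV[R]_n -> R) : an a -> an b -> near0 (fun x => x 0 k * a x = x 0 k * b x) ->
    near0 (fun x => a x = b x).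
  move=> ha hb hab; have : near0 (fun x => x 0 k * (a x - b x) = 0).
    by apply: near0_imp hab => x E; rewrite mulrBr E subrr.
  move/(near0_domain (an_coord k) (an_sub ha hb)) => [|]; last first.
    by apply: near0_imp => x /eqP; rewrite subr_eq0 => /eqP.
  move=> [r r0 hr]; exfalso; have := hr (const_mx r); rewrite mxE => hc.
  suff: r = 0 by move/eqP; rewrite gt_eqF.
  by apply: hc => i; rewrite mxE gtr0_norm.
move/(near0_domain hfz hgz) => [hf0|hg0].
- have [f1 hf1 hf2] := an_divc k hf.
  have E1 : near0 (fun x => f x = x 0 k * f1 x).
    by apply: near0_imp2 hf0 hf2 => x ->; rewrite subr0.
  have [m1 hm1] : mono f1.
    apply: (IH m' f1 g) => //; exists u; split=> //.
    apply: dens; [exact: an_mul|exact/an_mul/hu/an_mon|].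
    by apply: near0_imp2 h E1 => x hx e; rewrite !mulrA -e -Em.
  have hk : mono (fun x : 'rV[R]_n => x 0 k) by eexists; exact: monoE_coord.
  have hm1' : mono f1 by exists m1.
  apply: mono_eq (mono_mul hk hm1') _.
  by apply: near0_imp E1 => x ->.
- have [g1 hg1 hg2] := an_divc k hg.
  have E1 : near0 (fun x => g x = x 0 k * g1 x).
    by apply: near0_imp2 hg0 hg2 => x ->; rewrite subr0.
  apply: (IH m' f g1) => //; exists u; split=> //.
  apply: dens; [exact: an_mul|exact/an_mul/hu/an_mon|].
  by apply: near0_imp2 h E1 => x hx e; rewrite mulrCA -e hx Em mulrA.
Qed.

End Ident.

(** * Taylor expansion in a distinguished variable, and difference quotients *)

Section Cons.
Context {R : realType}.
Implicit Types (r s C D e : R).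

(** The first coordinate is the variable in which germs are expanded and made regular; the tail
    carries the parameters. *)
Definition vcons n (y : R) (x : 'rV[R]_n) : 'rV[R]_n.+1 :=
  \row_j if unlift ord0 j is Some k then x 0 k else y.

Definition vtail n (x : 'rV[R]_n.+1) : 'rV[R]_n := \row_k x 0 (lift ord0 k).

Lemma vcons0 n y (x : 'rV[R]_n) : vcons y x 0 ord0 = y.
Proof. by rewrite mxE unlift_none. Qed.

Lemma vconsS n y (x : 'rV[R]_n) k : vcons y x 0 (lift ord0 k) = x 0 k.
Proof. by rewrite mxE liftK. Qed.

Lemma vconsK n y (x : 'rV[R]_n) : vtail (vcons y x) = x.
Proof. by apply/rowP => k; rewrite mxE vconsS. Qed.

Lemma vcons_eta n (x : 'rV[R]_n.+1) : vcons (x 0 ord0) (vtail x) = x.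
Proof. by apply/rowP => j; rewrite mxE; case: unliftP => [k ->|->] //; rewrite mxE. Qed.

Lemma vcons_00 n : vcons 0 (0 : 'rV[R]_n) = 0.
Proof. by apply/rowP => j; rewrite !mxE; case: unlift => // k; rewrite mxE. Qed.

Lemma vtail0 n : vtail (0 : 'rV[R]_n.+1) = 0.
Proof. by apply/rowP => j; rewrite !mxE. Qed.

Lemma zeroc_vcons n (x : 'rV[R]_n.+1) : zeroc ord0 x = vcons 0 (vtail x).
Proof.
apply/rowP => j; rewrite !mxE; case: unliftP => [k ->|->]; last by rewrite eqxx.
by rewrite mxE eq_sym (negbTE (neq_lift _ _)).
Qed.

Lemma an_ord n m (q : 'rV[R]_n -> 'rV[R]_m.+1) :
  an (fun x => q x 0 ord0) -> anmap (fun x => vtail (q x)) -> anmap q.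
Proof.
move=> h0 h1 j; case: (unliftP ord0 j) => [k ->|-> //].
by apply: an_ext (h1 k) _ => x; rewrite mxE.
Qed.

Lemma anmap_vtail n : anmap (@vtail n).
Proof. by move=> k; apply: an_ext (an_coord (lift ord0 k)) _ => x; rewrite mxE. Qed.

Lemma anmap_vcons n m (f : 'rV[R]_n -> R) (q : 'rV[R]_n -> 'rV[R]_m) :
  an f -> anmap q -> anmap (fun x => vcons (f x) (q x)).
Proof.
move=> hf hq; apply: an_ord; first by apply: an_ext hf _ => x; rewrite vcons0.
by move=> k; apply: an_ext (hq k) _ => x; rewrite vconsK.
Qed.

Lemma anmap_id n : anmap (fun x : 'rV[R]_n => x).
Proof. by move=> i; exact: an_coord. Qed.

Lemma anmap_cst n m (c : 'rV[R]_m) : anmap (fun _ : 'rV[R]_n => c).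
Proof. by move=> i; exact: an_cst. Qed.

Lemma near0_cancel n k (a b : 'rV[R]_n -> R) : an a -> an b ->
  near0 (fun x => x 0 k * a x = x 0 k * b x) -> near0 (fun x => a x = b x).
Proof.
move=> ha hb hab; have : near0 (fun x => x 0 k * (a x - b x) = 0).
  by apply: near0_imp hab => x E; rewrite mulrBr E subrr.
move/(near0_domain (an_coord k) (an_sub ha hb)) => [|]; last first.
  by apply: near0_imp => x /eqP; rewrite subr_eq0 => /eqP.
move=> [r r0 hr]; exfalso; have := hr (const_mx r); rewrite mxE => hc.
suff: r = 0 by move/eqP; rewrite gt_eqF.
by apply: hc => i; rewrite mxE gtr0_norm.
Qed.

Lemma taylor n (f : 'rV[R]_n.+1 -> R) d : an f ->
  exists (c : nat -> 'rV[R]_n -> R) g, [/\ forall k, an (c k), an g &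
    near0 (fun x => f x = \sum_(k < d) c k (vtail x) * x 0 ord0 ^+ k + x 0 ord0 ^+ d * g x)].
Proof.
move=> hf; elim: d => [|d [c [g [hc hg h]]]].
  exists (fun _ _ => 0), f; split=> //; first by move=> _; exact: an_cst.
  by apply: near0_T => x; rewrite big_ord0 add0r expr0 mul1r.
have [g' hg' h'] := an_divc ord0 hg.
exists (fun k => if k == d then fun x => g (vcons 0 x) else c k), g'; split=> //.
  move=> k; case: eqP => // _; apply: an_comp (vcons_00 n) hg.
  by apply: anmap_vcons; [exact: an_cst|exact: anmap_id].
apply: near0_imp2 h h' => x -> h'; rewrite big_ord_recr /= eqxx -addrA.
congr (_ + _); first by apply: eq_bigr => i _; rewrite (ltn_eqF (ltn_ord i)).
by rewrite exprSr -mulrA -h' zeroc_vcons; ring.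
Qed.

Lemma near0_vtail n (P : 'rV[R]_n -> Prop) : near0 P <-> near0 (fun x : 'rV[R]_n.+1 => P (vtail x)).
Proof.
split; first exact: (near0_comp (@anmap_vtail n) (vtail0 n)).
move=> [e e0 h]; exists e => // x bx; rewrite -(vconsK 0 x); apply: h => i.
rewrite mxE; case: unlift => [k|]; [exact: bx|by rewrite normr0 ltW].
Qed.

Lemma near0_cancelX n k m (a b : 'rV[R]_n -> R) : an a -> an b ->
  near0 (fun x => x 0 k ^+ m * a x = x 0 k ^+ m * b x) -> near0 (fun x => a x = b x).
Proof.
move=> ha hb; elim: m => [|m IH] h; first by apply: near0_imp h => x; rewrite !mul1r.
apply: IH; apply: (@near0_cancel _ k).
- by apply: an_mul => //; apply/an_exp/an_coord.
- by apply: an_mul => //; apply/an_exp/an_coord.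
- by apply: near0_imp h => x; rewrite !exprS !mulrA.
Qed.

(** Setting the distinguished variable to 0 leaves only the coefficient of index 0; once it is gone
    the variable is cancelled. *)
Lemma taylor_uniq n d (a : nat -> 'rV[R]_n -> R) (g : 'rV[R]_n.+1 -> R) :
  (forall k, an (a k)) -> an g ->
  near0 (fun x => \sum_(k < d) a k (vtail x) * x 0 ord0 ^+ k + x 0 ord0 ^+ d * g x = 0) ->
  forall k, (k < d)%N -> near0 (fun x => a k x = 0).
Proof.
move=> + hg; elim: d a => [//|d IH] a ha h.
have hat k : an (fun x => a k (vtail x)).
  by apply: an_comp (vtail0 n) (ha k); exact: anmap_vtail.
have a0 : near0 (fun x => a 0%N x = 0).
  have h0 := near0_comp (anmap_vcons (an_cst n 0) (@anmap_id n)) (vcons_00 n) h.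
  apply: near0_imp h0 => x; rewrite vconsK vcons0 big_ord_recl expr0 mulr1 exprS !mul0r addr0.
  by rewrite big1 ?addr0 // => i _; rewrite exprS mul0r mulr0.
have h1 : near0 (fun x : 'rV[R]_n.+1 =>
    \sum_(k < d) a k.+1 (vtail x) * x 0 ord0 ^+ k + x 0 ord0 ^+ d * g x = 0).
  apply: (@near0_cancel _ ord0).
  - apply: an_add; first by apply: an_sum => i; apply: an_mul => //; exact/an_exp/an_coord.
    by apply: an_mul => //; apply/an_exp/an_coord.
  - exact: an_cst.
  - apply: near0_imp2 h ((near0_vtail _).1 a0) => x + E0.
    rewrite big_ord_recl /= E0 mul0r add0r mulr0 => E.
    rewrite -[RHS]E mulrDr [in LHS]big_distrr /= mulrA -exprS.
    by congr (_ + _); apply: eq_bigr => i _; rewrite mulrCA -exprS.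
by case=> [//|k]; rewrite ltnS; exact: (IH (fun k => a k.+1)).
Qed.

Definition zs n (s : seq 'I_n) (x : 'rV[R]_n) : 'rV[R]_n :=
  \row_j if j \in s then 0 else x 0 j.

Lemma anmap_zs n (s : seq 'I_n) : anmap (zs s).
Proof.
move=> j; apply: an_ext (_ : an (fun x : 'rV[R]_n => if j \in s then 0 else x 0 j)) _.
  by case: (j \in s); [exact: an_cst|exact: an_coord].
by move=> x; rewrite mxE.
Qed.

Lemma hadamard n (f : 'rV[R]_n -> R) (s : seq 'I_n) : an f -> uniq s ->
  exists2 g : 'I_n -> 'rV[R]_n -> R, forall i, an (g i) &
    near0 (fun x => f x - f (zs s x) = \sum_(i <- s) x 0 i * g i x).
Proof.
move=> hf; elim: s => [_|i s IH /= /andP[is_ us]].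
  exists (fun _ _ => 0); first by move=> _; exact: an_cst.
  apply: near0_T => x; rewrite big_nil (_ : zs _ _ = x) ?subrr //.
  by apply/rowP => j; rewrite mxE.
have [g hg h] := IH us; have [g0 hg0 h0] := an_divc i hf.
have zi : anmap (zeroc (R := R) i).
  move=> j; apply: (an_ext (anmap_zs [:: i] j)) => x.
  by rewrite !mxE inE.
have zi0 : zeroc i 0 = 0 :> 'rV[R]_n by apply/rowP => j; rewrite !mxE; case: ifP.
exists (fun j => if j == i then g0 else fun x => g j (zeroc i x)).
  move=> j; case: eqP => // _; exact: an_comp.
apply: near0_imp2 h0 (near0_comp zi zi0 h) => x E0 E1.
rewrite big_cons eqxx -E0.
rewrite (_ : \sum_(j <- s) _ = \sum_(j <- s) zeroc i x 0 j * g j (zeroc i x)).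
  rewrite -E1 addrA subrK; congr (_ - f _).
  by apply/rowP => j; rewrite !mxE inE; case: (j == i); case: (j \in s).
rewrite big_seq [RHS]big_seq; apply: eq_bigr => j js.
have /negbTE ji : j != i by apply: contraNneq is_ => <-.
by rewrite ji mxE ji.
Qed.

Lemma box_row_mx p q r (a : 'rV[R]_p) (b : 'rV[R]_q) : box r a -> box r b -> box r (row_mx a b).
Proof.
by move=> ha hb i; case: (split_ordP i) => j ->; rewrite ?row_mxEl ?row_mxEr.
Qed.

Lemma AN_row_mx p q n s r (a : 'rV[R]_n -> 'rV[R]_p) (b : 'rV[R]_n -> 'rV[R]_q) :
  (forall i, AN s (fun x => a x 0 i) r) -> (forall i, AN s (fun x => b x 0 i) r) ->
  forall i, AN s (fun x => row_mx (a x) (b x) 0 i) r.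
Proof.
move=> ha hb i; case: (split_ordP i) => j ->.
  by apply: AN_eq (ha j) _ => x _; rewrite row_mxEl.
by apply: AN_eq (hb j) _ => x _; rewrite row_mxEr.
Qed.

Lemma anmap_row_mx p q n (a : 'rV[R]_n -> 'rV[R]_p) (b : 'rV[R]_n -> 'rV[R]_q) :
  anmap a -> anmap b -> anmap (fun x => row_mx (a x) (b x)).
Proof.
move=> ha hb i; case: (split_ordP i) => j ->.
  by apply: an_ext (ha j) _ => x; rewrite row_mxEl.
by apply: an_ext (hb j) _ => x; rewrite row_mxEr.
Qed.

Lemma anmap_lsubmx p q : anmap (@lsubmx R 1 p q).
Proof. by move=> i; apply: an_ext (an_coord (lshift q i)) _ => x; rewrite mxE. Qed.

Lemma anmap_rsubmx p q : anmap (@rsubmx R 1 p q).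
Proof. by move=> i; apply: an_ext (an_coord (rshift p i)) _ => x; rewrite mxE. Qed.

Lemma lsubmx0 p q : lsubmx (0 : 'rV[R]_(p + q)) = 0.
Proof. by apply/rowP => i; rewrite !mxE. Qed.

Lemma rsubmx0 p q : rsubmx (0 : 'rV[R]_(p + q)) = 0.
Proof. by apply/rowP => i; rewrite !mxE. Qed.

(** [S] sends (x, b, h) to (x, b + h), so removing the block h from f o S gives the difference of f
    at (x, b + h) and (x, b); [T] then inserts h = a - b. *)
Lemma hadamard2 p q (f : 'rV[R]_(p + q) -> R) : an f ->
  exists2 H : 'I_q -> 'rV[R]_(p + (q + q)) -> R, forall k, an (H k) &
    exists2 e, 0 < e & forall (x : 'rV[R]_p) (a b : 'rV[R]_q), box e x -> box e a -> box e b ->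
      f (row_mx x a) - f (row_mx x b) = \sum_k (a 0 k - b 0 k) * H k (row_mx x (row_mx a b)).
Proof.
move=> hf.
pose S (w : 'rV[R]_(p + (q + q))) : 'rV[R]_(p + q) :=
  row_mx (lsubmx w) (lsubmx (rsubmx w) + rsubmx (rsubmx w)).
have hS : anmap S.
  apply: anmap_row_mx => [|i]; first exact: anmap_lsubmx.
  have rr : rsubmx (0 : 'rV[R]_(p + (q + q))) = 0 by rewrite rsubmx0.
  have h1 := anmap_comp (@anmap_rsubmx p (q + q)) rr (@anmap_lsubmx q q) i.
  have h2 := anmap_comp (@anmap_rsubmx p (q + q)) rr (@anmap_rsubmx q q) i.
  by apply: an_ext (an_add h1 h2) _ => x; rewrite [in RHS]mxE.
have S0 : S 0 = 0 by rewrite /S lsubmx0 rsubmx0 lsubmx0 rsubmx0 addr0 row_mx0.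
have hfS := an_comp hS S0 hf.
pose iota (k : 'I_q) : 'I_(p + (q + q)) := rshift p (rshift q k).
have iinj : injective iota by move=> k l /rshift_inj /rshift_inj.
have us : uniq (map iota (enum 'I_q)) by rewrite map_inj_uniq // enum_uniq.
have [g hg [e e0 he]] := hadamard hfS us.
pose T (w : 'rV[R]_(p + (q + q))) : 'rV[R]_(p + (q + q)) :=
  row_mx (lsubmx w) (row_mx (rsubmx (rsubmx w)) (lsubmx (rsubmx w) - rsubmx (rsubmx w))).
have hT : anmap T.
  have rr : rsubmx (0 : 'rV[R]_(p + (q + q))) = 0 by rewrite rsubmx0.
  have h1 := anmap_comp (@anmap_rsubmx p (q + q)) rr (@anmap_lsubmx q q).
  have h2 := anmap_comp (@anmap_rsubmx p (q + q)) rr (@anmap_rsubmx q q).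
  apply: anmap_row_mx; first exact: anmap_lsubmx.
  apply: anmap_row_mx => // i.
  by apply: an_ext (an_sub (h1 i) (h2 i)) _ => x; rewrite [in RHS]mxE; congr (_ + _); rewrite [in RHS]mxE.
have T0 : T 0 = 0 by rewrite /T lsubmx0 rsubmx0 lsubmx0 rsubmx0 subr0 !row_mx0.
exists (fun k w => g (iota k) (T w)); first by move=> k; exact: an_comp.
exists (e / 2); first by rewrite divr_gt0.
move=> x a b bx ba bb; have e2 : e / 2 <= e by lra.
pose w := row_mx x (row_mx b (a - b)).
have bw : box e w.
  apply: box_row_mx; first exact: box_le bx e2.
  apply: box_row_mx; first exact: box_le bb e2.
  move=> i; rewrite !mxE; apply: le_trans (ler_normB _ _) _.
  by have := ba i; have := bb i; lra.
have Tw : T (row_mx x (row_mx a b)) = w by rewrite /T !(row_mxKl, row_mxKr).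
have := he _ bw; rewrite big_map big_enum /=.
have -> : S w = row_mx x a by rewrite /S /w !(row_mxKl, row_mxKr) addrC subrK.
have -> : S (zs [seq iota i | i <- enum 'I_q] w) = row_mx x b.
  have ni i (j : 'I_(p + (q + q))) : (forall k, j <> iota k) ->
      zs [seq iota i | i <- enum 'I_q] w i j = w 0 j.
    move=> h; rewrite mxE; case: mapP => // -[k _ /h] //.
  congr row_mx.
    apply/rowP => i; rewrite mxE ni ?row_mxEl // => k.
    by move/eqP; rewrite /iota eq_lrshift.
  apply/rowP => i; rewrite !mxE.
  case: mapP => [[k _ /rshift_inj /eqP]|_]; first by rewrite eq_lrshift.
  case: mapP => [_|[]]; last by exists i; rewrite ?mem_enum.
  by rewrite addr0; case: split_ordP => // j /eqP; rewrite ?eq_rlshift // => /eqP/rshift_inj <-; rewrite row_mxEl.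
move=> ->; apply: eq_bigr => k _; rewrite Tw; congr (_ * _).
by rewrite /w /iota !row_mxEr !mxE.
Qed.

End Cons.

(** * Implicit functions and the Tschirnhaus transform *)

Section IFT.
Context {R : realType}.
Implicit Types (r s C D e : R).

Lemma fin_radius (I : finType) (P : I -> R -> Prop) :
  (forall i e e', 0 < e' -> e' <= e -> P i e -> P i e') ->
  (forall i, exists2 e, 0 < e & P i e) -> exists2 e, 0 < e & forall i, P i e.
Proof.
move=> mono h; suff [e e0 he] : exists2 e, 0 < e & forall i, i \in enum I -> P i e.
  by exists e => // i; apply: he; rewrite mem_enum.
elim: (enum I) => [|i s [e e0 IH]]; first by exists 1.
have [e1 e10 h1] := h i; have m0 : 0 < Num.min e e1 by rewrite lt_min e0.
exists (Num.min e e1) => // j; rewrite inE => /orP[/eqP -> |js].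
  by apply: mono h1 => //; rewrite ge_min lexx orbT.
by apply: mono (IH j js) => //; rewrite ge_min lexx.
Qed.

Lemma cvgn_sum (I : Type) (t : seq I) (f : I -> nat -> R) (a : I -> R) :
  (forall l, f l @ \oo --> a l) ->
  (fun N => \sum_(l <- t) f l N) @ \oo --> \sum_(l <- t) a l.
Proof.
move=> h; elim: t => [|l t IH].
  by rewrite big_nil; under eq_fun do rewrite big_nil; exact: cvg_cst.
by rewrite big_cons; under eq_fun do rewrite big_cons; apply: cvgD.
Qed.

(** The quadratic bound says, without derivatives, that the partial derivatives of Phi in its last q
    variables vanish at 0. The difference quotients H are then small near 0, Phi is a contraction in
    these variables, and the iterates [th k] converge as a series of germs. *)
Lemma ift p q (Phi : 'rV[R]_(p + q) -> 'rV[R]_q) : anmap Phi -> Phi 0 = 0 ->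
  (forall j (k : 'I_q), exists C e : R, 0 < e /\
     forall t : R, `|t| <= e -> `|Phi (row_mx 0 (t *: delta_mx 0 k)) 0 j| <= C * t ^+ 2) ->
  exists theta : 'rV[R]_p -> 'rV[R]_q, [/\ anmap theta, theta 0 = 0 &
     near0 (fun x => theta x = Phi (row_mx x (theta x)))].
Proof.
move=> hPhi Phi0 hquad.
have /choice[H hH] j : exists H : 'I_q -> 'rV[R]_(p + (q + q)) -> R, (forall k, an (H k)) /\
    exists2 e : R, 0 < e & forall (x : 'rV[R]_p) (a b : 'rV[R]_q), box e x -> box e a -> box e b ->
      Phi (row_mx x a) 0 j - Phi (row_mx x b) 0 j =
        \sum_k (a 0 k - b 0 k) * H k (row_mx x (row_mx a b)).
  by have [H h1 h2] := hadamard2 (hPhi j); exists H.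
have hHan j k : an (H j k) by have [] := hH j.
have [e0 e00 he0] : exists2 e : R, 0 < e & forall j (x : 'rV[R]_p) (a b : 'rV[R]_q),
      box e x -> box e a -> box e b ->
      Phi (row_mx x a) 0 j - Phi (row_mx x b) 0 j =
        \sum_k (a 0 k - b 0 k) * H j k (row_mx x (row_mx a b)).
  apply: fin_radius => [j e e' _ ee' h x a b bx ba bb|j]; last by have [] := hH j.
  by apply: h; apply: box_le; eauto.
(* A nonzero value would make Phi grow linearly along the k-th axis. *)
have H00 j k : H j k 0 = 0.
  apply/eqP; apply: contrapT => /negP Hn.
  have [C [e [ep hC]]] := hquad j k.
  have h2 : 0 < `|H j k 0| / 2 by rewrite divr_gt0 // normr_gt0.
  have [e1 e10 he1] := an_cont (hHan j k) h2.
  pose t := Num.min (Num.min e e0) (Num.min e1 (`|H j k 0| / 2 / (`|C| + 1))).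
  have C1 : 0 < `|C| + 1 by rewrite ltr_wpDl.
  have tp : 0 < t by rewrite /t !lt_min ep e00 e10 divr_gt0.
  have tn : `|t| = t by rewrite gtr0_norm.
  have [te te0 te1 tC] : [/\ t <= e, t <= e0, t <= e1 & t <= `|H j k 0| / 2 / (`|C| + 1)].
    by split; rewrite /t !ge_min lexx ?orbT.
  have bt e' : t <= e' -> box e' (t *: delta_mx 0 k : 'rV[R]_q).
    move=> te' i; rewrite !mxE /=; case: (i == k); rewrite ?mulr1 ?tn ?mulr0 ?normr0 //.
    by apply: le_trans te'; exact: ltW.
  have := he0 j 0 (t *: delta_mx 0 k) 0 (box0 (ltW e00)) (bt _ te0) (box0 (ltW e00)).
  rewrite row_mx0 Phi0 (bigD1 k) //= big1 ?addr0; last first.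
    by move=> i /negbTE ik; rewrite !mxE ik /= mulr0 subr0 mul0r.
  rewrite !mxE !eqxx mulr1 !subr0 => E; have := hC t; rewrite tn E normrM tn => /(_ te).
  rewrite expr2 mulrCA ler_pM2l //.
  set w := row_mx _ _ => hw.
  have bw : box e1 w.
    apply: box_row_mx; first exact/box0/ltW.
    by apply: box_row_mx; [exact: bt|exact/box0/ltW].
  have := he1 _ bw; have : C * t <= `|H j k 0| / 2.
    move: tC; rewrite ler_pdivlMr // => tC; apply: le_trans tC.
    by rewrite mulrC ler_wpM2l ?(ltW tp) // (le_trans (ler_norm C)) // lerDl.
  have := ler_normD (H j k w) (H j k 0 - H j k w); rewrite addrC subrK.
  rewrite [`|_ - H j k w|]distrC; lra.
(* With each difference quotient of norm at most c, the sum of q of them contracts by q c <= 1/2. *)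
pose c : R := (2 * q.+1%:R)^-1.
have c0 : 0 < c by rewrite invr_gt0 mulr_gt0.
have [rho0 rho00 hrho0] : exists2 e : R, 0 < e & forall jk : 'I_q * 'I_q, AN e (H jk.1 jk.2) c.
  apply: fin_radius => [[j k] e e' /ltW e'0 ee' h|[j k] /=]; first exact: AN_radius h.
  have [s s0 hs] := an_small (hHan j k) c0; exists s => //.
  by apply: AN_eq hs _ => x _; rewrite H00 subr0.
pose rho := Num.min e0 rho0.
have rp : 0 < rho by rewrite lt_min e00.
have re0 : rho <= e0 by rewrite ge_min lexx.
have hrho j k : AN rho (H j k) c.
  by apply: AN_radius (ltW rp) _ (hrho0 (j, k)); rewrite ge_min lexx orbT.
have hx0 : anmap (fun x : 'rV[R]_p => row_mx x (0 : 'rV[R]_q)).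
  by apply: anmap_row_mx; [exact: anmap_id|exact: anmap_cst].
have rp2 : 0 < rho / 2 by rewrite divr_gt0.
have P00 : Phi (row_mx 0 0) = 0 by rewrite row_mx0.
have [s1 s10 hs1] := anmap_small (anmap_comp hx0 (row_mx0 _ _ _ _) hPhi) P00 rp2.
pose s := Num.min s1 rho.
have s0 : 0 < s by rewrite lt_min s10.
have s0' := ltW s0.
have srho : s <= rho by rewrite ge_min lexx orbT.
have hs j : AN s (fun x => Phi (row_mx x 0) 0 j) (rho / 2).
  by apply: AN_radius s0' _ (hs1 j); rewrite ge_min lexx.
have hid i : AN s (fun x : 'rV[R]_p => x 0 i) rho by apply: AN_le (AN_coord s i) _.
pose th := fix th k x := if k is k'.+1 then Phi (row_mx x (th k' x)) else 0.
have qc : q%:R * c <= 2^-1.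
  rewrite /c invfM mulrCA ler_piMr // ler_pdivrMr // mul1r ler_nat //.
(* The first bound keeps the iterates in the polydisc of radius rho, where the norms of the H are
   controlled; the second halves the increments. *)
have hth k : (forall j, AN s (fun x => th k x 0 j) (rho * (1 - 2^-1 ^+ k))) /\
    (forall j, AN s (fun x => th k.+1 x 0 j - th k x 0 j) (rho * 2^-1 ^+ k.+1)).
  elim: k => [|k [IH1 IH2]].
    split=> j.
      by rewrite expr0 subrr mulr0; apply: AN_eq (AN_0 _ _) _ => x _; rewrite mxE.
    rewrite expr1; apply: AN_eq (hs j) _ => x _; by rewrite /= [in RHS](mxE _ _ 0) subr0.
  have IH3 j : AN s (fun x => th k.+1 x 0 j) (rho * (1 - 2^-1 ^+ k.+1)).
    apply: AN_le (AN_eq (AN_add s0' (IH1 j) (IH2 j)) _) _.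
      by move=> x _; rewrite subrKC.
    by rewrite !exprS; lra.
  split=> // j.
  have le1 k' : rho * (1 - 2^-1 ^+ k') <= rho.
    by rewrite ler_piMr ?(ltW rp) // gerBl exprn_ge0.
  have hk k' : (forall j, AN s (fun x => th k' x 0 j) (rho * (1 - 2^-1 ^+ k'))) ->
      forall j, AN s (fun x => th k' x 0 j) rho.
    by move=> h j'; apply: AN_le (h j') (le1 k').
  have hw l : AN s (fun x => H j l (row_mx x (row_mx (th k.+1 x) (th k x)))) c.
    apply: (AN_comp s0' (hrho j l)).
    by apply: AN_row_mx => //; apply: AN_row_mx; exact: hk.
  have hsum := AN_sum (index_enum 'I_q) s0' (fun l => AN_mul s0' (IH2 l) (hw l)).
  apply: AN_le (AN_eq hsum _) _.
    move=> x bx; have bb k' : (forall j, AN s (fun x => th k' x 0 j) (rho * (1 - 2^-1 ^+ k'))) ->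
        box e0 (th k' x).
      move=> h i; apply: (le_trans (AN_bound (hk _ h i) bx) re0).
    rewrite -he0; [by []| |exact: bb|exact: bb].
    by apply: box_le bx _; apply: le_trans re0.
  rewrite sumr_const card_ord -[X in X <= _]mulr_natl [_ ^+ k.+2]exprSr.
  rewrite [X in _ <= X]mulrA.
  rewrite [X in X <= _](_ : _ = rho * 2^-1 ^+ k.+1 * (q%:R * c)); last by ring.
  by rewrite ler_wpM2l // mulr_ge0 ?exprn_ge0 // ltW.
have hth1 j k : AN s (fun x => th k x 0 j) rho.
  apply: AN_le ((hth k).1 j) _.
  by rewrite ler_piMr ?(ltW rp) // gerBl exprn_ge0.
pose theta (x : 'rV[R]_p) : 'rV[R]_q := \row_j fsum (fun k x => th k.+1 x 0 j - th k x 0 j) x.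
have hgeo N : \sum_(k < N) (rho * 2^-1 ^+ k.+1) <= rho.
  rewrite -mulr_sumr ler_piMr ?(ltW rp) //.
  suff -> : \sum_(k < N) 2^-1 ^+ k.+1 = 1 - 2^-1 ^+ N :> R.
    by rewrite gerBl exprn_ge0.
  elim: N => [|N IH]; first by rewrite big_ord0 subrr.
  by rewrite big_ord_recr /= IH exprS; lra.
have htheta j : AN s (fun x => theta x 0 j) rho.
  apply: AN_eq (AN_fsum s0' (fun k => (hth k).2 j) hgeo) _ => x _.
  by rewrite mxE.
have tele x j N : \sum_(k < N) (th k.+1 x 0 j - th k x 0 j) = th N x 0 j.
  elim: N => [|N IH]; first by rewrite big_ord0 mxE.
  by rewrite big_ord_recr /= IH addrC subrK.
have hlim x j : box s x -> (fun N => th N x 0 j) @ \oo --> theta x 0 j.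
  move=> bx; have := fsum_cvg s0' (fun k => (hth k).2 j) hgeo bx.
  by under eq_fun do rewrite tele; rewrite mxE.
have th0 k : th k 0 = 0 by elim: k => //= k ->; rewrite row_mx0.
exists theta; split.
- by move=> j; exact: an_AN s0 (htheta j).
- apply/rowP => j; have := hlim 0 j (box0 s0').
  under eq_fun do rewrite th0 mxE.
  move=> h; rewrite [in RHS]mxE; apply: (cvg_unique (@norm_hausdorff _ R) h).
  exact: cvg_cst.
- exists s => // x bx; apply/rowP => j.
  have h1 : (fun N => th N.+1 x 0 j) @ \oo --> theta x 0 j.
    by have := hlim x j bx; rewrite -(cvg_shiftS (fun N => th N x 0 j)).
  suff h2 : (fun N => th N.+1 x 0 j) @ \oo --> Phi (row_mx x (theta x)) 0 j.
    exact: (cvg_unique (@norm_hausdorff _ R) h1 h2).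
  have bb k : box rho (th k x) by move=> i; exact: AN_bound (hth1 i k) bx.
  have bt : box rho (theta x) by move=> i; exact: AN_bound (htheta i) bx.
  have bx' : box rho x by apply: box_le bx _.
  apply/cvgrPdist_le => e ep.
  have hsum : (fun N => \sum_l `|theta x 0 l - th N x 0 l| * c) @ \oo --> (\sum_(l < q) 0 * c).
    apply: cvgn_sum => l; apply: cvgMl; apply/norm_cvg0P.
    by rewrite -(subrr (theta x 0 l)); apply: cvgB; [exact: cvg_cst|exact: hlim].
  rewrite big1 in hsum; last by move=> l _; rewrite mul0r.
  have /cvgrPdist_le /(_ e ep) := hsum; apply: filterS => N; rewrite sub0r normrN => hN.
  rewrite /= (he0 j); [|exact: box_le bx' re0|exact: box_le bt re0|exact: box_le (bb N) re0].
  apply: le_trans hN; rewrite [X in _ <= X]ger0_norm; last first.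
    by apply: sumr_ge0 => l _; rewrite mulr_ge0 // ltW.
  apply: le_trans (ler_norm_sum _ _ _) _; apply: ler_sum => l _.
  rewrite normrM ler_wpM2l //; apply: AN_bound (hrho j l) _.
  by apply: box_row_mx => //; apply: box_row_mx.
Qed.

End IFT.

Section Tschirnhaus.
Context {R : realType}.
Implicit Types (r s C D e : R).

Lemma an_divc0 n (f : 'rV[R]_n.+1 -> R) : an f ->
  exists2 g, an g & near0 (fun x => f x = f (vcons 0 (vtail x)) + x 0 ord0 * g x).
Proof.
move=> /(an_divc ord0)[g hg h]; exists g => //.
by apply: near0_imp h => x <-; rewrite zeroc_vcons addrC subrK.
Qed.

(** Weierstrass regularity of order d in the first variable. *)
Definition regular n (F : 'rV[R]_n.+1 -> R) d :=
  exists u : 'rV[R]_1 -> R, [/\ an u, u 0 != 0 &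
    near0 (fun y : 'rV[R]_1 => F (vcons (y 0 0) 0) = y 0 0 ^+ d * u y)].

(* The second highest coefficient of F(y + t, 0) = (y + t)^(d+1) u(y + t) has a simple zero
   at t = 0. *)
Lemma taylor_simple n (F : 'rV[R]_n.+1 -> R) d (C : nat -> 'rV[R]_n.+1 -> R)
    (g : 'rV[R]_n.+2 -> R) : an F -> regular F d.+1 -> (forall k, an (C k)) -> an g ->
  near0 (fun w : 'rV[R]_n.+2 => F (vcons (w 0 ord0 + vtail w 0 ord0) (vtail (vtail w))) =
      \sum_(k < d.+1) C k (vtail w) * w 0 ord0 ^+ k + w 0 ord0 ^+ d.+1 * g w) ->
  exists V : 'rV[R]_1 -> R, [/\ an V, V 0 != 0 &
    near0 (fun x : 'rV[R]_1 => C d (vcons (x 0 0) 0) = x 0 0 * V x)].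
Proof.
move=> hF [u [hu u0 hFu]] hC hg hexp.
pose sh (w : 'rV[R]_2) : 'rV[R]_1 := const_mx (w 0 ord0 + vtail w 0 0).
have hsh : anmap sh.
  move=> i; apply: (an_ext (an_add (an_coord ord0) (anmap_vtail (0 : 'I_1)))) => x.
  by rewrite [in RHS]mxE.
have sh0 : sh 0 = 0 by apply/rowP => i; rewrite !mxE addr0.
have hru := an_comp hsh sh0 hu.
have [U [h [hU hh hexpu]]] := taylor d.+1 hru.
pose e2 (w : 'rV[R]_2) : 'rV[R]_n.+2 := vcons (w 0 ord0) (vcons (vtail w 0 0) 0).
have he2 : anmap e2.
  apply: anmap_vcons; first exact: an_coord.
  by apply: anmap_vcons; [exact: (anmap_vtail (0 : 'I_1))|exact: anmap_cst].
have e20 : e2 0 = 0 by rewrite /e2 vtail0 !mxE vcons_00 vcons_00.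
(* [PA] is the binomial expansion of (x + y)^(d+1) in powers of y and [PB] the truncated Taylor
   expansion of u(x + y); below degree d + 1 their product has the coefficients of F(x + y, 0). *)
pose PA (x : 'rV[R]_1) := \poly_(i < d.+2) (x 0 0 ^+ (d.+1 - i) *+ 'C(d.+1, i)).
pose PB (x : 'rV[R]_1) := \poly_(j < d.+1) U j x.
pose P k (x : 'rV[R]_1) := (PA x * PB x)`_k.
have hPA k : an (fun x => (PA x)`_k).
  apply: (@an_ext _ _ (fun x : 'rV[R]_1 => if (k < d.+2)%N then x 0 0 ^+ (d.+1 - k) * ('C(d.+1, k))%:R else 0)).
    by case: (k < d.+2)%N; [apply: an_mul (an_cst _ _); exact/an_exp/an_coord|exact: an_cst].
  by move=> x; rewrite coef_poly; case: ifP => // _; rewrite mulr_natr.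
have hPB k : an (fun x => (PB x)`_k).
  apply: (@an_ext _ _ (fun x : 'rV[R]_1 => if (k < d.+1)%N then U k x else 0)).
    by case: (k < d.+1)%N; [exact: hU|exact: an_cst].
  by move=> x; rewrite coef_poly.
have hP k : an (P k).
  apply: (an_ext (@an_sum _ _ _ (index_enum 'I_k.+1) (fun i x => (PA x)`_i * (PB x)`_(k - i)) _)).
    by move=> i; exact: an_mul.
  by move=> x; rewrite /P coefM.
have hPy (x : 'rV[R]_1) y : (x 0 0 + y) ^+ d.+1 * (\sum_(k < d.+1) U k x * y ^+ k) =
    \sum_(k < d.+1) P k x * y ^+ k + y ^+ d.+1 * \sum_(k < d.+1) P (d.+1 + k)%N x * y ^+ k.
  transitivity ((PA x * PB x).[y]).
    rewrite hornerM !horner_poly exprDn; congr (_ * _).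
    by apply: eq_bigr => i _; rewrite mulrnAl.
  have sz : (size (PA x * PB x)%R <= d.+1 + d.+1)%N.
    apply: leq_trans (size_polyMleq _ _) _.
    have := size_poly d.+2 (fun i => x 0 0 ^+ (d.+1 - i) *+ 'C(d.+1, i)).
    have := size_poly d.+1 (fun j => U j x).
    rewrite -/(PA x) -/(PB x); lia.
  rewrite (horner_coef_wide _ sz) big_split_ord /=; congr (_ + _).
  by rewrite mulr_sumr; apply: eq_bigr => i _; rewrite exprD mulrCA.
have hq : near0 (fun w : 'rV[R]_2 => vtail w 0 0 = (vtail w) 0 0) by exact: near0_T.
have key : near0 (fun x : 'rV[R]_1 => C d (vcons (x 0 0) 0) - P d x = 0).
  apply: (taylor_uniq (d := d.+1) (a := fun k x => C k (vcons (x 0 0) 0) - P k x)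
    (g := fun w => g (e2 w) - (\sum_(k < d.+1) P (d.+1 + k)%N (vtail w) * w 0 ord0 ^+ k
       + (w 0 ord0 + vtail w 0 0) ^+ d.+1 * h w))) => //.
  - move=> k; apply: an_sub => //; apply: an_comp (hC k); last first.
      by rewrite mxE vcons_00.
    by apply: anmap_vcons; [exact: an_coord|exact: anmap_cst].
  - apply: an_sub; first exact: an_comp.
    apply: an_add.
      apply: an_sum => k; apply: an_mul; last exact/an_exp/an_coord.
      by apply: an_comp (vtail0 1) (hP _); exact: anmap_vtail.
    apply: an_mul => //; apply: an_exp; apply: an_add; first exact: an_coord.
    exact: (anmap_vtail (0 : 'I_1)).
  have hFw := near0_comp hsh sh0 hFu.
  apply: near0_imp2 (near0_and hFw hexpu) (near0_comp he2 e20 hexp) => w [E1 E2] E3.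
  have E4 : F (vcons (sh w 0 0) 0) = \sum_(k < d.+1) C k (vcons (vtail w 0 0) 0) * w 0 ord0 ^+ k
      + w 0 ord0 ^+ d.+1 * g (e2 w).
    move: E3; rewrite /e2 !vconsK !vcons0 /sh [const_mx _ _ _]mxE => ->.
    by [].
  move: E4; rewrite E1 E2 [sh w 0 0]mxE mulrDr [w 0 ord0 + _]addrC hPy.
  under [X in _ -> X + _ = _]eq_bigr do rewrite mulrBl.
  rewrite sumrB [vtail w 0 0 + _]addrC => E4.
  set S1 := \sum_(k < d.+1) C k _ * _ in E4 *.
  set S2 := \sum_(k < d.+1) P k _ * _ in E4 *.
  set S3 := \sum_(k < d.+1) P (d.+1 + k)%N _ * _ in E4 *.
  have : S1 = S2 + w 0 ord0 ^+ d.+1 * S3 + (w 0 ord0 + vtail w 0 0) ^+ d.+1 * (w 0 ord0 ^+ d.+1 * h w)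
    - w 0 ord0 ^+ d.+1 * g (e2 w) by rewrite E4 addrK.
  by move=> ->; ring.
(* The coefficient of y^d in the product is (d + 1) x U_0 plus terms divisible by x^2; V is that
   coefficient divided by x, with value (d + 1) U_0 at 0, nonzero in characteristic 0. *)
pose V (x : 'rV[R]_1) := U 0%N x *+ d.+1 +
  x 0 0 * \sum_(j < d) (x 0 0 ^+ (d.-1 - j) *+ 'C(d.+1, j)) * U (d - j)%N x.
exists V; split.
- apply: an_add.
    by apply: (an_ext (an_mul (hU 0%N) (an_cst 1 (d.+1%:R)))) => x; rewrite mulr_natr.
  apply: an_mul; first exact: an_coord.
  apply: an_sum => j; apply: an_mul => //.
  by apply: (an_ext (an_mul (an_exp (d.-1 - j) (an_coord (0 : 'I_1))) (an_cst 1 ('C(d.+1, j)%:R)))) => x; rewrite mulr_natr.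
- rewrite /V mxE mul0r addr0 mulrn_eq0 /=.
  have := near0_0 hexpu; rewrite sh0 big_ord_recl !mxE expr0 mulr1 exprS !mul0r addr0 big1 => [|i _].
    by rewrite addr0 vtail0 => <-.
  by rewrite exprS mul0r mulr0.
- apply: near0_imp key => x /eqP; rewrite subr_eq0 => /eqP ->.
  rewrite /P coefM big_ord_recr /= subnn !coef_poly /= ltnW // subSnn expr1 binSn /V.
  rewrite addrC mulrDr; congr (_ + _); first by rewrite mulrnAl mulrnAr.
  rewrite mulrA mulr_sumr; apply: eq_bigr => j _; rewrite !coef_poly.
  have jd := ltn_ord j.
  have -> : (j < d.+2)%N by lia.
  have -> : (d - j < d.+1)%N by lia.
  rewrite mulrA mulrnAr -expr2 -exprD; congr (_ ^+ _ *+ _ * _).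
  by lia.
Qed.

(** Weierstrass preparation is avoided: the tail y^(d+1) g is kept, with g a unit. Here [C k] (t, x)
    is the k-th Taylor coefficient of F at y = t, and theta is the implicit solution t of [C d] (t,
    x) = 0, whose zero in t is simple by [taylor_simple]. *)
Lemma tschirnhaus n (F : 'rV[R]_n.+1 -> R) d : an F -> regular F d.+1 ->
  exists (theta : 'rV[R]_n -> R) (c : nat -> 'rV[R]_n -> R) (g : 'rV[R]_n.+1 -> R),
  [/\ an theta /\ theta 0 = 0, (forall k, an (c k)) /\ an g, g 0 != 0,
    (forall k, (k <= d)%N -> c k 0 = 0) /\ near0 (fun x => c d x = 0) &
    near0 (fun w => F (vcons (w 0 ord0 + theta (vtail w)) (vtail w)) =
      \sum_(k < d.+1) c k (vtail w) * w 0 ord0 ^+ k + w 0 ord0 ^+ d.+1 * g w)].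
Proof.
move=> hF rF.
pose S (w : 'rV[R]_n.+2) : 'rV[R]_n.+1 := vcons (w 0 ord0 + vtail w 0 ord0) (vtail (vtail w)).
have hS : anmap S.
  apply: anmap_vcons; first by apply: an_add; [exact: an_coord|exact: (anmap_vtail ord0)].
  by apply: anmap_comp (vtail0 _) _; exact: anmap_vtail.
have S0 : S 0 = 0 by rewrite /S !vtail0 !mxE addr0 vcons_00.
have [C [g [hC hg hexp]]] := taylor d.+1 (an_comp hS S0 hF).
have [V [hV V0 hCV]] := taylor_simple hF rF hC hg hexp.
have [U hU hCU] := an_divc0 (hC d).
pose j1 (x : 'rV[R]_1) : 'rV[R]_n.+1 := vcons (x 0 0) 0.
have hj1 : anmap j1 by apply: anmap_vcons; [exact: an_coord|exact: anmap_cst].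
have j10 : j1 0 = 0 by rewrite /j1 mxE vcons_00.
have Cd0 : C d 0 = 0.
  by have := near0_0 hCV; rewrite mxE vcons_00 mul0r.
have UV : near0 (fun x => U (j1 x) = V x).
  apply: (@near0_cancel _ _ 0) => //; first exact: an_comp.
  apply: near0_imp2 hCV (near0_comp hj1 j10 hCU) => x <- ->.
  by rewrite /j1 vconsK vcons0 vcons_00 Cd0 add0r.
have U0 : U 0 != 0 by have := near0_0 UV; rewrite j10 => ->.
(* As [C d] (t, x) = [C d] (0, x) + t U(t, x) with U(0) nonzero, the equation reads t = - [C d] (0,
   x) / U(t, x). On x = 0 the right-hand side is 0, so the quadratic bound of [ift] is trivial. *)
pose Phi (w : 'rV[R]_(n + 1)) : 'rV[R]_1 :=
  const_mx (- (C d (vcons 0 (lsubmx w)) * (U (vcons (rsubmx w 0 0) (lsubmx w)))^-1)).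
have hl := @anmap_lsubmx R n 1.
have hPhi : anmap Phi.
  move=> i; apply: (an_ext (an_opp (an_mul (f := fun w : 'rV[R]_(n + 1) => C d (vcons 0 (lsubmx w)))
     (g := fun w => (U (vcons (rsubmx w 0 0) (lsubmx w)))^-1) _ _))).
  - apply: an_comp (hC d); last by rewrite lsubmx0 vcons_00.
    by apply: anmap_vcons => //; exact: an_cst.
  - apply: an_inv; last by rewrite lsubmx0 rsubmx0 mxE vcons_00.
    apply: an_comp hU; last by rewrite lsubmx0 rsubmx0 mxE vcons_00.
    by apply: anmap_vcons; [exact: (@anmap_rsubmx R n 1 0)|exact: hl].
  - by move=> w; rewrite [in RHS]mxE.
have Phi0 (t : R) k : Phi (row_mx 0 (t *: delta_mx 0 k)) = 0.
  by apply/rowP => i; rewrite !mxE row_mxKl vcons_00 Cd0 mul0r oppr0.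
have [|j k|th [hth th0 hfix]] := ift hPhi.
- by have := Phi0 0 ord0; rewrite scale0r row_mx0.
- by exists 0, 1; split=> // t _; rewrite Phi0 mxE normr0 mul0r.
pose theta x := th x 0 0.
have htheta : an theta by exact: hth.
have theta0 : theta 0 = 0 by rewrite /theta th0 mxE.
pose T (x : 'rV[R]_n) : 'rV[R]_n.+1 := vcons (theta x) x.
have hT : anmap T by apply: anmap_vcons => //; exact: anmap_id.
have T0 : T 0 = 0 by rewrite /T theta0 vcons_00.
pose W (w : 'rV[R]_n.+1) : 'rV[R]_n.+2 := vcons (w 0 ord0) (T (vtail w)).
have hW : anmap W.
  apply: anmap_vcons; first exact: an_coord.
  by apply: anmap_comp (vtail0 n) hT; exact: anmap_vtail.
have W0 : W 0 = 0 by rewrite /W vtail0 T0 mxE vcons_00.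
have hexpW : near0 (fun w => F (vcons (w 0 ord0 + theta (vtail w)) (vtail w)) =
      \sum_(k < d.+1) C k (T (vtail w)) * w 0 ord0 ^+ k + w 0 ord0 ^+ d.+1 * g (W w)).
  apply: near0_imp (near0_comp hW W0 hexp) => w.
  by rewrite /S /W !vconsK !vcons0.
have hc k : an (fun x => C k (T x)) by exact: an_comp.
have hgW : an (fun w => g (W w)) by exact: an_comp.
have [u [hu u0 hFu]] := rF.
(* On x = 0 the expansion is compared with y^(d+1) u; uniqueness of the coefficients gives [C k 0] =
   0 and then g 0 = u 0. *)
have hz : near0 (fun y : 'rV[R]_1 =>
     \sum_(k < d.+1) C k 0 * y 0 0 ^+ k + y 0 0 ^+ d.+1 * (g (W (j1 y)) - u y) = 0).
  apply: near0_imp2 hFu (near0_comp hj1 j10 hexpW) => y.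
  rewrite /j1 vconsK vcons0 theta0 addr0 => -> E.
  rewrite mulrBr addrA E -/T.
  by under eq_bigr do rewrite -T0; rewrite subrr.
pose tz (x : 'rV[R]_0) := 0 : R.
have hgj : an (fun y : 'rV[R]_1 => g (W (j1 y)) - u y).
  by apply: an_sub => //; apply: (an_comp hj1 j10 hgW).
have Ck0 k : (k <= d)%N -> C k 0 = 0.
  move=> kd; have := @taylor_uniq R 0 d.+1 (fun k _ => C k 0) _ (fun k => an_cst 0 _) hgj hz k.
  by rewrite ltnS => /(_ kd) /near0_0.
exists theta, (fun k x => C k (T x)), (fun w => g (W w)); split=> //.
- have : near0 (fun y : 'rV[R]_1 => g (W (j1 y)) - u y = 0).
    apply: (@near0_cancelX _ _ 0 d.+1) => //; first exact: an_cst.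
    apply: near0_imp hz => y; rewrite big1 ?add0r ?mulr0 //.
    by move=> k _; rewrite Ck0 ?mul0r // -ltnS.
  by move/near0_0/eqP; rewrite subr_eq0 j10 => /eqP ->.
- split; first by move=> k kd; rewrite T0 Ck0.
  have hUT := an_neq0 (an_comp hT T0 hU); rewrite T0 in hUT.
  apply: near0_imp2 (near0_and hfix (hUT U0)) (near0_comp hT T0 hCU) => x [E1 E2] ->.
  rewrite /T vconsK vcons0; have : theta x = - (C d (vcons 0 x) * (U (T x))^-1).
    by rewrite /theta {1}E1 mxE row_mxKl row_mxKr.
  by move=> {1}->; rewrite mulNr divfK // subrr.
Qed.

End Tschirnhaus.

(** * Local uniformisation along an ultrafilter *)

Section Ultra.
Context {R : realType} {I : Type} (U : set_system I) {UF : UltraFilter U}.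
Implicit Types (r s C D e : R).

Definition ae (P : I -> Prop) := U [set i | P i].

Lemma ae_T (P : I -> Prop) : (forall i, P i) -> ae P.
Proof. by move=> h; apply: filterS filterT => i _; exact: h. Qed.

Lemma ae_imp (P Q : I -> Prop) : (forall i, P i -> Q i) -> ae P -> ae Q.
Proof. by move=> h; apply: filterS. Qed.

Lemma ae_and (P Q : I -> Prop) : ae P -> ae Q -> ae (fun i => P i /\ Q i).
Proof. exact: filterI. Qed.

Lemma ae_imp2 (P Q S : I -> Prop) : (forall i, P i -> Q i -> S i) -> ae P -> ae Q -> ae S.
Proof. by move=> h hP hQ; apply: ae_imp (ae_and hP hQ) => i []; exact: h. Qed.

Lemma ae_em (P : I -> Prop) : ae P \/ ae (fun i => ~ P i).
Proof. exact: in_ultra_setVsetC. Qed.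

Lemma ae_ex (P : I -> Prop) : ae P -> exists i, P i.
Proof. by move=> h; have [i hi] := filter_ex h; exists i. Qed.

Lemma ae_contra (P : I -> Prop) : ae P -> ae (fun i => ~ P i) -> False.
Proof. by move=> h1 h2; have [i []] := ae_ex (ae_and h1 h2). Qed.

Lemma ae_all (J : finType) (P : J -> I -> Prop) : (forall j, ae (P j)) -> ae (fun i => forall j, P j i).
Proof.
move=> h; suff: ae (fun i => forall j, j \in enum J -> P j i).
  by apply: ae_imp => i hi j; apply: hi; rewrite mem_enum.
elim: (enum J) => [|j s IH]; first exact: ae_T.
apply: ae_imp2 (h j) IH => i Pi hs k; rewrite inE => /orP[/eqP -> //|]; exact: hs.
Qed.

Lemma ae_exfin (J : finType) (P : J -> I -> Prop) : ae (fun i => exists j, P j i) -> exists j, ae (P j).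
Proof.
move=> h; apply: contrapT => hn.
have h2 : forall j, ae (fun i => ~ P j i).
  by move=> j; have [hj|//] := ae_em (P j); exfalso; apply: hn; exists j.
apply: (ae_contra h); apply: ae_imp (ae_all h2) => i hi [j]; exact: hi.
Qed.

Definition infi n (z : I -> 'rV[R]_n) := forall e : R, 0 < e -> ae (fun i => box e (z i)).

Lemma inf_near0 n (z : I -> 'rV[R]_n) (P : 'rV[R]_n -> Prop) : infi z -> near0 P -> ae (fun i => P (z i)).
Proof. by move=> hz [e e0 h]; apply: ae_imp (hz e e0) => i; exact: h. Qed.

Lemma inf_cont n (z : I -> 'rV[R]_n) (f : 'rV[R]_n -> R) : infi z -> an f ->
  forall e : R, 0 < e -> ae (fun i => `|f (z i) - f 0| < e).
Proof. by move=> hz hf e e0; exact: inf_near0 hz (an_cont hf e0). Qed.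

Lemma infP n (z : I -> 'rV[R]_n) :
  (forall k (e : R), 0 < e -> ae (fun i => `|z i 0 k| <= e)) -> infi z.
Proof. by move=> h e e0; apply: ae_all => k; exact: h. Qed.

Lemma inf_coord n (z : I -> 'rV[R]_n) k (e : R) : infi z -> 0 < e -> ae (fun i => `|z i 0 k| <= e).
Proof. by move=> hz e0; apply: ae_imp (hz e e0) => i; exact. Qed.

Lemma inf_an n m (z : I -> 'rV[R]_n) (q : 'rV[R]_n -> 'rV[R]_m) : anmap q -> q 0 = 0 ->
  infi z -> infi (fun i => q (z i)).
Proof.
move=> hq q0 hz e e0; apply: (inf_near0 (P := fun x => box e (q x)) hz).
by apply: near0_comp => //; exact: near0_box.
Qed.

Lemma ae_bounded_lim (u : I -> R) C : ae (fun i => `|u i| <= C) ->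
  exists l : R, forall e, 0 < e -> ae (fun i => `|u i - l| <= e).
Proof.
move=> hu; pose S := [set t : R | ae (fun i => t <= u i)].
have hS : has_sup S.
  split; first by exists (- C); apply: ae_imp hu => i; rewrite ler_norml => /andP[].
  exists C => t ht; have [i [h1]] := ae_ex (ae_and ht hu).
  by rewrite ler_norml => /andP[_]; exact: le_trans.
exists (sup S) => e e0.
have [t St tS] := sup_adherent e0 hS.
have h2 : ae (fun i => ~ (sup S + e <= u i)).
  have [h|//] := ae_em (fun i => sup S + e <= u i).
  exfalso; have := ub_le_sup hS.2 h; lra.
apply: ae_imp2 St h2 => i h3 /negP; rewrite -ltNge => h4.
by rewrite ler_norml; apply/andP; split; lra.
Qed.

(* The germ at 0 of z along U lies on an analytic image of a space of smaller dimension. *)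
Definition deg n (z : I -> 'rV[R]_n) := exists (k : nat) (q : 'rV[R]_k -> 'rV[R]_n) (w : I -> 'rV[R]_k),
  [/\ (k < n)%N, anmap q, q 0 = 0, infi w & ae (fun i => z i = q (w i))].

Definition res n (z : I -> 'rV[R]_n) (q : 'rV[R]_n -> 'rV[R]_n) (w : I -> 'rV[R]_n) :=
  [/\ anmap q, q 0 = 0, infi w & ae (fun i => z i = q (w i))].

Definition pos n (z : I -> 'rV[R]_n) := ae (fun i => forall k, 0 < z i 0 k).

Lemma res_id n (z : I -> 'rV[R]_n) : infi z -> res z (fun x => x) z.
Proof. by move=> hz; split=> //; [exact: anmap_id|exact: ae_T]. Qed.

Lemma res_comp n (z w v : I -> 'rV[R]_n) q p : res z q w -> res w p v -> res z (fun x => q (p x)) v.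
Proof.
move=> [hq q0 hw zw] [hp p0 hv wv]; split=> //.
- exact: anmap_comp.
- by rewrite p0.
- by apply: ae_imp2 zw wv => i -> ->.
Qed.

Lemma nondeg_res n (z w : I -> 'rV[R]_n) q : ~ deg z -> res z q w -> ~ deg w.
Proof.
move=> nz [hq q0 hw zw] [k [p [v [kn hp p0 hv wv]]]]; apply: nz.
exists k, (fun x => q (p x)), v; split=> //; first exact: anmap_comp.
  by rewrite p0.
by apply: ae_imp2 zw wv => i -> ->.
Qed.

(** A coordinate vanishing along U could be dropped, leaving one parameter less. *)
Lemma nondeg_neq0 n (z : I -> 'rV[R]_n) k : infi z -> ~ deg z -> ae (fun i => z i 0 k != 0).
Proof.
case: n z k => [|n] z k hz nz; first by case: k.
have [h0|] := ae_em (fun i => z i 0 k = 0); last by apply: ae_imp => i /eqP.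
exfalso; apply: nz; pose q (x : 'rV[R]_n) : 'rV[R]_n.+1 :=
  \row_j if unlift k j is Some j' then x 0 j' else 0.
exists n, q, (fun i => \row_j z i 0 (lift k j)); split=> //.
- move=> j; case: (unliftP k j) => [j' ->|->].
    by apply: an_ext (an_coord j') _ => x; rewrite mxE liftK.
  by apply: an_ext (an_cst n 0) _ => x; rewrite mxE unlift_none.
- by apply/rowP => j; rewrite !mxE; case: unlift => // j'; rewrite mxE.
- by move=> e e0; apply: ae_imp (hz e e0) => i hi j; rewrite mxE; exact: hi.
- apply: ae_imp h0 => i h0; apply/rowP => j; rewrite mxE.
  by case: unliftP => [j' ->|->] //; rewrite mxE.
Qed.

Lemma nondeg_tail n (z : I -> 'rV[R]_n.+1) : infi z -> ~ deg z -> ~ deg (fun i => vtail (z i)).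
Proof.
move=> hz nz [k [q [w [kn hq q0 hw zw]]]]; apply: nz.
exists k.+1, (fun x : 'rV[R]_k.+1 => vcons (x 0 ord0) (q (vtail x))), (fun i => vcons (z i 0 ord0) (w i)); split=> //.
- apply: anmap_vcons; first exact: an_coord.
  by apply: anmap_comp (vtail0 k) hq; exact: anmap_vtail.
- by rewrite vtail0 q0 mxE vcons_00.
- move=> e e0; apply: ae_imp2 (hz e e0) (hw e e0) => i h1 h2 j.
  by rewrite mxE; case: unlift => [j'|]; [exact: h2|exact: h1].
- by apply: ae_imp zw => i E; rewrite vconsK vcons0 -E vcons_eta.
Qed.

(** A substitution that is toric up to units, with exponent matrix M: it pulls monomials back to
    monomials times units. *)
Definition tor n (z : I -> 'rV[R]_n) (M : 'I_n -> 'I_n -> nat) q w :=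
  res z q w /\ forall k, monoE (M k) (fun x => q x 0 k).

Definition idM n (k j : 'I_n) : nat := (j == k : nat).

Lemma tor_id n (z : I -> 'rV[R]_n) : infi z -> tor z (@idM n) (fun x => x) z.
Proof. by move=> hz; split; [exact: res_id|move=> k; exact: monoE_coord]. Qed.

Lemma tor_comp n (z w v : I -> 'rV[R]_n) M N q p : tor z M q w -> tor w N p v ->
  tor z (fun k => pullm N (M k)) (fun x => q (p x)) v.
Proof.
move=> [rq hM] [rp hN]; split; first exact: res_comp rq rp.
case: rp => hp p0 _ _ k; exact: (monoE_comp hp p0 hN (hM k)).
Qed.

Lemma pullm_comp n (M N : 'I_n -> 'I_n -> nat) (m : 'I_n -> nat) j :
  pullm (fun k => pullm N (M k)) m j = pullm N (pullm M m) j.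
Proof.
rewrite /pullm; under eq_bigr do rewrite big_distrr /=.
rewrite exchange_big; apply: eq_bigr => k _; rewrite big_distrl /=.
by apply: eq_bigr => i _; rewrite mulnA.
Qed.

Lemma pullm_id n (m : 'I_n -> nat) j : pullm (@idM n) m j = m j.
Proof.
rewrite /pullm /idM (bigD1 j) //= eqxx muln1 big1 ?addn0 // => i /negbTE ij.
by rewrite eq_sym ij muln0.
Qed.

Lemma eq_pullm n k (M M' : 'I_n -> 'I_k -> nat) m m' j : (forall i, M i =1 M' i) -> m =1 m' ->
  pullm M m j = pullm M' m' j.
Proof. by move=> hM hm; apply: eq_bigr => i _; rewrite hM hm. Qed.

Lemma pullm_scale n k (M : 'I_n -> 'I_k -> nat) m (e : nat) j :
  pullm M (fun i => e * m i)%N j = (e * pullm M m j)%N.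
Proof. by rewrite /pullm big_distrr /=; apply: eq_bigr => i _; rewrite mulnA. Qed.

Lemma pullm_le n k (M : 'I_n -> 'I_k -> nat) m m' j : (forall i, m i <= m' i)%N ->
  (pullm M m j <= pullm M m' j)%N.
Proof. by move=> h; apply: leq_sum => i _; rewrite leq_mul2r h orbT. Qed.

Lemma pullm_D n k (M M' : 'I_n -> 'I_k -> nat) m j :
  pullm (fun i j => M i j + M' i j)%N m j = (pullm M m j + pullm M' m j)%N.
Proof. by rewrite /pullm -big_split; apply: eq_bigr => i _; rewrite mulnDr. Qed.

Lemma pullm_1 n k (M : 'I_n -> 'I_k -> nat) (m : 'I_n -> nat) l j : (forall i, i != l -> M i j = 0%N) ->
  pullm M m j = (m l * M l j)%N.
Proof.
by move=> h; rewrite /pullm (bigD1 l) //= big1 ?addn0 // => i il; rewrite h ?muln0.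
Qed.

Lemma ae_sign (u : I -> R) : ae (fun i => u i != 0) -> exists2 s : R, s ^+ 2 = 1 & ae (fun i => 0 < s * u i).
Proof.
move=> h; have [hp|hn] := ae_em (fun i => 0 < u i).
  by exists 1; [rewrite expr1n|apply: ae_imp hp => i; rewrite mul1r].
exists (- 1); first by rewrite sqrrN expr1n.
by apply: ae_imp2 h hn => i u0 /negP; rewrite -leNgt mulN1r oppr_gt0 lt_neqAle u0.
Qed.

Lemma flip n (z : I -> 'rV[R]_n) : infi z -> ~ deg z -> exists q w, tor z (@idM n) q w /\ pos w.
Proof.
move=> hz nz; have /choice[s hs] k : exists s : R, s ^+ 2 = 1 /\ ae (fun i => 0 < s * z i 0 k).
  by have [s s1 s2] := ae_sign (nondeg_neq0 k hz nz); exists s.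
have s1 k : s k * s k = 1 by rewrite -expr2; have [] := hs k.
have s0 k : s k != 0 by apply/eqP => h; have := s1 k; rewrite h mul0r => /esym/eqP; rewrite oner_eq0.
pose q (x : 'rV[R]_n) : 'rV[R]_n := \row_k (s k * x 0 k).
have hq : anmap q.
  by move=> k; apply: an_ext (an_mul (an_cst n (s k)) (an_coord k)) _ => x; rewrite mxE.
have q0 : q 0 = 0 by apply/rowP => k; rewrite !mxE mulr0.
exists q, (fun i => q (z i)); split; last first.
  by apply: ae_all => k; have [_] := hs k; apply: ae_imp => i; rewrite mxE.
split; first split=> //.
- exact: inf_an.
- by apply: ae_T => i; apply/rowP => k; rewrite !mxE mulrA s1 mul1r.
- move=> k; exists (fun=> s k); split; [exact: an_cst|by []|].
  by apply: near0_T => x; rewrite mxE mulrC /idM mon_delta.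
Qed.

Lemma root_exists (x : R) k : 0 < x -> (0 < k)%N -> exists2 y : R, 0 < y & y ^+ k = x.
Proof.
move=> x0 k0; exists (x `^ (k%:R^-1)); first exact: powR_gt0.
rewrite -powR_mulrn ?powR_ge0 // -powRrM mulVf ?powRr1 //; first exact: ltW.
by rewrite pnatr_eq0 -lt0n.
Qed.

Definition powM n (e : 'I_n -> nat) (k j : 'I_n) : nat := (e k * (j == k))%N.

Lemma pullm_pow n (e m : 'I_n -> nat) j : pullm (powM e) m j = (m j * e j)%N.
Proof.
rewrite (@pullm_1 _ _ _ _ j j); first by rewrite /powM eqxx muln1.
by move=> i ij; rewrite /powM eq_sym (negbTE ij) muln0.
Qed.

Lemma tor_pow n (z : I -> 'rV[R]_n) (e : 'I_n -> nat) : infi z -> pos z -> (forall k, 0 < e k)%N ->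
  exists q w, tor z (powM e) q w /\ pos w.
Proof.
move=> hz pz e0; pose q (x : 'rV[R]_n) : 'rV[R]_n := \row_k (x 0 k ^+ e k).
have /choice[w hw] i : exists w : 'rV[R]_n, (forall k, 0 < z i 0 k) ->
    forall k, 0 < w 0 k /\ w 0 k ^+ e k = z i 0 k.
  have [zp|zp] := pselect (forall k, 0 < z i 0 k); last by exists 0.
  have /choice[y hy] k : exists y : R, 0 < y /\ y ^+ e k = z i 0 k.
    by have [y y0 h] := root_exists (zp k) (e0 k); exists y.
  by exists (\row_k y k) => _ k; rewrite mxE; exact: hy.
have pw : pos w by apply: ae_imp pz => i /hw h k; have [] := h k.
exists q, w; split=> //; split; first split.
- by move=> k; apply: an_ext (an_exp (e k) (an_coord k)) _ => x; rewrite mxE.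
- by apply/rowP => k; rewrite !mxE expr0n eqn0Ngt e0.
- apply: infP => k d d0; apply: ae_imp2 pz (inf_coord k hz (exprn_gt0 (e k) d0)) => i /hw h.
  have [w0 wE] := h k; rewrite -wE normrX => hle.
  by rewrite -(ler_pXn2r (e0 k)) ?nnegrE // ltW.
- by apply: ae_imp pz => i /hw h; apply/rowP => k; rewrite mxE; have [_ ->] := h k.
- move=> k; apply: (monoE_eqm (m := fun j => e k * (j == k : nat))%N) => //.
  apply: monoE_eq (monoE_exp (e k) (monoE_coord k)) _.
  by apply: near0_T => x; rewrite mxE.
Qed.

(* Exponents of the substitution x_k := x_k * x_l. *)
Definition addM n (k l : 'I_n) (i j : 'I_n) : nat := (idM i j + (i == k) * (j == l))%N.

Lemma pullm_add n (k l : 'I_n) m j : pullm (addM k l) m j = (m j + m k * (j == l))%N.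
Proof.
rewrite pullm_D pullm_id (@pullm_1 _ _ _ _ k j) ?eqxx ?mul1n //.
by move=> i /negbTE ->; rewrite mul0n.
Qed.

Lemma tor_ratio n (z : I -> 'rV[R]_n) k l : infi z -> pos z -> k != l ->
  (forall e, 0 < e -> ae (fun i => z i 0 k / z i 0 l <= e)) ->
  exists q w, tor z (addM k l) q w /\ pos w.
Proof.
move=> hz pz kl hr.
pose q (x : 'rV[R]_n) : 'rV[R]_n := \row_j (if j == k then x 0 k * x 0 l else x 0 j).
pose w i : 'rV[R]_n := \row_j (if j == k then z i 0 k / z i 0 l else z i 0 j).
have pw : pos w.
  by apply: ae_imp pz => i h j; rewrite mxE; case: ifP => // _; rewrite divr_gt0.
exists q, w; split=> //; split; first split.
- move=> j; apply: (@an_ext _ _ (fun x : 'rV[R]_n => if j == k then x 0 k * x 0 l else x 0 j)).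
    by case: (j == k); [apply: an_mul|]; exact: an_coord.
  by move=> x; rewrite mxE.
- by apply/rowP => j; rewrite !mxE mul0r; case: ifP.
- apply: infP => j e e0; case: (eqVneq j k) => [->|/negbTE jk].
    apply: ae_imp2 pz (hr e e0) => i h he; rewrite mxE eqxx ger0_norm //.
    by rewrite divr_ge0 // ltW.
  by apply: ae_imp (inf_coord j hz e0) => i; rewrite mxE jk.
- apply: ae_imp pz => i h; apply/rowP => j; rewrite !mxE eqxx.
  by case: eqP => // ->; rewrite eq_sym (negbTE kl) divfK // gt_eqF.
- move=> j; case: (eqVneq j k) => [->|/negbTE jk].
    apply: monoE_eqm (monoE_eq (monoE_mul (monoE_coord k) (monoE_coord l)) _).
      by move=> i; rewrite /addM eqxx mul1n.
    by apply: near0_T => x; rewrite mxE eqxx.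
  apply: monoE_eqm (monoE_eq (monoE_coord j) _).
    by move=> i; rewrite /addM jk mul0n addn0.
  by apply: near0_T => x; rewrite mxE jk.
Qed.

(* Exponents of the substitution x_k := x_l * (a + x_k), with a nonzero. *)
Definition mrgM n (k l : 'I_n) (i j : 'I_n) : nat := if i == k then (j == l : nat) else idM i j.

Lemma tor_merge n (z : I -> 'rV[R]_n) k l (a : R) : infi z -> ~ deg z -> pos z -> k != l -> 0 < a ->
  (forall e, 0 < e -> ae (fun i => `|z i 0 k / z i 0 l - a| <= e)) ->
  exists q w, tor z (mrgM k l) q w /\ pos w.
Proof.
move=> hz nz pz kl a0 hr.
pose q (x : 'rV[R]_n) : 'rV[R]_n := \row_j (if j == k then x 0 l * (a + x 0 k) else x 0 j).
pose w i : 'rV[R]_n := \row_j (if j == k then z i 0 k / z i 0 l - a else z i 0 j).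
have tq : tor z (mrgM k l) q w.
  split; first split.
  - move=> j; apply: (@an_ext _ _ (fun x : 'rV[R]_n => if j == k then x 0 l * (a + x 0 k) else x 0 j)).
      case: (j == k); last exact: an_coord.
      by apply: an_mul; [|apply: an_add; [exact: an_cst|]]; exact: an_coord.
    by move=> x; rewrite mxE.
  - by apply/rowP => j; rewrite !mxE mul0r; case: ifP.
  - apply: infP => j e e0; case: (eqVneq j k) => [->|/negbTE jk].
      by apply: ae_imp (hr e e0) => i he; rewrite mxE eqxx.
    by apply: ae_imp (inf_coord j hz e0) => i; rewrite mxE jk.
  - apply: ae_imp pz => i h; apply/rowP => j; rewrite !mxE eqxx.
    case: eqP => // ->; rewrite eq_sym (negbTE kl).
    by rewrite addrC subrK mulrC divfK // gt_eqF.
  - move=> j; rewrite /mrgM; case: (eqVneq j k) => [->|/negbTE jk].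
      apply: monoE_eqm (monoE_eq (monoE_mul (monoE_coord l) (monoE_unit (u := fun x : 'rV[R]_n => a + x 0 k) _ _)) _).
      + by move=> i; rewrite addn0.
      + by apply: an_add; [exact: an_cst|exact: an_coord].
      + by rewrite mxE addr0 gt_eqF.
      + by apply: near0_T => x; rewrite mxE eqxx.
    apply: monoE_eq (monoE_coord j) _.
    by apply: near0_T => x; rewrite mxE jk.
have [_ _ hw _] := tq.1.
(* After subtracting a, the new k-th coordinate may be negative; [flip] restores positivity without
   changing exponents. *)
have [p [v [tp pv]]] := flip hw (nondeg_res nz tq.1).
exists (fun x => q (p x)), v; split=> //.
have [r1 r2] := tor_comp tq tp; split=> // j.
by apply: monoE_eqm (r2 j) => i; rewrite pullm_id.
Qed.

(** Along U the ratio z_k / z_l tends to 0, to infinity or to a positive limit, and each case has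
    its substitution. Each replaces an exponent at k or l by the sum of both, so exponents with
    equal sums become equal in one more place and stay equal elsewhere. *)
Lemma tor_step n (z : I -> 'rV[R]_n) k l : infi z -> ~ deg z -> pos z -> k != l ->
  exists M q w, [/\ tor z M q w, pos w & forall a b : 'I_n -> nat,
    (a k + a l = b k + b l)%N ->
    (forall j, j != k -> j != l -> a j = b j -> pullm M a j = pullm M b j) /\
    (pullm M a k = pullm M b k \/ pullm M a l = pullm M b l)].
Proof.
move=> hz nz pz kl.
have add k' l' : k' != l' -> (forall e, 0 < e -> ae (fun i => z i 0 k' / z i 0 l' <= e)) ->
  exists M q w, [/\ tor z M q w, pos w & forall a b : 'I_n -> nat,
    (a k' + a l' = b k' + b l')%N ->
    (forall j, j != k' -> j != l' -> a j = b j -> pullm M a j = pullm M b j) /\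
    (pullm M a k' = pullm M b k' \/ pullm M a l' = pullm M b l')].
  move=> kl' /(tor_ratio hz pz kl')[q [w [tq pw]]]; exists (addM k' l'), q, w; split=> // a b E.
  split=> [j jk jl ab|]; rewrite !pullm_add.
    by rewrite (negbTE jl) !muln0 ab.
  by right; rewrite eqxx; lia.
have [hb|hb] := pselect (exists C, ae (fun i => `|z i 0 k / z i 0 l| <= C)); last first.
  have lk : l != k by rewrite eq_sym.
  have hr e : 0 < e -> ae (fun i => z i 0 l / z i 0 k <= e).
    move=> e0; have [h|h] := ae_em (fun i => `|z i 0 k / z i 0 l| <= e^-1).
      by exfalso; apply: hb; exists e^-1.
    apply: ae_imp2 h pz => i /negP; rewrite -ltNge => h hp.
    rewrite -[X in X <= _]invf_div -[X in _ <= X]invrK lef_pV2 ?posrE ?invr_gt0 ?divr_gt0 //.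
    by move: h; rewrite ger0_norm ?divr_ge0 ?(ltW (hp _)) // => /ltW.
  have [M [q [w [tq pw h]]]] := add l k lk hr; exists M, q, w; split=> // a b E.
  have [] := h a b; first by rewrite addnC E addnC.
  by move=> h1 h2; split=> [j jk jl|]; [exact: h1|tauto].
have [C hC] := hb; have [a ha] := ae_bounded_lim hC.
have a0 : 0 <= a.
  rewrite leNgt; apply/negP => an; have := ha (- a / 2); rewrite divr_gt0 ?oppr_gt0 // => /(_ isT) h.
  have [i [hi hp]] := ae_ex (ae_and h pz).
  have := divr_gt0 (hp k) (hp l); move: hi; rewrite ler_norml => /andP[]; lra.
have [a0'|a0'] := eqVneq a 0.
  apply: add => // e e0; apply: ae_imp (ha e e0) => i; rewrite a0' subr0.
  exact: le_trans (ler_norm _).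
have ap : 0 < a by rewrite lt_neqAle eq_sym a0'.
have [q [w [tq pw]]] := tor_merge hz nz pz kl ap ha.
exists (mrgM k l), q, w; split=> // x y E.
have lk : l == k = false by rewrite eq_sym (negbTE kl).
split=> [j jk jl xy|].
  rewrite !(@pullm_1 _ _ _ _ j j); first by rewrite xy.
    by move=> i ij; rewrite /mrgM /idM (negbTE jl) [j == i]eq_sym (negbTE ij) if_same.
  by move=> i ij; rewrite /mrgM /idM (negbTE jl) [j == i]eq_sym (negbTE ij) if_same.
have Z m : pullm (mrgM k l) m k = 0%N.
  rewrite /pullm big1 // => i _; rewrite /mrgM /idM.
  by case: (eqVneq i k) => [_|ik]; rewrite ?(negbTE kl) ?[k == i]eq_sym ?(negbTE ik) muln0.
by left; rewrite !Z.
Qed.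

(** Makes one of two monomials divide the other, by induction on the number of coordinates in which
    their exponents differ. *)
Lemma tor_compare n (z : I -> 'rV[R]_n) (a b : 'I_n -> nat) : infi z -> ~ deg z -> pos z ->
  exists M q w, [/\ tor z M q w, pos w &
    (forall j, pullm M a j <= pullm M b j)%N \/ (forall j, pullm M b j <= pullm M a j)%N].
Proof.
move: {2}(#|[pred k | a k != b k]|) (leqnn #|[pred k | a k != b k]|) => s.
elim: s z a b => [|s IH] z a b hs hz nz pz.
  exists (@idM n), (fun x => x), z; split=> //; first exact: tor_id.
  left=> j; rewrite !pullm_id; move: hs; rewrite leqn0 => /eqP/card0_eq/(_ j).
  by rewrite !inE => /negbFE/eqP ->.
have [hab|/existsNP[k /negP]] := pselect (forall k, a k <= b k)%N.
  by exists (@idM n), (fun x => x), z; split=> //; [exact: tor_id|left=> j; rewrite !pullm_id].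
rewrite -ltnNge => bk.
have [hba|/existsNP[l /negP]] := pselect (forall k, b k <= a k)%N.
  by exists (@idM n), (fun x => x), z; split=> //; [exact: tor_id|right=> j; rewrite !pullm_id].
rewrite -ltnNge => al.
have kl : k != l by apply/eqP => E; rewrite E in bk; lia.
(* Weights with (a_k - b_k) e_k = (b_l - a_l) e_l: after [tor_pow] the two exponents have equal sums
   over k and l, as [tor_step] demands. *)
pose e j := if j == k then (b l - a l)%N else if j == l then (a k - b k)%N else 1%N.
have e0 j : (0 < e j)%N by rewrite /e; case: ifP => _; [lia|case: ifP => _; lia].
have [q1 [z1 [t1 p1]]] := tor_pow hz pz e0.
have [_ _ hz1 _] := t1.1; have nz1 := nondeg_res nz t1.1.
have [M2 [q2 [z2 [t2 p2 h2]]]] := tor_step hz1 nz1 p1 kl.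
have [_ _ hz2 _] := t2.1; have nz2 := nondeg_res nz1 t2.1.
pose a2 := pullm M2 (pullm (powM e) a); pose b2 := pullm M2 (pullm (powM e) b).
have E : (pullm (powM e) a k + pullm (powM e) a l = pullm (powM e) b k + pullm (powM e) b l)%N.
  rewrite !pullm_pow /e eqxx eq_sym (negbTE kl) eqxx.
  have [x ->] : exists x, a k = (b k + x)%N by exists (a k - b k)%N; lia.
  have [y ->] : exists y, b l = (a l + y)%N by exists (b l - a l)%N; lia.
  rewrite !addKn; nia.
have [h3 h4] := h2 _ _ E.
have hlt : (#|[pred j | a2 j != b2 j]| <= s)%N.
  rewrite -ltnS; apply: leq_trans hs; apply: proper_card.
  apply/properP; split.
    apply/fintype.subsetP => j; rewrite !inE; apply: contraNN => /eqP ab.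
    have jk : j != k by apply/eqP => jk; rewrite jk in ab; lia.
    have jl : j != l by apply/eqP => jl; rewrite jl in ab; lia.
    by apply/eqP/h3 => //; rewrite !pullm_pow ab.
  case: h4 => h4; [exists k|exists l]; rewrite !inE ?negbK; try (apply/eqP; exact: h4).
    by apply/eqP; lia.
  by apply/eqP; lia.
have [M3 [q3 [z3 [t3 p3 h5]]]] := IH z2 a2 b2 hlt hz2 nz2 p2.
exists (fun k => pullm M3 (pullm M2 (powM e k))), (fun x => q1 (q2 (q3 x))), z3; split=> //.
  by apply: tor_comp (tor_comp t1 t2) t3.
have P m j : pullm (fun k => pullm M3 (pullm M2 (powM e k))) m j =
    pullm M3 (pullm M2 (pullm (powM e) m)) j.
  rewrite pullm_comp; apply: eq_pullm => // i; exact: pullm_comp.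
by case: h5 => h5; [left|right] => j; rewrite !P; exact: h5.
Qed.

Lemma tor_min n (z : I -> 'rV[R]_n) (J : eqType) (s : seq J) (a : J -> 'I_n -> nat) j0 :
  infi z -> ~ deg z -> pos z ->
  exists M q w k, [/\ tor z M q w, pos w, k \in j0 :: s &
    forall j, j \in j0 :: s -> forall i, (pullm M (a k) i <= pullm M (a j) i)%N].
Proof.
move=> hz nz pz; elim: s => [|j s [M [q [w [k [t pw ks hk]]]]]].
  exists (@idM n), (fun x => x), z, j0; split=> //; [exact: tor_id|exact: mem_head|].
  by move=> j; rewrite inE => /eqP ->.
have [_ _ hw _] := t.1; have nw := nondeg_res nz t.1.
have [M' [q' [w' [t' pw' h]]]] := tor_compare (pullm M (a k)) (pullm M (a j)) hw nw pw.
have t2 := tor_comp t t'.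
have sub x : x \in j0 :: s -> x \in j0 :: j :: s.
  by rewrite !inE => /orP[->|->]; rewrite ?orbT.
have split3 x : x \in j0 :: j :: s -> x = j \/ x \in j0 :: s.
  by rewrite !inE => /or3P[->|/eqP ->|->]; rewrite ?orbT; by [right|left].
case: h => h.
  exists (fun i => pullm M' (M i)), (fun x => q (q' x)), w', k; split; [exact: t2|by []|exact: sub|].
  move=> x /split3[->|xs] i; rewrite !pullm_comp; first exact: h.
  by apply: pullm_le; exact: hk.
exists (fun i => pullm M' (M i)), (fun x => q (q' x)), w', j; split; [exact: t2|by []|by rewrite !inE eqxx orbT|].
move=> x /split3[->|xs] i; rewrite !pullm_comp //.
by apply: leq_trans (h i) _; apply: pullm_le; exact: hk.
Qed.

End Ultra.

(** * Resolution by induction on the number of variables and on the order *)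

Section Resolve.
Context {R : realType} {I : Type} (U : set_system I) {UF : UltraFilter U}.
Implicit Types (r s C D e : R).

Local Notation ae := (ae U).
Local Notation infi := (infi U).
Local Notation deg := (deg U).
Local Notation res := (res U).
Local Notation pos := (pos U).
Local Notation tor := (tor U).

(* Local uniformisation along z: after a substitution q, F is a monomial times a unit. *)
Definition resolves n := forall (z : I -> 'rV[R]_n) F, infi z -> ~ deg z -> an F -> ~ ger0 F ->
  exists q w, [/\ res z q w, pos w & mono (fun x => F (q x))].

Lemma ger0_prod n (J : Type) (s : seq J) (f : J -> 'rV[R]_n -> R) :
  (forall j, an (f j)) -> (forall j, ~ ger0 (f j)) -> ~ ger0 (fun x => \prod_(j <- s) f j x).
Proof.
move=> hf nf; elim: s => [|j s IH].
  by move=> /near0_0; rewrite big_nil => /eqP; rewrite oner_eq0.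
move=> h; apply: (near0_neq0_mul (hf j) (an_prod s hf) (nf j) IH).
by apply: near0_imp h => x; rewrite big_cons.
Qed.

(** Resolving the product resolves each factor, by [mono_factor]. Germs that are identically zero
    are replaced by 1 to keep the product nonzero. *)
Lemma resolve_seq n (z : I -> 'rV[R]_n) (J : eqType) (s : seq J) (f : J -> 'rV[R]_n -> R) :
  resolves n -> infi z -> ~ deg z -> (forall j, an (f j)) -> (forall j, j \in s -> ~ ger0 (f j)) ->
  exists q w, [/\ res z q w, pos w & forall j, j \in s -> mono (fun x => f j (q x))].
Proof.
move=> hn hz nz hf nf.
pose f' j := if `[< ger0 (f j) >] then fun=> 1 else f j.
have hf' j : an (f' j) by rewrite /f'; case: ifP => // _; exact: an_cst.
have nf' j : ~ ger0 (f' j).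
  rewrite /f'; case: asboolP => // _ /near0_0 /eqP; by rewrite oner_eq0.
have [q [w [rq pw hm]]] := hn z _ hz nz (an_prod s hf') (ger0_prod (s := s) hf' nf').
exists q, w; split=> // j js; have [hq q0 _ _] := rq.
have E : f' j = f j by rewrite /f'; case: asboolP => // h; case: (nf j js h).
rewrite -E; apply: (mono_factor (g := fun x => \prod_(i <- rem j s) f' i (q x))).
- exact: an_comp.
- by apply: an_prod => i; exact: an_comp.
- by apply: mono_eq hm _; apply: near0_T => x; rewrite (big_rem j).
Qed.

Lemma coord_nger0 n k : ~ ger0 (fun x : 'rV[R]_n => x 0 k).
Proof.
move=> [r r0 h]; have := h (const_mx r); rewrite mxE => hr.
suff: r = 0 by move/eqP; rewrite gt_eqF.
by apply: hr => i; rewrite mxE gtr0_norm.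
Qed.

(** The lowest slope of the Newton polygon. Once the nonzero coefficients c k are monomials of
    exponent [al k] times units, the slopes [al k] / (d + 1 - k) are made comparable by toric
    substitutions; m is the least of them, attained at k0, where b k0 becomes a unit. *)
Lemma newton n (z : I -> 'rV[R]_n) d (c : nat -> 'rV[R]_n -> R) k1 : resolves n ->
  infi z -> ~ deg z -> (forall k, an (c k)) -> (forall k, (k < d)%N -> c k 0 = 0) ->
  (k1 < d)%N -> ~ ger0 (c k1) ->
  exists q w (m : 'I_n -> nat) (b : nat -> 'rV[R]_n -> R), [/\ res z q w /\ pos w,
    (forall j, mono (fun x => q x 0 j)), (exists j, (0 < m j)%N),
    (forall k, an (b k)) /\ (exists2 k0, (k0 < d)%N & b k0 0 != 0) &
    forall k, (k < d)%N -> near0 (fun x => c k (q x) = mon m x ^+ (d.+1 - k) * b k x)].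
Proof.
move=> hn hz nz hc c0 k1d nk1.
pose K := [seq k <- iota 0 d | ~~ `[< ger0 (c k) >]].
have KP k : (k \in K) = (k < d)%N && ~~ `[< ger0 (c k) >].
  by rewrite mem_filter mem_iota andbC.
have k1K : k1 \in K by rewrite KP k1d; apply/negP => /asboolP.
pose f (j : nat + 'I_n) := match j with inl k => c k | inr j => fun x : 'rV[R]_n => x 0 j end.
have [q1 [w1 [rq1 pw1 hm1]]] : exists q w, [/\ res z q w, pos w & forall j : nat + 'I_n,
    j \in map inl K ++ map inr (enum 'I_n) -> mono (fun x => f j (q x))].
  apply: resolve_seq => //; first by case=> [k|j] /=; [exact: hc|exact: an_coord].
  move=> j; rewrite mem_cat => /orP[/mapP[k kK ->]|/mapP[k _ ->]] /=; last exact: coord_nger0.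
  by move: kK; rewrite KP => /andP[_ /negP] h1 h2; apply: h1; apply/asboolP.
have /choice[al hal] k : exists m, k \in K -> monoE m (fun x => c k (q1 x)).
  have [kK|] := boolP (k \in K); last by exists (fun=> 0%N).
  by have [|m hm] := hm1 (inl k); [rewrite mem_cat map_f|exists m].
have hm1c j : mono (fun x => q1 x 0 j).
  by apply: (hm1 (inr j)); rewrite mem_cat [X in _ || X]map_f ?orbT // mem_enum.
have [_ _ hw1 _] := rq1; have nw1 := nondeg_res (UF:=UF) nz rq1.
(* Multiplying by N! turns the slopes [al k] / (N - k) into integral exponents that [tor_min] can
   compare. *)
pose N := d.+1; pose e k := (N`! %/ (N - k))%N.
have [M [q2 [w2 [k0 [t2 pw2 k0K hmin]]]]] := tor_min K (fun k i => e k * al k i)%N k1 hw1 nw1 pw1.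
have {}k0K : k0 \in K by move: k0K; rewrite inE => /orP[/eqP ->|].
have k0d : (k0 < d)%N by move: k0K; rewrite KP => /andP[].
have [_ _ hw2 _] := t2.1.
have e1 (i : 'I_n) : (0 < N - k0)%N by rewrite /N; lia.
(* Raising all coordinates to the power N - k0 makes the least slope itself integral. *)
have [q3 [w3 [t3 pw3]]] := tor_pow (e := fun=> (N - k0)%N) hw2 pw2 e1.
have t23 := tor_comp (UF:=UF) t2 t3; have r123 := res_comp (UF:=UF) rq1 t23.1.
set q23 := (fun x => q2 (q3 x)) in t23 r123.
pose be k := pullm M (al k).
have [hq23 q230 _ _] := t23.1.
have hck k : k \in K -> monoE (fun i => be k i * (N - k0))%N (fun x => c k (q1 (q23 x))).
  move=> kK; apply: monoE_eqm (monoE_comp hq23 q230 t23.2 (hal k kK)) => i.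
  by rewrite pullm_comp pullm_pow.
have hbe k i : k \in K -> ((N - k) * be k0 i <= (N - k0) * be k i)%N.
  move=> kK; have kd : (k < d)%N by move: kK; rewrite KP => /andP[].
  have := hmin k; rewrite inE kK orbT => /(_ isT i); rewrite !pullm_scale -/(be _) => h.
  have ek k' : (k' < d)%N -> (e k' * (N - k') = N`!)%N.
    by move=> kd'; rewrite /e divnK // dvdn_fact // /N; lia.
  have := leq_mul (leqnn ((N - k) * (N - k0))%N) h.
  have -> : ((N - k) * (N - k0) * (e k0 * be k0 i) = N`! * ((N - k) * be k0 i))%N.
    by rewrite -(ek k0 k0d); lia.
  have -> : ((N - k) * (N - k0) * (e k * be k i) = N`! * ((N - k0) * be k i))%N.
    by rewrite -(ek k kd); lia.
  by rewrite leq_pmul2l // fact_gt0.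
have /choice[b hb] k : exists b, [/\ an b, (k = k0 -> b 0 != 0) &
    ((k < d)%N -> near0 (fun x => c k (q1 (q23 x)) = mon (be k0) x ^+ (N - k) * b x))].
  have [kK|kK] := boolP (k \in K); last first.
    exists (fun=> 0); split; first exact: an_cst.
      by move=> E; move: kK; rewrite E k0K.
    move=> kd; move: kK; rewrite KP kd /= negbK => /asboolP h.
    have [hq1 q10 _ _] := rq1.
    by apply: near0_imp (near0_comp hq23 q230 (near0_comp hq1 q10 h)) => x ->; rewrite mulr0.
  have [u [hu u0 hx]] := hck k kK.
  exists (fun x => mon (fun i => (N - k0) * be k i - (N - k) * be k0 i)%N x * u x); split.
  - by apply: an_mul => //; exact: an_mon.
  - move=> E; rewrite (eq_mon (m' := fun=> 0%N)) ?mon0 ?mul1r // => i.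
    by rewrite E subnn.
  - move=> kd; apply: near0_imp hx => x ->; rewrite -monM mulrA -monD; congr (_ * _).
    by apply: eq_mon => i; rewrite subnKC ?hbe // mulnC.
exists (fun x => q1 (q23 x)), w3, (be k0), b; split.
- by split.
- by move=> j; apply: (mono_comp hq23 q230) (hm1c j) => i; exists (pullm (powM (fun=> (N - k0)%N)) (M i)); exact: t23.2.
(* Were all exponents 0, c k0 would be a unit, against c k0 0 = 0. *)
- apply: contrapT => hno.
  have be0 i : be k0 i = 0%N.
    by apply/eqP; rewrite -leqn0 leqNgt; apply/negP => h; apply: hno; exists i.
  have [u [hu u0 hx]] := hck k0 k0K.
  have := near0_0 hx; rewrite q230; have [_ -> _ _] := rq1.
  rewrite c0 // (eq_mon (m' := fun=> 0%N)) ?mon0 ?mul1r; last by move=> i; rewrite be0.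
  by move/esym/eqP; rewrite (negbTE u0).
- split; first by move=> k; have [] := hb k.
  by exists k0 => //; have [_ h _] := hb k0; exact: h.
- by move=> k kd; have [_ _ h] := hb k; exact: h.
Qed.

Lemma an_horner n (p : {poly R}) (f : 'rV[R]_n -> R) : an f -> an (fun x => p.[f x]).
Proof.
move=> hf; apply: (an_ext (an_sum (f := fun (i : 'I_(size p)) x => p`_i * f x ^+ i) (index_enum _) _)).
  by move=> i; apply: an_mul; [exact: an_cst|exact: an_exp].
by move=> x; rewrite horner_coef.
Qed.

Lemma coef_Xsub_exp (a : R) m : (('X + a%:P) ^+ m.+1 : {poly R})`_m.+1 = 1 /\
  (('X + a%:P) ^+ m.+1 : {poly R})`_m = a *+ m.+1.
Proof.
elim: m => [|m [IH1 IH2]].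
  by rewrite expr1 !coefD !coefX !coefC /= addr0 add0r.
rewrite exprSr mulrDr !coefD !coefMX !coefMC /= IH1 IH2 mul1r; split.
  suff -> : (('X + a%:P) ^+ m.+1)`_m.+2 = 0 by rewrite mul0r addr0.
  apply: nth_default; apply: leq_trans (size_poly_exp_leq _ _) _.
  by rewrite size_XaddC /= mul1n.
by rewrite [RHS]mulrS addrC.
Qed.

(** This is what the Tschirnhaus transform is for. An order d + 1 at l would mean p = g (X -
    l)^(d+1); the missing term of degree d forces l = 0, and then every a i vanishes. *)
Lemma depressed_mult (a : nat -> R) (g : R) d (l : R) : g != 0 ->
  (exists2 k0, (k0 < d)%N & a k0 != 0) ->
  exists2 k, (k <= d)%N & ((\poly_(i < d) a i + g *: 'X^(d.+1)) \Po ('X + l%:P))`_k != 0.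
Proof.
move=> g0 [k0 k0d ak0]; apply: contrapT => hno.
set p := \poly_(i < d) a i + g *: 'X^(d.+1) in hno.
set q := p \Po _ in hno.
have q0 k : (k <= d)%N -> q`_k = 0.
  by move=> kd; apply/eqP; apply: contrapT => /negP h; apply: hno; exists k.
have pE : p = q \Po ('X + (- l)%:P).
  rewrite /q -comp_polyA (_ : ('X + l%:P) \Po ('X + (- l)%:P) = 'X) ?comp_polyXr //.
  by rewrite comp_polyD comp_polyX comp_polyC polyCN addrNK.
have sq : (size q <= d.+2)%N.
  rewrite /q; apply: leq_trans (size_comp_poly_leq _ _) _.
  rewrite size_XaddC muln1; suff : (size p <= d.+2)%N by case: (size p).
  apply: leq_trans (size_polyD _ _) _; rewrite geq_max; apply/andP; split.
    by apply: leq_trans (size_poly _ _) _; lia.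
  by apply: leq_trans (size_scale_leq _ _) _; rewrite size_polyXn.
have qE : q = q`_d.+1 *: 'X^(d.+1).
  apply/polyP => i; rewrite coefZ coefXn; case: eqVneq => [->|ne]; first by rewrite mulr1.
  rewrite mulr0; have [id|di] := leqP i d; first exact: q0.
  by apply: nth_default; apply: leq_trans sq _; move/eqP: ne; lia.
have pE' : p = q`_d.+1 *: ('X + (- l)%:P) ^+ d.+1.
  by rewrite pE {1}qE comp_polyZ comp_Xn_poly.
have [h1 h2] := coef_Xsub_exp (- l) d.
have pc i : p`_i = (if (i < d)%N then a i else 0) + g * (i == d.+1)%:R.
  by rewrite coefD coef_poly coefZ coefXn.
have E1 := pc d.+1; rewrite pE' coefZ h1 eqxx !mulr1 ltnNge leqnSn add0r in E1.
have E2 := pc d; rewrite pE' coefZ h2 E1 ltnn (ltn_eqF (ltnSn d)) mulr0 addr0 in E2.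
have l0 : l = 0.
  move/eqP: E2; rewrite mulf_eq0 (negbTE g0) /= mulrn_eq0 /= oppr_eq0; exact/eqP.
have E3 := pc k0; rewrite pE' l0 polyCN oppr0 addr0 coefZ coefXn k0d in E3.
move: E3; rewrite (_ : k0 == d.+1 = false); last by apply/eqP; lia.
by rewrite !mulr0 addr0 => /esym/eqP; rewrite (negbTE ak0).
Qed.

Lemma regular_poly n (F : 'rV[R]_n.+1 -> R) (p : {poly R}) l d :
  near0 (fun y : 'rV[R]_1 => F (vcons (y 0 0) 0) = p.[y 0 0 + l]) ->
  (exists2 k, (k <= d)%N & (p \Po ('X + l%:P))`_k != 0) ->
  exists2 d', (d' <= d)%N & regular F d'.
Proof.
move=> hF [k kd hk]; set q := p \Po _ in hk.
have ex : exists k, q`_k != 0 by exists k.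
case: (ex_minnP ex) => m hm mmin; exists m; first exact: leq_trans (mmin k hk) kd.
exists (fun y => (drop_poly m q).[y 0 0]); split.
- by apply: an_horner; exact: an_coord.
- by rewrite mxE horner_coef0 coef_drop_poly add0n.
- apply: near0_imp hF => y ->.
  have -> : p.[y 0 0 + l] = q.[y 0 0] by rewrite /q horner_comp !hornerE.
  rewrite -{1}(poly_take_drop m q) hornerD hornerM hornerXn mulrC.
  suff -> : take_poly m q = 0 by rewrite horner0 add0r.
  apply/polyP => i; rewrite coef_take_poly coef0; case: ifP => // im.
  by apply/eqP; apply: contraTT im => /mmin; rewrite -leqNgt.
Qed.

Lemma res_tail n (z : I -> 'rV[R]_n.+1) q w : infi z -> res (fun i => vtail (z i)) q w ->
  res z (fun x => vcons (x 0 ord0) (q (vtail x))) (fun i => vcons (z i 0 ord0) (w i)).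
Proof.
move=> hz [hq q0 hw zw]; split=> //.
- apply: anmap_vcons; first exact: an_coord.
  by apply: anmap_comp (vtail0 n) hq; exact: anmap_vtail.
- by rewrite vtail0 q0 mxE vcons_00.
- move=> e e0; apply: ae_imp2 (hz e e0) (hw e e0) => i h1 h2 j.
  by rewrite mxE; case: unlift => [j'|]; [exact: h2|exact: h1].
- by apply: ae_imp zw => i E; rewrite vconsK vcons0 -E vcons_eta.
Qed.

Lemma mono_exp n (f : 'rV[R]_n -> R) k : mono f -> mono (fun x => f x ^+ k).
Proof. by move=> [m hm]; eexists; apply: monoE_exp; eassumption. Qed.

Lemma mono_unit n (u : 'rV[R]_n -> R) : an u -> u 0 != 0 -> mono u.
Proof. by move=> hu u0; eexists; exact: monoE_unit. Qed.

Lemma mono_mon n m : mono (@mon R n m).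
Proof.
exists m, (fun=> 1); split; [exact: an_cst|exact: oner_neq0|].
by apply: near0_T => x; rewrite mulr1.
Qed.

Lemma inf_vcons n (a : I -> R) (w : I -> 'rV[R]_n) : (forall e, 0 < e -> ae (fun i => `|a i| <= e)) ->
  infi w -> infi (fun i => vcons (a i) (w i)).
Proof.
move=> ha hw e e0; apply: ae_imp2 (ha e e0) (hw e e0) => i h1 h2 j.
by rewrite mxE; case: unlift.
Qed.

(** The last clause keeps the tail coordinates monomial, so that powers of x^m split off at one
    stage remain monomials after the substitutions of later stages. *)
Definition resolves_reg n d := forall (z : I -> 'rV[R]_n.+1) F, infi z -> ~ deg z -> an F ->
  regular F d -> exists q w, [/\ res z q w, pos w, mono (fun x => F (q x)) &
    forall j, mono (fun x => q x 0 (lift ord0 j))].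

Lemma mono_monS n (m : 'I_n -> nat) (q : 'rV[R]_n.+1 -> 'rV[R]_n.+1) : anmap q -> q 0 = 0 ->
  (forall j, mono (fun x => q x 0 (lift ord0 j))) -> mono (fun x => mon m (vtail (q x))).
Proof.
move=> hq q0 hm; apply: (mono_comp (q := fun x => vtail (q x))).
- by apply: anmap_comp => //; exact: anmap_vtail.
- by rewrite q0 vtail0.
- by move=> j; apply: mono_eq (hm j) _; apply: near0_T => x; rewrite mxE.
- exact: mono_mon.
Qed.

Lemma mon_gt0 n (m : 'I_n -> nat) (x : 'rV[R]_n) : (forall k, 0 < x 0 k) -> 0 < mon m x.
Proof. by move=> h; apply: prodr_gt0 => k _; rewrite exprn_gt0. Qed.

Lemma mon_at0 n (m : 'I_n -> nat) j : (0 < m j)%N -> mon m (0 : 'rV[R]_n) = 0.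
Proof. by move=> h; rewrite /mon (bigD1 j) //= mxE expr0n eqn0Ngt h mul0r. Qed.

Section Step.
Variables (n d : nat).
Hypothesis IHd : forall d', (d' <= d)%N -> resolves_reg n d'.
Variables (z : I -> 'rV[R]_n.+1) (m : 'I_n -> nat) (b : nat -> 'rV[R]_n -> R)
  (g : 'rV[R]_n.+1 -> R) (F : 'rV[R]_n.+1 -> R).
Hypothesis hz : infi z.
Hypothesis nz : ~ deg z.
Hypothesis pz : ae (fun i => forall j, 0 < vtail (z i) 0 j).
Hypothesis hb : forall k, an (b k).
Hypothesis hg : an g.
Hypothesis g0 : g 0 != 0.
Hypothesis bk0 : exists2 k0, (k0 < d)%N & b k0 0 != 0.
Hypothesis mj : exists j, (0 < m j)%N.
Hypothesis hF : near0 (fun x => F x = \sum_(k < d) mon m (vtail x) ^+ (d.+1 - k) * b k (vtail x)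
  * x 0 ord0 ^+ k + x 0 ord0 ^+ d.+1 * g x).

Let rho i := z i 0 ord0 / mon m (vtail (z i)).

Let an_b k : an (fun x : 'rV[R]_n.+1 => b k (vtail x)).
Proof. by apply: an_comp (vtail0 n) (hb k); exact: anmap_vtail. Qed.

Let an_m : an (fun x : 'rV[R]_n.+1 => mon m (vtail x)).
Proof. by apply: an_comp (vtail0 n) (an_mon m); exact: anmap_vtail. Qed.

Let m00 : mon m (0 : 'rV[R]_n) = 0.
Proof. by have [j hj] := mj; exact: mon_at0 hj. Qed.

(** The ratio rho of y to x^m has a limit l, so y = x^m (l + y') with y' infinitesimal. Then F is
    (x^m)^(d+1) times a germ which on the y'-axis is the depressed polynomial expanded at l; its
    order there is at most d and the induction on the order applies. *)
Lemma step_bounded C : ae (fun i => `|rho i| <= C) ->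
  exists q w, [/\ res z q w, pos w, mono (fun x => F (q x)) &
    forall j, mono (fun x => q x 0 (lift ord0 j))].
Proof.
move=> /ae_bounded_lim[l hl].
pose S (x : 'rV[R]_n.+1) : 'rV[R]_n.+1 := vcons (mon m (vtail x) * (l + x 0 ord0)) (vtail x).
pose w i : 'rV[R]_n.+1 := vcons (rho i - l) (vtail (z i)).
have hS : anmap S.
  apply: anmap_vcons; last exact: anmap_vtail.
  by apply: an_mul => //; apply: an_add; [exact: an_cst|exact: an_coord].
have S0 : S 0 = 0 by rewrite /S vtail0 m00 mul0r vcons_00.
have hw : infi w.
  apply: inf_vcons => //; exact: (inf_an (@anmap_vtail R n) (vtail0 n) hz).
have rS : res z S w.
  split=> //; apply: ae_imp pz => i hi; rewrite /S /w vconsK vcons0 addrC subrK mulrC divfK.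
    by rewrite vcons_eta.
  by rewrite gt_eqF // mon_gt0.
have nw := nondeg_res (UF := UF) nz rS.
pose F3 (x : 'rV[R]_n.+1) := \sum_(k < d) b k (vtail x) * (l + x 0 ord0) ^+ k +
  (l + x 0 ord0) ^+ d.+1 * g (S x).
have an_l : an (fun x : 'rV[R]_n.+1 => l + x 0 ord0).
  by apply: an_add; [exact: an_cst|exact: an_coord].
have hF3 : an F3.
  apply: an_add.
    by apply: an_sum => k; apply: an_mul => //; exact: an_exp.
  by apply: an_mul; [exact: an_exp|exact: an_comp].
have EF3 : near0 (fun x => F (S x) = mon m (vtail x) ^+ d.+1 * F3 x).
  apply: near0_imp (near0_comp hS S0 hF) => x ->.
  have tS : vtail (S x) = vtail x by rewrite /S vconsK.
  have sS : S x 0 ord0 = mon m (vtail x) * (l + x 0 ord0) by rewrite /S vcons0.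
  rewrite tS sS /F3 [RHS]mulrDr; congr (_ + _); last by rewrite exprMn mulrA.
  rewrite mulr_sumr; apply: eq_bigr => k _; rewrite exprMn.
  rewrite -[in RHS](subnK (n := d.+1) (m := k)) ?exprD; last by have := ltn_ord k; lia.
  by ring.
pose p := \poly_(i < d) b i 0 + g 0 *: 'X^(d.+1).
have pE y : p.[y] = \sum_(k < d) b k 0 * y ^+ k + y ^+ d.+1 * g 0.
  by rewrite hornerD horner_poly hornerZ hornerXn [g 0 * _]mulrC.
have hp : near0 (fun y : 'rV[R]_1 => F3 (vcons (y 0 0) 0) = p.[y 0 0 + l]).
  apply: near0_T => y; rewrite /F3 /S pE !vconsK !vcons0 m00 mul0r vcons_00.
  by rewrite [l + _]addrC.
have [d' d'd rF3] := regular_poly hp (depressed_mult l g0 bk0).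
have [q [v [rq pv hm hj]]] := IHd d'd hw nw hF3 rF3.
have [hq q0 hv _] := rq.
exists (fun x => S (q x)), v; split=> //; first exact: res_comp rS rq.
- apply: mono_eq (mono_mul (mono_exp d.+1 (mono_monS m hq q0 hj)) hm) _.
  by apply: near0_imp (near0_comp hq q0 EF3) => x ->.
- move=> j; apply: mono_eq (hj j) _.
  by apply: near0_T => x; rewrite /S vconsS mxE.
Qed.

Lemma step_unbounded : (forall C, ae (fun i => C < `|rho i|)) ->
  exists q w, [/\ res z q w, pos w, mono (fun x => F (q x)) &
    forall j, mono (fun x => q x 0 (lift ord0 j))].
Proof.
move=> hrho.
have [s s1 hs] := ae_sign (nondeg_neq0 ord0 hz nz).
have s11 : s * s = 1 by rewrite -expr2.
have s0 : s != 0 by apply/eqP => h; move/eqP: s11; rewrite h mul0r eq_sym oner_eq0.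
pose S (x : 'rV[R]_n.+1) : 'rV[R]_n.+1 := vcons (s * x 0 ord0) (vtail x).
have hS : anmap S.
  apply: anmap_vcons; last exact: anmap_vtail.
  by apply: an_mul; [exact: an_cst|exact: an_coord].
have S0 : S 0 = 0 by rewrite /S vtail0 mxE mulr0 vcons_00.
pose w i := S (z i).
have SS x : S (S x) = x by rewrite /S vconsK vcons0 mulrA s11 mul1r vcons_eta.
have hw : infi w by exact: inf_an.
have rS : res z S w by split=> //; apply: ae_T => i; rewrite /w SS.
have nw := nondeg_res (UF := UF) nz rS.
have pw : pos w.
  apply: ae_imp2 hs pz => i h1 h2 k; rewrite /w /S.
  by case: (unliftP ord0 k) => [j ->|->]; rewrite ?vconsS ?vcons0.
pose al (j : 'I_n.+1) : nat := (j == ord0).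
pose be (j : 'I_n.+1) : nat := if unlift ord0 j is Some k then m k else 0%N.
have hal x : mon al x = x 0 ord0 by exact: mon_delta.
have hbe x : mon be x = mon m (vtail x).
  rewrite /mon big_ord_recl /be unlift_none expr0 mul1r; apply: eq_bigr => k _.
  by rewrite liftK mxE.
have [M [q [v [tq pv hle]]]] := tor_compare al be hw nw pw.
have [[hq q0 hv wv] hM] := tq.
have [u1 [hu1 u10 E1]] := monoE_comp hq q0 hM (ex_intro _ (fun=> 1) (And3 (an_cst _ _) (oner_neq0 _) (near0_T (fun x => esym (mulr1 (mon al x)))))).
have [u2 [hu2 u20 E2]] := monoE_comp hq q0 hM (ex_intro _ (fun=> 1) (And3 (an_cst _ _) (oner_neq0 _) (near0_T (fun x => esym (mulr1 (mon be x)))))).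
have zrho : ae (fun i => `|rho i| = (mon al (q (v i))) / (mon be (q (v i)))).
  apply: ae_imp2 wv (ae_and pw pz) => i E [h1 h2]; rewrite -E hal hbe /rho.
  have wt : vtail (w i) = vtail (z i) by rewrite /w /S vconsK.
  rewrite wt normrM [`|_^-1|]ger0_norm ?invr_ge0 ?(ltW (mon_gt0 _ _)) //; congr (_ / _).
  rewrite /w /S vcons0 -[RHS]gtr0_norm; last by have := h1 ord0; rewrite /w /S vcons0.
  rewrite normrM; suff -> : `|s| = 1 by rewrite mul1r.
  by apply/eqP; rewrite -(@eqrXn2 _ 2) // real_normK ?num_real // s1 expr1n.
have qv : ae (fun i => 0 < mon al (q (v i)) /\ 0 < mon be (q (v i))).
  by apply: ae_imp2 wv pw => i <- h; split; exact: mon_gt0.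
have ev1 := inf_near0 (UF:=UF) hv E1; have ev2 := inf_near0 (UF:=UF) hv E2.
have eq_u1 := inf_near0 (UF:=UF) hv (an_neq0 hu1 u10).
have eq_u2 := inf_near0 (UF:=UF) hv (an_neq0 hu2 u20).
case: hle => hle; last first.
  (* If x^m divided y, the ratio |rho| would be an analytic germ along U and thus bounded. *)
  exfalso; pose h x := mon (fun j => pullm M al j - pullm M be j)%N x * (u1 x / u2 x).
  have hh : an h by apply: an_mul; [exact: an_mon|apply: an_mul => //; exact: an_inv].
  have hc := inf_cont (UF:=UF) hv hh (ltr01 : 0 < 1 :> R).
  have [i [hi [h1 [h2 [h3 [h4 [h5 [h6 h7]]]]]]]] := ae_ex (ae_and hc (ae_and (hrho (`|h 0| + 1))
    (ae_and zrho (ae_and qv (ae_and ev1 (ae_and ev2 (ae_and eq_u1 eq_u2))))))).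
  have mE : mon (pullm M al) (v i) = mon (fun j => pullm M al j - pullm M be j)%N (v i) * mon (pullm M be) (v i).
    by rewrite -monD; apply: eq_mon => j; rewrite subnK.
  have hE : `|rho i| = h (v i).
    rewrite h2 h4 h5 mE /h.
    have mb0 : mon (pullm M be) (v i) != 0.
      have [_] := h3; rewrite h5; apply: contraTneq => ->; by rewrite mul0r ltxx.
    by field; rewrite h7 mb0.
  move: h1; rewrite hE => h1; have := ler_norm (h (v i)); have := ler_normD (h (v i) - h 0) (h 0).
  rewrite subrK; lra.
pose h x := mon (fun j => pullm M be j - pullm M al j)%N x * (u2 x / u1 x).
have hh : an h by apply: an_mul; [exact: an_mon|apply: an_mul => //; exact: an_inv].
have Eh : near0 (fun x => mon be (q x) = mon al (q x) * h x).
  apply: near0_imp2 (near0_and E1 E2) (an_neq0 hu1 u10) => x [-> ->] u1x.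
  have -> : mon (pullm M be) x = mon (fun j => pullm M be j - pullm M al j)%N x * mon (pullm M al) x.
    by rewrite -monD; apply: eq_mon => j; rewrite subnK.
  by rewrite /h; field.
have evh := inf_near0 (UF:=UF) hv Eh.
(* Along U, h is 1 / |rho|, which tends to 0. *)
have h00 : h 0 = 0.
  apply/eqP; apply: contrapT => /negP hn.
  have h2 : 0 < `|h 0| / 2 by rewrite divr_gt0 // normr_gt0.
  have [i [e1 [e2 [e3 [e4 e5]]]]] := ae_ex (ae_and (inf_cont (UF:=UF) hv hh h2) (ae_and (hrho ((`|h 0| / 2)^-1))
    (ae_and zrho (ae_and qv evh)))).
  have [a0 b0] := e4.
  have hp : 0 < h (v i) by have := b0; rewrite e5 pmulr_rgt0.
  have : `|rho i| = (h (v i))^-1 by rewrite e3 e5 invfM mulrA divff ?mul1r // gt_eqF.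
  move=> E; move: e2; rewrite E ltf_pV2 ?posrE // => e2.
  have := ler_normD (h (v i)) (h 0 - h (v i)); rewrite [`|h 0 - _|]distrC (gtr0_norm hp).
  rewrite (_ : h (v i) + (h 0 - h (v i)) = h 0); last by ring.
  lra.
have an_T : anmap (fun x => S (q x)) by exact: anmap_comp.
have T0 : S (q 0) = 0 by rewrite q0 S0.
exists (fun x => S (q x)), v; split=> //.
- exact: res_comp rS tq.1.
- pose V x := \sum_(k < d) h x ^+ (d.+1 - k) * b k (vtail (q x)) * s ^+ k + s ^+ d.+1 * g (S (q x)).
  have hV : an V.
    apply: an_add.
      apply: an_sum => k; apply: an_mul; last exact: an_cst.
      by apply: an_mul; [exact: an_exp|apply: (an_comp hq q0 (an_b k))].
    by apply: an_mul; [exact: an_cst|exact: an_comp].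
  (* Each term with k < d carries a positive power of h, so V 0 is s^(d+1) g 0. *)
  have V0 : V 0 != 0.
    rewrite /V big1 ?add0r ?T0 ?mulf_neq0 ?expf_neq0 // => k _.
    by rewrite h00 expr0n subn_eq0 leqNgt (leq_trans (ltn_ord k)) // !mul0r.
  have hmal : mono (fun x => q x 0 ord0) by exists (M ord0); exact: hM.
  apply: mono_eq (mono_mul (mono_exp d.+1 hmal) (mono_unit hV V0)) _.
  apply: near0_imp2 Eh (near0_comp an_T T0 hF) => x E ->.
  have tS : vtail (S (q x)) = vtail (q x) by rewrite /S vconsK.
  have sS : S (q x) 0 ord0 = s * q x 0 ord0 by rewrite /S vcons0.
  rewrite /V tS sS [LHS]mulrDr; congr (_ + _); last by rewrite exprMn; ring.
  rewrite mulr_sumr; apply: eq_bigr => k _.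
  rewrite -hbe E hal !exprMn.
  rewrite -[in LHS](subnK (n := d.+1) (m := k)) ?exprD; last by have := ltn_ord k; lia.
  by rewrite addnK; ring.
- move=> j; exists (M (lift ord0 j)); apply: monoE_eq (hM (lift ord0 j)) _.
  by apply: near0_T => x; rewrite /S vconsS mxE.
Qed.

End Step.

Lemma resolve_reg n d : resolves n -> resolves_reg n d.
Proof.
move=> hn; elim/ltn_ind: d => d IH z F hz nz hF rF.
case: d IH rF => [_ [u [hu u0 hFu]]|d IH rF].
  have [q [w [[rq hq] pw]]] := flip hz nz; have [aq q0 _ _] := rq.
  exists q, w; split=> //; last by move=> j; exists (idM (lift ord0 j)); exact: hq.
  apply: mono_unit; first exact: an_comp.
  by have := near0_0 hFu; rewrite q0 mxE vcons_00 expr0 mul1r => ->.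
have [theta [c [g [[hth th0] [hc hg] g0 [c0 cd0] hexp]]]] := tschirnhaus hF rF.
pose S (x : 'rV[R]_n.+1) : 'rV[R]_n.+1 := vcons (x 0 ord0 + theta (vtail x)) (vtail x).
pose S' (x : 'rV[R]_n.+1) : 'rV[R]_n.+1 := vcons (x 0 ord0 - theta (vtail x)) (vtail x).
have an_th : an (fun x : 'rV[R]_n.+1 => theta (vtail x)).
  by apply: an_comp (vtail0 n) hth; exact: anmap_vtail.
have hS : anmap S by apply: anmap_vcons (@anmap_vtail R n); apply: an_add => //; exact: an_coord.
have hS' : anmap S' by apply: anmap_vcons (@anmap_vtail R n); apply: an_sub => //; exact: an_coord.
have S0 : S 0 = 0 by rewrite /S vtail0 th0 mxE addr0 vcons_00.
have S'0 : S' 0 = 0 by rewrite /S' vtail0 th0 mxE subr0 vcons_00.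
have SS' x : S (S' x) = x by rewrite /S /S' vconsK vcons0 subrK vcons_eta.
pose z1 i := S' (z i).
have hz1 : infi z1 by exact: inf_an.
have r1 : res z S z1 by split=> //; apply: ae_T => i; rewrite /z1 SS'.
have nz1 := nondeg_res (UF := UF) nz r1.
(* If all coefficients are identically zero, F is y^(d+1) times a unit right after the shift. *)
have [[k1 [k1d nk1]]|hno] := pselect (exists k, (k < d)%N /\ ~ ger0 (c k)); last first.
  have c00 : near0 (fun x : 'rV[R]_n => forall k : 'I_d.+1, c k x = 0).
    apply: near0_all => k; have := ltn_ord k; rewrite ltnS leq_eqVlt => /orP[/eqP -> //|kd].
    by apply: contrapT => h; apply: hno; exists k.
  have [q [w [[rq hq] pw]]] := flip hz1 nz1; have [aq q0 _ _] := rq.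
  exists (fun x => S (q x)), w; split=> //.
  - exact: res_comp r1 rq.
  - have hm0 : mono (fun x => q x 0 ord0) by exists (idM ord0); exact: hq.
    have hgq : an (fun x => g (q x)) by exact: an_comp.
    have gq0 : g (q 0) != 0 by rewrite q0.
    apply: mono_eq (mono_mul (mono_exp d.+1 hm0) (mono_unit hgq gq0)) _.
    apply: near0_imp2 (near0_comp aq q0 hexp) (near0_comp aq q0 ((near0_vtail _).1 c00)) => x.
    by rewrite -/(S _) => -> h; rewrite big1 ?add0r // => k _; rewrite h mul0r.
  - move=> j; exists (idM (lift ord0 j)); apply: monoE_eq (hq _) _.
    by apply: near0_T => x; rewrite /S vconsS mxE.
have ht1 : infi (fun i => vtail (z1 i)) by exact: (inf_an (@anmap_vtail R n) (vtail0 n) hz1).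
have nt1 := nondeg_tail (UF:=UF) hz1 nz1.
have c0' k : (k < d)%N -> c k 0 = 0 by move=> kd; rewrite c0 // ltnW.
have [q [w [m [b [[rq pw] hmq hmj [hb hb0] hcb]]]]] := newton hn ht1 nt1 hc c0' k1d nk1.
have r2 := res_tail hz1 rq.
set S2 := (fun x : 'rV[R]_n.+1 => _) in r2.
set z2 := (fun i => _) in r2.
have [hS2 S20 hz2 _] := r2.
have nz2 := nondeg_res (UF := UF) nz1 r2.
have pz2 : ae (fun i => forall j, 0 < vtail (z2 i) 0 j).
  by apply: ae_imp pw => i h j; rewrite /z2 vconsK.
have hgS2 : an (fun x => g (S2 x)) by exact: an_comp.
have gS20 : g (S2 0) != 0 by rewrite S20.
have hb1 : near0 (fun x : 'rV[R]_n => forall k : 'I_d, c k (q x) = mon m x ^+ (d.+1 - k) * b k x).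
  by apply: near0_all => k; exact: hcb.
have [aq q0 _ _] := rq.
have hF2 : near0 (fun x => F (S (S2 x)) = \sum_(k < d) mon m (vtail x) ^+ (d.+1 - k) * b k (vtail x)
  * x 0 ord0 ^+ k + x 0 ord0 ^+ d.+1 * g (S2 x)).
  have hcd := (near0_vtail _).1 (near0_comp aq q0 cd0).
  apply: near0_imp2 (near0_and hcd ((near0_vtail _).1 hb1)) (near0_comp hS2 S20 hexp) => x [E1 E2].
  have tS : vtail (S2 x) = q (vtail x) by rewrite /S2 vconsK.
  have sS : S2 x 0 ord0 = x 0 ord0 by rewrite /S2 vcons0.
  rewrite -/(S _) => ->; rewrite tS sS big_ord_recr /= E1 mul0r addr0.
  by congr (_ + _); apply: eq_bigr => k _; rewrite E2.
have [q3 [w3 [r3 pw3 hm3 hj3]]] : exists q w, [/\ res z2 q w, pos w, mono (fun x => F (S (S2 (q x)))) &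
    forall j, mono (fun x => q x 0 (lift ord0 j))].
  have IH' d' : (d' <= d)%N -> resolves_reg n d' by move=> h; apply: IH.
  pose rho i := z2 i 0 ord0 / mon m (vtail (z2 i)).
  have [[C hC]|hub] := pselect (exists C, ae (fun i => `|rho i| <= C)).
    exact: (step_bounded IH' hz2 nz2 pz2 hb hgS2 gS20 hb0 hmj hF2 hC).
  apply: (step_unbounded hz2 nz2 pz2 hb hgS2 gS20 hF2) => C.
  have [h|] := ae_em (fun i => `|rho i| <= C); first by exfalso; apply: hub; exists C.
  by apply: ae_imp => i /negP; rewrite -ltNge.
have [aq3 q30 _ _] := r3.
exists (fun x => S (S2 (q3 x))), w3; split=> //.
- by apply: res_comp (res_comp r1 r2) r3.
- move=> j; apply: (@mono_eq _ _ (fun x => q (vtail (q3 x)) 0 j)); last first.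
    by apply: near0_T => x; rewrite /S /S2 vconsS vconsK.
  apply: (mono_comp (q := fun x => vtail (q3 x)) _ _ _ (hmq j)).
  + by apply: anmap_comp => //; exact: anmap_vtail.
  + by rewrite q30 vtail0.
  + by move=> k; apply: mono_eq (hj3 k) _; apply: near0_T => x; rewrite mxE.
Qed.

(** A linear change of coordinates takes the first axis to the line through a point v with F v
    nonzero; the restriction of F to this line is not zero and so has a finite order. *)
Lemma regularize n (F : 'rV[R]_n.+1 -> R) : an F -> ~ ger0 F ->
  exists (L L' : 'rV[R]_n.+1 -> 'rV[R]_n.+1) d,
    [/\ anmap L /\ L 0 = 0, anmap L' /\ L' 0 = 0, forall x, L (L' x) = x & regular (fun x => F (L x)) d].
Proof.
move=> hF nF; have [r [C [r0 hr]]] := hF.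
have [v [k [bv vk Fv]]] : exists v k, [/\ box (r / 2) v, v 0 k != 0 & F v != 0].
  have [v bv Fv] : exists2 v, box (r / 2) v & F v != 0.
    apply: contrapT => h; apply: nF; exists (r / 2); first by rewrite divr_gt0.
    by move=> x bx; apply/eqP; apply: contrapT => /negP Fx; apply: h; exists x.
  have [v0|/eqP/rowP/existsNP[k vk]] := eqVneq v 0; last first.
    by exists v, k; split=> //; apply/eqP => E; apply: vk; rewrite E mxE.
  have F0 : F 0 != 0 by rewrite -v0.
  have [e e0 he] := an_neq0 hF F0.
  have m0 : 0 < Num.min e (r / 2) by rewrite lt_min e0 divr_gt0.
  exists (const_mx (Num.min e (r / 2))), ord0; split; last first.
  - by apply: he => i; rewrite mxE gtr0_norm // ge_min lexx.
  - by rewrite mxE gt_eqF.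
  - by move=> i; rewrite mxE gtr0_norm // ge_min lexx orbT.
pose L (x : 'rV[R]_n.+1) : 'rV[R]_n.+1 :=
  \row_j (x 0 ord0 * v 0 j + if unlift k j is Some j' then x 0 (lift ord0 j') else 0).
pose L' (y : 'rV[R]_n.+1) : 'rV[R]_n.+1 :=
  vcons (y 0 k / v 0 k) (\row_j (y 0 (lift k j) - y 0 k / v 0 k * v 0 (lift k j))).
have hphi : AN 2 (fun x : 'rV[R]_1 => F (x 0 0 *: v)) C.
  apply: (AN_comp _ hr) => // i.
  apply: AN_le (AN_eq (AN_scale (v 0 i) (AN_coord 2 (0 : 'I_1))) _) _.
    by move=> x _; rewrite mxE mulrC.
  by have := bv i; lra.
have [h|[d [u [hu u0 E]]]] := AN_order1 (ltr0n _ 2) hphi.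
  exfalso; have := h (const_mx 1); rewrite mxE normr1 scale1r ltr1n => /(_ isT).
  by move/eqP; rewrite (negbTE Fv).
exists L, L', d; split.
- split; last first.
    by apply/rowP => j; rewrite !mxE mul0r add0r; case: unlift => // j'; rewrite mxE.
  move=> j; apply: (@an_ext _ _ (fun x : 'rV[R]_n.+1 => x 0 ord0 * v 0 j +
      if unlift k j is Some j' then x 0 (lift ord0 j') else 0)); last by move=> x; rewrite mxE.
  apply: an_add; first by apply: an_mul; [exact: an_coord|exact: an_cst].
  by case: (unlift k j) => [j'|]; [exact: an_coord|exact: an_cst].
- split; last first.
    rewrite /L' -[RHS](vcons_00 n); congr vcons; first by rewrite mxE mul0r.
    by apply/rowP => j; rewrite !mxE !mul0r subr0.
  have hk : an (fun y : 'rV[R]_n.+1 => y 0 k / v 0 k) by apply: an_mul; [exact: an_coord|exact: an_cst].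
  apply: anmap_vcons => // j.
  apply: (@an_ext _ _ (fun y : 'rV[R]_n.+1 => y 0 (lift k j) - y 0 k / v 0 k * v 0 (lift k j))); last by move=> x; rewrite mxE.
  by apply: an_sub; [exact: an_coord|apply: an_mul => //; exact: an_cst].
- move=> x; apply/rowP => j; rewrite mxE /L' vcons0; case: unliftP => [j' ->|->].
    by rewrite vconsS mxE addrC subrK.
  by rewrite addr0 divfK.
- exists u; split=> //; first exact: an_AN hu.
  exists 2 => // y bY; rewrite -E //; congr F; apply/rowP => j; rewrite !mxE unlift_none.
  by case: (unlift k j) => [j'|]; rewrite ?addr0 // mxE liftK mxE addr0.
Qed.

(** Induction on n: the case of n variables resolves the coefficients of a germ in n + 1 variables
    made regular. *)
Theorem resolve n : resolves n.
Proof.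
elim: n => [|n IH] z F hz nz hF nF.
  exists (fun x => x), z; split; first exact: res_id.
    by apply: ae_T => i [].
  apply: mono_unit => //; apply/eqP => F0; apply: nF; apply: near0_T => x.
  by rewrite -F0; congr F; apply/rowP => -[].
have [L [L' [d [[hL L0] [hL' L'0] LL' rF]]]] := regularize hF nF.
have r1 : res z L (fun i => L' (z i)).
  by split=> //; [exact: inf_an|apply: ae_T => i; rewrite LL'].
have [_ _ h1 _] := r1; have n1 := nondeg_res (UF := UF) nz r1.
have [q [w [rq pw hm _]]] := resolve_reg IH h1 n1 (an_comp hL L0 hF) rF.
by exists (fun x => L (q x)), w; split=> //; exact: res_comp r1 rq.
Qed.

End Resolve.

(** * Directions, limits and the stabilisation of GD *)

Section Bridge.
Context {R : realType}.
Implicit Types (r s C D e : R).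

Lemma ball_rV n (x y : 'rV[R]_n) e : 0 < e -> ball x e y <-> forall k, `|x 0 k - y 0 k| < e.
Proof.
move=> e0; split=> [[_ h] k|h]; first exact: h.
by split=> // i j; rewrite ord1; exact: h.
Qed.

Lemma closure_rV n (S : set 'rV[R]_n) p : closure S p <->
  forall e, 0 < e -> exists2 x, S x & box e (x - p).
Proof.
split=> [h e e0|h B /nbhs_ballP[e /= e0 eB]].
  have [x [Sx bx]] := h _ (nbhsx_ballx p e e0); exists x => // i.
  have /(ball_rV _ _ e0) /(_ i) := bx; rewrite !mxE distrC; exact: ltW.
have e2 : 0 < e / 2 by rewrite divr_gt0.
have [x Sx bx] := h _ e2; exists x; split=> //; apply: eB; apply/(ball_rV _ _ e0) => k.
have := bx k; rewrite !mxE distrC; lra.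
Qed.

Lemma closure_rV2 n (S : set ('rV[R]_n * 'rV[R]_n)) p a : closure S (p, a) <->
  forall e, 0 < e -> exists x b, [/\ S (x, b), box e (x - p) & box e (b - a)].
Proof.
split=> [h e e0|h B /nbhs_ballP[e /= e0 eB]].
  have [[x b] [Sx [/= bx bb]]] := h _ (nbhsx_ballx (p, a) e e0); exists x, b; split=> // i.
    have /(ball_rV _ _ e0) /(_ i) := bx; rewrite !mxE distrC; exact: ltW.
  have /(ball_rV _ _ e0) /(_ i) := bb; rewrite !mxE distrC; exact: ltW.
have e2 : 0 < e / 2 by rewrite divr_gt0.
have [x [b [Sx bx bb]]] := h _ e2; exists (x, b); split=> //; apply: eB; split=> /=.
  by apply/(ball_rV _ _ e0) => k; have := bx k; rewrite !mxE distrC; lra.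
by apply/(ball_rV _ _ e0) => k; have := bb k; rewrite !mxE distrC; lra.
Qed.

Lemma cvg_rV n (x : nat -> 'rV[R]_n) (p : 'rV[R]_n) : x @ \oo --> p <->
  forall e, 0 < e -> \forall i \near \oo, box e (x i - p).
Proof.
split=> [/cvg_ballP h e e0|h].
  have := h e e0; apply: filterS => i /(ball_rV _ _ e0) hi k.
  by have := hi k; rewrite !mxE distrC; exact: ltW.
apply/cvg_ballP => e e0; have e2 : 0 < e / 2 by rewrite divr_gt0.
have := h _ e2; apply: filterS => i hi; apply/(ball_rV _ _ e0) => k.
by have := hi k; rewrite !mxE distrC; lra.
Qed.

Definition unitv n (x : 'rV[R]_n) := (enorm x)^-1 *: x.

Lemma near_eps e : 0 < e -> \forall i \near \oo, (i.+1%:R^-1 : R) < e.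
Proof. by move=> e0; exact: (near_infty_natSinv_lt (PosNum e0)). Qed.

Lemma enorm_ge0 n (x : 'rV[R]_n) : 0 <= enorm x.
Proof. exact: sqrtr_ge0. Qed.

Lemma sumsq_ge0 n (x : 'rV[R]_n) : 0 <= \sum_(i < n) x 0 i ^+ 2.
Proof. by apply: sumr_ge0 => i _; exact: sqr_ge0. Qed.

Lemma enorm_sqr n (x : 'rV[R]_n) : enorm x ^+ 2 = \sum_(i < n) x 0 i ^+ 2.
Proof. by rewrite sqr_sqrtr // sumsq_ge0. Qed.

Lemma enorm_coord n (x : 'rV[R]_n) k : `|x 0 k| <= enorm x.
Proof.
rewrite -(@ler_pXn2r _ 2) ?nnegrE ?enorm_ge0 // enorm_sqr real_normK ?num_real //.
by rewrite (bigD1 k) //= lerDl; apply: sumr_ge0 => i _; exact: sqr_ge0.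
Qed.

Lemma enorm0 n : enorm (0 : 'rV[R]_n) = 0.
Proof. by rewrite /enorm big1 ?sqrtr0 // => i _; rewrite mxE expr0n. Qed.

Lemma enorm_eq0 n (x : 'rV[R]_n) : (enorm x == 0) = (x == 0).
Proof.
apply/eqP/eqP => [h|->]; last exact: enorm0.
apply/rowP => k; rewrite mxE; apply/eqP; rewrite -normr_le0 -h; exact: enorm_coord.
Qed.

Lemma enormZ n (t : R) (x : 'rV[R]_n) : enorm (t *: x) = `|t| * enorm x.
Proof.
apply/eqP; rewrite -(@eqrXn2 _ 2) ?mulr_ge0 ?enorm_ge0 // exprMn !enorm_sqr.
rewrite real_normK ?num_real // mulr_sumr; apply/eqP; apply: eq_bigr => i _.
by rewrite mxE exprMn.
Qed.

Lemma enorm_unitv n (x : 'rV[R]_n) : x != 0 -> enorm (unitv x) = 1.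
Proof.
move=> x0; have e0 : enorm x != 0 by rewrite enorm_eq0.
by rewrite enormZ ger0_norm ?invr_ge0 ?enorm_ge0 // mulVf.
Qed.

Lemma unitvK n (x : 'rV[R]_n) : x != 0 -> enorm x *: unitv x = x.
Proof. by move=> x0; rewrite scalerA mulfV ?scale1r // enorm_eq0. Qed.

Lemma unitv_id n (x : 'rV[R]_n) : enorm x = 1 -> unitv x = x.
Proof. by move=> h; rewrite /unitv h invr1 scale1r. Qed.

Lemma unit_neq0 n (x : 'rV[R]_n) : enorm x = 1 -> x != 0.
Proof. by move=> h; rewrite -enorm_eq0 h oner_eq0. Qed.

Lemma unitvZ n (t : R) (x : 'rV[R]_n) : 0 < t -> unitv (t *: x) = unitv x.
Proof.
move=> t0; rewrite /unitv enormZ gtr0_norm // invfM scalerA mulrAC mulVf ?mul1r //.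
by rewrite gt_eqF.
Qed.

Lemma enorm_gt0 n (x : 'rV[R]_n) : x != 0 -> 0 < enorm x.
Proof. by move=> h; rewrite lt_neqAle enorm_ge0 eq_sym enorm_eq0 h. Qed.

Lemma direction_setP n (A : set 'rV[R]_n) p a : direction_set A p a <-> enorm a = 1 /\
  forall e, 0 < e -> exists x, [/\ A x, x != p, box e (x - p) & box e (unitv (x - p) - a)].
Proof.
split=> [[ua [x [hx xp xa]]]|[ua h]]; split=> //.
  move=> e e0; have /cvg_rV /(_ e e0) h1 := xp; have /cvg_rV /(_ e e0) h2 := xa.
  have [i [h3 h4]] := filter_ex (filterI h1 h2).
  by have [Ax /eqP xne] := hx i; exists (x i).
have /choice[x hx] (i : nat) : exists x, [/\ A x, x != p, box i.+1%:R^-1 (x - p) &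
    box i.+1%:R^-1 (unitv (x - p) - a)] by apply: h; rewrite invr_gt0.
exists x; split.
- by move=> i; have [Ax /eqP xp _ _] := hx i.
- apply/cvg_rV => e e0; apply: filterS (near_eps e0) => i hi.
  by have [_ _ b _] := hx i; apply: box_le b (ltW hi).
- apply/cvg_rV => e e0; apply: filterS (near_eps e0) => i hi.
  by have [_ _ _ b] := hx i; apply: box_le b (ltW hi).
Qed.

Lemma GDP n (A : set 'rV[R]_n) a : GD A a <-> enorm a = 1 /\
  forall e, 0 < e -> exists p b, [/\ A p, direction_set A p b, box e p & box e (b - a)].
Proof.
split=> [[ua /closure_rV2 h]|[ua h]]; split=> //.
  move=> e /h [p [b [[/= Ap dp] bp ba]]]; exists p, b; split=> //.
  by rewrite subr0 in bp.
apply/closure_rV2 => e /h [p [b [Ap dp bp ba]]]; exists p, b; split=> //.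
by rewrite subr0.
Qed.

Lemma GD_unit n (A : set 'rV[R]_n) a : GD A a -> enorm a = 1.
Proof. by case. Qed.

Lemma half_coneP n (S : set 'rV[R]_n) x : (forall a, S a -> enorm a = 1) ->
  half_cone S x <-> (x = 0 /\ S !=set0) \/ (x != 0 /\ S (unitv x)).
Proof.
move=> hS; split=> [[t [v [t0 Sv ->]]]|[[-> [v Sv]]|[x0 Sx]]].
- move: t0; rewrite le_eqVlt => /orP[/eqP <-|t0]; first by left; rewrite scale0r; split=> //; exists v.
  right; rewrite unitvZ // (unitv_id (hS _ Sv)); split=> //.
  by rewrite scaler_eq0 negb_or gt_eqF //= (unit_neq0 (hS _ Sv)).
- by exists 0, v; rewrite scale0r.
- by exists (enorm x), (unitv x); rewrite enorm_ge0 unitvK.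
Qed.

Lemma half_coneZ n (S : set 'rV[R]_n) x (t : R) : 0 <= t -> half_cone S x -> half_cone S (t *: x).
Proof.
by move=> t0 [s [v [s0 Sv ->]]]; exists (t * s), v; rewrite mulr_ge0 // scalerA.
Qed.

Definition conic n (C : set 'rV[R]_n) := forall t x, 0 < t -> C x -> C (t *: x).

Lemma direction_scale n (C : set 'rV[R]_n) v b (t : R) : conic C -> 0 < t ->
  direction_set C v b -> direction_set C (t *: v) b.
Proof.
move=> cC t0 /direction_setP[ub h]; apply/direction_setP; split=> // e e0.
have m0 : 0 < Num.min e (e / t) by rewrite lt_min e0 divr_gt0.
have [x [Cx xv bx bu]] := h _ m0; exists (t *: x); split.
- exact: cC.
- by rewrite (inj_eq (scalerI _)) // gt_eqF.
- move=> i; rewrite -scalerBr mxE normrM gtr0_norm //.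
  rewrite mulrC -ler_pdivlMr //; apply: le_trans (bx i) _; by rewrite ge_min lexx orbT.
- by rewrite -scalerBr unitvZ //; apply: box_le bu _; rewrite ge_min lexx.
Qed.

(** Scaling v towards 0 preserves its directions, so in a cone the directions at every point count,
    not only those at points near 0. *)
Lemma GD_conic n (C : set 'rV[R]_n) v b : conic C -> C v -> direction_set C v b -> GD C b.
Proof.
move=> cC Cv db; apply/GDP; split; first by have /direction_setP[] := db.
move=> e e0; pose t := e / (enorm v + 1).
have v1 : 0 < enorm v + 1 by rewrite ltr_wpDl // enorm_ge0.
have t0 : 0 < t by rewrite divr_gt0.
exists (t *: v), b; split; [exact: cC|exact: direction_scale| |].
  move=> i; rewrite mxE normrM gtr0_norm // /t mulrAC ler_pdivrMr //.
  rewrite ler_wpM2l ?(ltW e0) //; apply: le_trans (enorm_coord v i) _; by rewrite lerDl.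
by move=> i; rewrite subrr mxE normr0 ltW.
Qed.

End Bridge.

(** * Limits along an ultrafilter *)

Section Lim.
Context {R : realType} {I : Type} (U : set_system I) {UF : UltraFilter U}.
Implicit Types (u v : I -> R) (e : R).
Local Notation ae := (ae U).

Definition ulim u (l : R) := forall e, 0 < e -> ae (fun i => `|u i - l| <= e).

Lemma ulim_cst (c : R) : ulim (fun=> c) c.
Proof. by move=> e e0; apply: ae_T => i; rewrite subrr normr0 ltW. Qed.

Lemma ulim_eq u v l : ulim u l -> ae (fun i => u i = v i) -> ulim v l.
Proof. by move=> h E e e0; apply: ae_imp2 (h e e0) E => i + <-. Qed.

Lemma ulim_add u v l m : ulim u l -> ulim v m -> ulim (fun i => u i + v i) (l + m).
Proof.
move=> hu hv e e0; have e2 : 0 < e / 2 by rewrite divr_gt0.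
apply: ae_imp2 (hu _ e2) (hv _ e2) => i h1 h2.
rewrite (_ : u i + v i - (l + m) = (u i - l) + (v i - m)); last by ring.
by apply: le_trans (ler_normD _ _) _; lra.
Qed.

Lemma ulim_bnd u l : ulim u l -> ae (fun i => `|u i| <= `|l| + 1).
Proof.
move=> h; apply: ae_imp (h 1 ltr01) => i hi.
rewrite (_ : u i = (u i - l) + l); last by ring.
by apply: le_trans (ler_normD _ _) _; lra.
Qed.

Lemma ulim_mul u v l m : ulim u l -> ulim v m -> ulim (fun i => u i * v i) (l * m).
Proof.
move=> hu hv e e0.
pose K := `|l| + 1 + (`|m| + 1).
have l0 := normr_ge0 l; have m0 := normr_ge0 m.
have K0 : 0 < K by rewrite /K; lra.
have eK : 0 < e / K by rewrite divr_gt0.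
apply: ae_imp2 (ulim_bnd hu) (ae_and (hu _ eK) (hv _ eK)) => i h1 [h2 h3].
rewrite (_ : u i * v i - l * m = u i * (v i - m) + (u i - l) * m); last by ring.
apply: le_trans (ler_normD _ _) _; rewrite !normrM.
have -> : e = (`|l| + 1) * (e / K) + e / K * (`|m| + 1) by rewrite /K; field; rewrite gt_eqF // -/K.
apply: lerD; first by rewrite ler_pM.
by rewrite ler_pM //; lra.
Qed.

Lemma ulim_opp u l : ulim u l -> ulim (fun i => - u i) (- l).
Proof. by move=> h e e0; apply: ae_imp (h e e0) => i; rewrite -opprD normrN. Qed.

Lemma ulim_sum (J : Type) (s : seq J) (u : J -> I -> R) (l : J -> R) :
  (forall j, ulim (u j) (l j)) -> ulim (fun i => \sum_(j <- s) u j i) (\sum_(j <- s) l j).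
Proof.
move=> h; elim: s => [|j s IH].
  by rewrite big_nil; apply: ulim_eq (ulim_cst 0) _; apply: ae_T => i; rewrite big_nil.
rewrite big_cons; apply: ulim_eq (ulim_add (h j) IH) _; apply: ae_T => i.
by rewrite big_cons.
Qed.

Lemma ulim_ge u l (a : R) : ulim u l -> ae (fun i => a <= u i) -> a <= l.
Proof.
move=> h ha; rewrite leNgt; apply/negP => la.
have e0 : 0 < (a - l) / 2 by rewrite divr_gt0 // subr_gt0.
have [i [h1 h2]] := ae_ex (ae_and (h _ e0) ha).
by move: h1; rewrite ler_norml => /andP[_]; lra.
Qed.

Lemma ulim_unique u l m : ulim u l -> ulim u m -> l = m.
Proof.
move=> h1 h2; have h : ulim (fun=> 0) (l - m).
  apply: ulim_eq (ulim_add h1 (ulim_opp h2)) _; apply: ae_T => i; exact: subrr.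
have h' : ulim (fun=> 0) (- (l - m)) by apply: ulim_eq (ulim_opp h) _; apply: ae_T => i; exact: oppr0.
have z : ae (fun=> (0 : R) <= 0) by apply: ae_T => i.
by have := ulim_ge h z; have := ulim_ge h' z; lra.
Qed.

Lemma ulim_inv u l : ulim u l -> l != 0 -> ulim (fun i => (u i)^-1) l^-1.
Proof.
move=> h l0 e e0; have lp : 0 < `|l| by rewrite normr_gt0.
have e1 : 0 < Num.min (`|l| / 2) (e * (`|l| / 2 * `|l|)).
  by rewrite lt_min divr_gt0 //= !mulr_gt0 // divr_gt0.
apply: ae_imp (h _ e1) => i; rewrite le_min => /andP[h1 h2].
have ui : `|l| / 2 <= `|u i|.
  have := ler_normD (u i) (l - u i); rewrite addrC subrK distrC => ?.
  by move: h1; lra.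
have ui0 : u i != 0 by rewrite -normr_gt0; lra.
rewrite (_ : (u i)^-1 - l^-1 = - (u i - l) * (u i * l)^-1); last by field; rewrite ui0 l0.
rewrite normrM normrN normfV ler_pdivrMr ?normr_gt0 ?mulf_neq0 //.
apply: le_trans h2 _; rewrite ler_wpM2l ?(ltW e0) // normrM ler_wpM2r //.
Qed.

Lemma ulim_ex u C : ae (fun i => `|u i| <= C) -> exists l, ulim u l.
Proof. exact: ae_bounded_lim. Qed.

Definition vlim n (x : I -> 'rV[R]_n) (l : 'rV[R]_n) := forall k, ulim (fun i => x i 0 k) (l 0 k).

Lemma vlim_box n (x : I -> 'rV[R]_n) l e : vlim x l -> 0 < e -> ae (fun i => box e (x i - l)).
Proof.
move=> h e0; apply: ae_all => k; apply: ae_imp (h k e e0) => i; by rewrite !mxE.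
Qed.

Lemma vlimP n (x : I -> 'rV[R]_n) l : (forall e, 0 < e -> ae (fun i => box e (x i - l))) -> vlim x l.
Proof. by move=> h k e e0; apply: ae_imp (h e e0) => i /(_ k); rewrite !mxE. Qed.

Lemma vlim_eq n (x y : I -> 'rV[R]_n) l : vlim x l -> ae (fun i => x i = y i) -> vlim y l.
Proof. by move=> h E k; apply: ulim_eq (h k) _; apply: ae_imp E => i ->. Qed.

Lemma vlim_cst n (l : 'rV[R]_n) : vlim (fun=> l) l.
Proof. by move=> k; exact: ulim_cst. Qed.

Lemma vlim_scale n (t : I -> R) (x : I -> 'rV[R]_n) s l : ulim t s -> vlim x l ->
  vlim (fun i => t i *: x i) (s *: l).
Proof.
move=> ht hx k; rewrite mxE; apply: ulim_eq (ulim_mul ht (hx k)) _; apply: ae_T => i.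
by rewrite mxE.
Qed.

Lemma vlim_add n (x y : I -> 'rV[R]_n) l m : vlim x l -> vlim y m ->
  vlim (fun i => x i + y i) (l + m).
Proof.
move=> hx hy k; rewrite mxE; apply: ulim_eq (ulim_add (hx k) (hy k)) _; apply: ae_T => i.
by rewrite mxE.
Qed.

Lemma vlim_unique n (x : I -> 'rV[R]_n) l m : vlim x l -> vlim x m -> l = m.
Proof. by move=> h1 h2; apply/rowP => k; exact: ulim_unique (h1 k) (h2 k). Qed.

Lemma ulim_enorm n (x : I -> 'rV[R]_n) l : vlim x l -> ulim (fun i => enorm (x i)) (enorm l).
Proof.
move=> h; have hs : ulim (fun i => \sum_(k < n) x i 0 k ^+ 2) (\sum_(k < n) l 0 k ^+ 2).
  by apply: ulim_sum => k; rewrite expr2; apply: ulim_mul.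
have [s hs1] : exists s, ulim (fun i => enorm (x i)) s.
  apply: (@ulim_ex _ (`|\sum_(k < n) l 0 k ^+ 2| + 1 + 1)).
  apply: ae_imp (ulim_bnd hs) => i; rewrite -enorm_sqr normrX => h2.
  have := normr_ge0 (enorm (x i)); set a := `|enorm _| in h2 *.
  rewrite expr2 in h2; nra.
suff -> : enorm l = s by [].
have s0 : 0 <= s by apply: ulim_ge hs1 _; apply: ae_T => i; exact: enorm_ge0.
apply/eqP; rewrite -(@eqrXn2 _ 2) ?enorm_ge0 // enorm_sqr; apply/eqP.
apply: ulim_unique hs _; rewrite expr2; apply: ulim_eq (ulim_mul hs1 hs1) _.
by apply: ae_T => i; rewrite -expr2 enorm_sqr.
Qed.

Lemma vlim_unitv n (x : I -> 'rV[R]_n) l : vlim x l -> l != 0 -> vlim (fun i => unitv (x i)) (unitv l).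
Proof.
by move=> h l0; apply: vlim_scale => //; apply: ulim_inv; [exact: ulim_enorm|rewrite enorm_eq0].
Qed.

Lemma GD_vlim n (A : set 'rV[R]_n) (a : I -> 'rV[R]_n) l : ae (fun i => GD A (a i)) -> vlim a l -> GD A l.
Proof.
move=> hA hl; apply/GDP; split.
  apply: (@ulim_unique (fun i => enorm (a i))); first exact: ulim_enorm.
  by apply: ulim_eq (ulim_cst 1) _; apply: ae_imp hA => i /GD_unit.
move=> e e0; have e2 : 0 < e / 2 by rewrite divr_gt0.
have [i [/GDP[_ h1] h2]] := ae_ex (ae_and hA (vlim_box hl e2)).
have [p [b [Ap db bp bb]]] := h1 _ e2; exists p, b; split=> //.
  by apply: box_le bp _; lra.
move=> k; rewrite (_ : b - l = (b - a i) + (a i - l)); last by rewrite addrA subrK.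
by rewrite mxE; apply: le_trans (ler_normD _ _) _; have := bb k; have := h2 k; lra.
Qed.

Lemma half_cone_vlim n (A : set 'rV[R]_n) (x : I -> 'rV[R]_n) l :
  ae (fun i => half_cone (GD A) (x i)) -> vlim x l -> half_cone (GD A) l.
Proof.
move=> hA hl; apply/half_coneP; first exact: GD_unit.
have [l0|l0] := eqVneq l 0.
  by left; split=> //; have [i [t [v [_ h _]]]] := ae_ex hA; exists v.
right; split=> //; apply: GD_vlim (vlim_unitv hl l0).
have lp := enorm_gt0 l0; have l2 : 0 < enorm l / 2 by rewrite divr_gt0.
apply: ae_imp2 hA (ulim_enorm hl l2) => i h1 h2.
have /half_coneP[] := h1; [exact: GD_unit| |by case].
by move=> [x0 _]; move: h2; rewrite x0 enorm0 sub0r normrN gtr0_norm //; lra.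
Qed.

Lemma direction_tangent n (A : set 'rV[R]_n) (v y : 'rV[R]_n) (x : I -> 'rV[R]_n) (eps : I -> R) : y != 0 ->
  ae (fun i => A (x i)) -> ae (fun i => 0 < eps i) -> ulim eps 0 ->
  vlim (fun i => (eps i)^-1 *: (x i - v)) y -> direction_set A v (unitv y).
Proof.
move=> y0 hC he e0 hy; apply/direction_setP.
split=> [|e ep]; first exact: enorm_unitv.
have y2 : 0 < enorm y / 2 by rewrite divr_gt0 // enorm_gt0.
have hx : vlim (fun i => x i - v) 0.
  have := vlim_scale e0 hy; rewrite scale0r => /vlim_eq; apply.
  by apply: ae_imp he => i h; rewrite scalerA mulfV ?scale1r // gt_eqF.
have [i [h1 [h2 [h3 [h4 h5]]]]] := ae_ex (ae_and hC (ae_and he (ae_and (vlim_box hx ep)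
   (ae_and (vlim_box (vlim_unitv hy y0) ep) (ulim_enorm hy y2))))).
exists (x i); split=> //.
- apply/eqP => E; move: h5; rewrite E subrr scaler0 enorm0 sub0r normrN gtr0_norm ?enorm_gt0 //.
  by have := enorm_gt0 y0; lra.
- by rewrite subr0 in h3.
- by rewrite unitvZ ?invr_gt0 // in h4.
Qed.

Lemma GD_tangent n (C : set 'rV[R]_n) (v y : 'rV[R]_n) (x : I -> 'rV[R]_n) (eps : I -> R) : conic C -> C v -> y != 0 ->
  ae (fun i => C (x i)) -> ae (fun i => 0 < eps i) -> ulim eps 0 ->
  vlim (fun i => (eps i)^-1 *: (x i - v)) y -> GD C (unitv y).
Proof. by move=> cC Cv y0 hC he e0 hy; apply: (GD_conic cC Cv); exact: direction_tangent hC he e0 hy. Qed.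

Definition mlim p n (E : I -> 'M[R]_(p, n)) (L : 'M[R]_(p, n)) :=
  forall j k, ulim (fun i => E i j k) (L j k).

Lemma mlim_mul p q n (E : I -> 'M[R]_(p, q)) (F : I -> 'M[R]_(q, n)) L M : mlim E L -> mlim F M ->
  mlim (fun i => E i *m F i) (L *m M).
Proof.
move=> hE hF j k; rewrite mxE; apply: ulim_eq (ulim_sum _ (fun l => ulim_mul (hE j l) (hF l k))) _.
by apply: ae_T => i; rewrite mxE.
Qed.

Lemma mlim_unique p n (E : I -> 'M[R]_(p, n)) L M : mlim E L -> mlim E M -> L = M.
Proof. by move=> h1 h2; apply/matrixP => j k; exact: ulim_unique (h1 j k) (h2 j k). Qed.

Lemma mlim_tr p n (E : I -> 'M[R]_(p, n)) L : mlim E L -> mlim (fun i => (E i)^T) L^T.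
Proof.
move=> h j k; rewrite mxE; apply: ulim_eq (h k j) _; by apply: ae_T => i; rewrite mxE.
Qed.

Lemma mlim_cst p n (L : 'M[R]_(p, n)) : mlim (fun=> L) L.
Proof. by move=> j k; exact: ulim_cst. Qed.

Lemma mlim_eq p n (E F : I -> 'M[R]_(p, n)) L : mlim E L -> ae (fun i => E i = F i) -> mlim F L.
Proof. by move=> h EF j k; apply: ulim_eq (h j k) _; apply: ae_imp EF => i ->. Qed.

End Lim.

(** * Limits of linear spaces *)

Section GramSchmidt.
Context {R : realType}.

Lemma mulmxtr_enorm n (x : 'rV[R]_n) : (x *m x^T) 0 0 = enorm x ^+ 2.
Proof. by rewrite enorm_sqr mxE; apply: eq_bigr => k _; rewrite mxE expr2. Qed.

(** Gram-Schmidt started at a, so that a stays in the span when only k + 1 of the available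
    dimensions are kept. *)
Lemma orthoframe n (W : 'M[R]_n) (a : 'rV[R]_n) k : enorm a = 1 -> (a <= W)%MS -> (k < \rank W)%N ->
  exists E : 'M[R]_(k.+1, n), [/\ E *m E^T = 1%:M, (E <= W)%MS & (a <= E)%MS].
Proof.
move=> ua aW; elim: k => [_|k IH kW].
  exists a; split=> //; apply/matrixP => i j; rewrite !ord1 mulmxtr_enorm ua expr1n mxE eqxx //.
have [E [EE EW aE]] := IH (ltnW kW).
have [u [uW uE u0]] : exists u : 'rV[R]_n, [/\ (u <= W)%MS, u *m E^T = 0 & u != 0].
  have : (W :&: kermx E^T)%MS != 0.
    rewrite -mxrank_eq0 -lt0n; have := mxrank_sum_cap W (kermx E^T).
    have := rank_leq_col (W + kermx E^T)%MS; rewrite mxrank_ker mxrank_tr.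
    have := rank_leq_row E; have := rank_leq_col E; lia.
  move/rowV0Pn => [u]; rewrite sub_capmx => /andP[uW /sub_kermxP uE] u0.
  by exists u.
have up := enorm_gt0 u0.
pose v := unitv u.
have vv : v *m v^T = 1%:M.
  by apply/matrixP => i j; rewrite !ord1 mulmxtr_enorm enorm_unitv // expr1n mxE.
have vE : v *m E^T = 0 by rewrite /v /unitv -scalemxAl uE scaler0.
have Ev : E *m v^T = 0 by rewrite -[LHS]trmxK trmx_mul trmxK vE trmx0.
have G1 : col_mx v E *m (col_mx v E)^T = 1%:M :> 'M[R]_(1 + k.+1).
  by rewrite tr_col_mx mul_col_row vv vE Ev EE -scalar_mx_block.
have G2 : (col_mx v E <= W)%MS by rewrite col_mx_sub EW /v /unitv scalemx_sub.
have G3 : (a <= col_mx v E)%MS.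
  apply: submx_trans aE _.
  by have := submx_refl (col_mx v E); rewrite {1}col_mx_sub => /andP[].
by exists (col_mx v E).
Qed.

(** Orthonormal frames are bounded, so they converge along U, and the relation E E^T = 1 passes to
    the limit: the rank cannot drop. *)
Lemma lim_framed (I : Type) (U : set_system I) {UF : UltraFilter U} n k (W : I -> 'M[R]_n)
    (a : I -> 'rV[R]_n) b :
  ae U (fun i => [/\ enorm (a i) = 1, (a i <= W i)%MS & (k < \rank (W i))%N]) ->
  vlim U a b ->
  exists V : 'M[R]_n, [/\ (k < \rank V)%N, (b <= V)%MS &
    forall x : 'rV[R]_n, (x <= V)%MS -> exists2 y : I -> 'rV[R]_n,
      ae U (fun i => (y i <= W i)%MS) & vlim U y x].
Proof.
move=> hW ha.
have /choice[E hE] i : exists E : 'M[R]_(k.+1, n),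
    [/\ enorm (a i) = 1, (a i <= W i)%MS & (k < \rank (W i))%N] ->
    [/\ E *m E^T = 1%:M, (E <= W i)%MS & (a i <= E)%MS].
  have [[h1 h2 h3]|h] := pselect [/\ enorm (a i) = 1, (a i <= W i)%MS & (k < \rank (W i))%N].
    by have [E hE] := orthoframe h1 h2 h3; exists E.
  by exists 0.
have hE' : ae U (fun i => [/\ E i *m (E i)^T = 1%:M, (E i <= W i)%MS & (a i <= E i)%MS]).
  by apply: ae_imp hW => i /hE.
have /choice[L hL] (j : 'I_k.+1) : exists l : 'rV[R]_n, forall m, ulim U (fun i => E i j m) (l 0 m).
  have /choice[l hl] m : exists l, ulim U (fun i => E i j m) l.
    apply: (@ulim_ex _ _ _ _ _ 1); apply: ae_imp hE' => i [h1 _ _].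
    have : (E i *m (E i)^T) j j = 1 by rewrite h1 mxE eqxx.
    rewrite mxE (bigD1 m) //= mxE => h2.
    have h3 : 0 <= \sum_(x < n | x != m) E i j x * (E i)^T x j.
      by apply: sumr_ge0 => x _; rewrite mxE -expr2 sqr_ge0.
    rewrite -(@ler_pXn2r _ 2) ?nnegrE // expr1n real_normK ?num_real // expr2; lra.
  by exists (\row_m l m) => m; rewrite mxE.
pose F := \matrix_(j < k.+1, m < n) L j 0 m.
have hF : mlim U E F by move=> j m; rewrite mxE; exact: hL.
have FF : F *m F^T = 1%:M.
  apply: (mlim_unique (mlim_mul hF (mlim_tr hF))).
  apply: (@mlim_eq _ _ U UF _ _ (fun=> 1%:M)); first exact: mlim_cst.
  by apply: ae_imp hE' => i [-> _ _].
have ha' : mlim U a b by move=> j m; rewrite ord1; exact: ha.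
(* Membership in the span of an orthonormal frame is the equation a = a E^T E, which passes to the
   limit. *)
have bF : b = b *m F^T *m F.
  apply: (mlim_unique ha').
  apply: (@mlim_eq _ _ U UF _ _ (fun i => a i *m (E i)^T *m E i)).
    exact: mlim_mul (mlim_mul ha' (mlim_tr hF)) hF.
  apply: ae_imp hE' => i [h1 _ /submxP[c ->]].
  by rewrite -(mulmxA c) h1 mulmx1.
have rF : \rank F = k.+1.
  apply/eqP; rewrite eqn_leq rank_leq_row /=.
  by have := mxrankM_maxl F F^T; rewrite FF mxrank1.
exists (<<F>>)%MS; split.
- by rewrite mxrank_gen rF.
- by rewrite genmxE bF submxMl.
- move=> x; rewrite genmxE => /submxP[c ->]; exists (fun i => c *m E i).
    by apply: ae_imp hE' => i [_ h _]; apply: submx_trans (submxMl _ _) h.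
  have hc : mlim U (fun=> c) c by exact: mlim_cst.
    by move=> m; exact: (mlim_mul hc hF).
Qed.

End GramSchmidt.

(** * Growth of linear spaces under GD *)

Section Stabilise.
Context {R : realType}.

Definition framed n k (C : set 'rV[R]_n) (a : 'rV[R]_n) :=
  exists W : 'M[R]_n, [/\ (k <= \rank W)%N, (a <= W)%MS & forall x : 'rV[R]_n, (x <= W)%MS -> C x].

Lemma framed_vlim (I : Type) (U : set_system I) {UF : UltraFilter U} n k (A : set 'rV[R]_n)
    (a : I -> 'rV[R]_n) l :
  ae U (fun i => enorm (a i) = 1 /\ framed k.+1 (half_cone (GD A)) (a i)) -> vlim U a l ->
  framed k.+1 (half_cone (GD A)) l.
Proof.
move=> h hl.
have /choice[W hW] i : exists W : 'M[R]_n, framed k.+1 (half_cone (GD A)) (a i) ->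
    [/\ (k < \rank W)%N, (a i <= W)%MS & forall x : 'rV[R]_n, (x <= W)%MS -> half_cone (GD A) x].
  have [[W hW]|hn] := pselect (framed k.+1 (half_cone (GD A)) (a i)); first by exists W.
  by exists 0.
have [|V [rV lV hV]] := lim_framed (UF := UF) (k := k) (W := W) _ hl.
  by apply: ae_imp h => i [ua /hW[h1 h2 _]].
exists V; split=> // x /hV[y hy yx]; apply: half_cone_vlim yx.
by apply: ae_imp2 h hy => i [_ /hW[_ _ h3]]; exact: h3.
Qed.

Lemma half_coneS n (A B : set 'rV[R]_n) : (forall a, A a -> B a) ->
  forall x, half_cone A x -> half_cone B x.
Proof. by move=> AB x [t [v [t0 Av ->]]]; exists t, v; split=> //; exact: AB. Qed.

Lemma conic_half_cone n (S : set 'rV[R]_n) : conic (half_cone S).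
Proof. by move=> t x /ltW; exact: half_coneZ. Qed.

(** The rays of a cone are among its directions at the vertex. *)
Lemma GD_incr n (A : set 'rV[R]_n) a : GD A a -> GD (half_cone (GD A)) a.
Proof.
move=> ha; have ua := GD_unit ha; have a0 := unit_neq0 ua.
apply: (@GD_conic _ _ _ 0); first exact: conic_half_cone.
  by exists 0, a; rewrite scale0r.
apply/direction_setP; split=> // e e0; exists (e *: a); split.
- by exists e, a; rewrite ltW.
- by rewrite scaler_eq0 negb_or gt_eqF.
- move=> i; rewrite subr0 mxE normrM gtr0_norm // ler_piMr ?(ltW e0) //.
  by rewrite -ua; exact: enorm_coord.
- by move=> i; rewrite subr0 unitvZ // unitv_id // subrr mxE normr0 ltW.
Qed.

Variables (U : set_system nat) (UF : UltraFilter U) (hU : \oo `<=` U).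
Local Notation ae := (ae U).

Lemma ulim_eps : ulim U (fun i => i.+1%:R^-1) (0 : R).
Proof.
move=> e e0; apply: (@filterS _ _ _ _ _ _ (hU (near_eps e0))) => i /= h.
by rewrite subr0 ger0_norm ?invr_ge0 // ltW.
Qed.

Lemma vlim_of_box n (x : nat -> 'rV[R]_n) l : (forall i, box i.+1%:R^-1 (x i - l)) -> vlim U x l.
Proof.
move=> h; apply: vlimP => e e0; apply: (@filterS _ _ _ _ _ _ (hU (near_eps e0))) => i /= hi.
exact: box_le (h i) (ltW hi).
Qed.

Lemma direction_seq n (A : set 'rV[R]_n) p a : direction_set A p a ->
  exists x, [/\ forall i, A (x i), forall i, x i != p, vlim U x p &
    vlim U (fun i => unitv (x i - p)) a].
Proof.
move=> /direction_setP[ua h].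
have /choice[x hx] (i : nat) : exists x, [/\ A x, x != p, box i.+1%:R^-1 (x - p) &
    box i.+1%:R^-1 (unitv (x - p) - a)] by apply: h; rewrite invr_gt0.
exists x; split; [by move=> i; case: (hx i)|by move=> i; case: (hx i)| |].
  by apply: vlim_of_box => i; case: (hx i).
by apply: vlim_of_box => i; case: (hx i).
Qed.

Lemma GD_seq n (A : set 'rV[R]_n) a : GD A a ->
  exists p b, [/\ forall i, A (p i), forall i, direction_set A (p i) (b i), vlim U p 0 & vlim U b a].
Proof.
move=> /GDP[ua h].
have /choice[x hx] (i : nat) : exists pb : 'rV[R]_n * 'rV[R]_n, [/\ A pb.1, direction_set A pb.1 pb.2,
    box i.+1%:R^-1 pb.1 & box i.+1%:R^-1 (pb.2 - a)].
  by have [|p [b hb]] := h i.+1%:R^-1; [rewrite invr_gt0|exists (p, b)].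
exists (fun i => (x i).1), (fun i => (x i).2); split;
  [by move=> i; case: (hx i)|by move=> i; case: (hx i)| |].
  by apply: vlim_of_box => i; rewrite subr0; case: (hx i).
by apply: vlim_of_box => i; case: (hx i).
Qed.

(** Both alternatives are closed under limits, so it suffices to treat directions at points of C. *)
Lemma GD_dichotomy n (A : set 'rV[R]_n) (C : set 'rV[R]_n) k : 
  (forall v b, C v -> direction_set C v b -> GD A b \/ framed k.+1 (half_cone (GD C)) b) ->
  forall a, GD C a -> GD A a \/ framed k.+1 (half_cone (GD C)) a.
Proof.
move=> claim a /GD_seq[p [b [hp hb _ ba]]].
have [h|h] := ae_em (fun i => GD A (b i)); first by left; exact: GD_vlim h ba.
right; apply: framed_vlim ba; apply: ae_imp h => i h.
split; first by have /direction_setP[] := hb i.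
by have [] := claim _ _ (hp i) (hb i).
Qed.

(* A limit of secants x_i -> v of C, with x_i in a subspace W_i of C, either lies in the limit V
   of the W_i, or spans with V a subspace of directions of C at v and -v. *)
Lemma GD_step n (A B : set 'rV[R]_n) (prev : Prop) k :
  (prev -> GD (half_cone (GD B)) = GD A) ->
  (forall a, GD A a -> (prev /\ GD B a) \/ framed k.+1 (half_cone (GD A)) a) ->
  forall a, GD (half_cone (GD A)) a ->
    GD A a \/ framed k.+2 (half_cone (GD (half_cone (GD A)))) a.
Proof.
move=> hprev hA; set C := half_cone (GD A); apply: GD_dichotomy => v b Cv db.
have ub : enorm b = 1 by have /direction_setP[] := db.
have b0 := unit_neq0 ub.
have [x [hx xv xlim blim]] := direction_seq db.
have cC : conic C by exact: conic_half_cone.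
(* Secants from the vertex are the normalised points of the cone themselves. *)
have [v0|v0] := eqVneq v 0.
  left; apply: (GD_vlim _ blim); apply: ae_T => i.
  have /half_coneP[] := hx i; first exact: GD_unit.
    by move=> [x0]; have := xv i; rewrite v0 x0 eqxx.
  by rewrite v0 subr0 => -[].
pose eps i := enorm (x i - v).
have eps0 i : 0 < eps i by rewrite enorm_gt0 // subr_eq0.
have epsl : ulim U eps 0.
  by rewrite -(enorm0 n) -(subrr v); apply: ulim_enorm; apply: vlim_add => //; exact: vlim_cst.
have xn0 : ae (fun i => x i != 0).
  have v2 : 0 < enorm v / 2 by rewrite divr_gt0 // enorm_gt0.
  apply: ae_imp (ulim_enorm xlim v2) => i; apply: contraTneq => ->.
  by rewrite enorm0 sub0r normrN gtr0_norm ?enorm_gt0 // -ltNge; have := enorm_gt0 v0; lra.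
have ulimv := vlim_unitv (UF:=UF) xlim v0.
have Au : ae (fun i => GD A (unitv (x i))).
  apply: ae_imp xn0 => i h; have /half_coneP[] := hx i; first exact: GD_unit.
    by move=> [x0]; rewrite x0 eqxx in h.
  by case.
(* If along U the points x i come from the previous cone, then b belongs to GD of that cone, which
   is [GD A]. *)
have [h1|h1] := ae_em (fun i => prev /\ GD B (unitv (x i))).
  have [i0 [pv _]] := ae_ex h1; left; rewrite -(hprev pv) -(unitv_id ub).
  have hB : ae (fun i => half_cone (GD B) (x i)).
    apply: ae_imp2 h1 xn0 => i [_ h2] h3; apply/half_coneP; first exact: GD_unit.
    by right.
  apply: (GD_tangent _ _ b0 hB _ epsl) => //.
  - exact: conic_half_cone.
  - exact: half_cone_vlim hB xlim.
  - exact: ae_T.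
  - exact: blim.
have h2 : ae (fun i => framed k.+1 C (unitv (x i))).
  by apply: ae_imp2 h1 Au => i h /hA[/h|].
have /choice[W hW] i : exists W : 'M[R]_n, framed k.+1 C (unitv (x i)) ->
    [/\ (k < \rank W)%N, (unitv (x i) <= W)%MS & forall x : 'rV[R]_n, (x <= W)%MS -> C x].
  have [[W hW]|hn] := pselect (framed k.+1 C (unitv (x i))); first by exists W.
  by exists 0.
have [|V [rV lV hV]] := lim_framed (UF := UF) (k := k) (W := W) _ ulimv.
  apply: ae_imp2 h2 xn0 => i /hW[g1 g2 _] g3; split=> //; exact: enorm_unitv.
have VC y : (y <= V)%MS -> C y.
  move=> /hV[t ht tl]; apply: half_cone_vlim tl; apply: ae_imp2 h2 ht => i /hW[_ _ g3]; exact: g3.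
(* A direction inside V is a unit vector of C, hence in [GD A]; otherwise b adds a dimension to
   V. *)
have [bV|bV] := boolP (b <= V)%MS.
  left; have /half_coneP[] := VC _ bV; first exact: GD_unit.
    by move=> [b00]; rewrite b00 eqxx in b0.
  by move=> [_]; rewrite unitv_id.
have vV : (v <= V)%MS by rewrite -(unitvK v0) scalemx_sub.
right; exists (V + b)%MS; split.
- apply: leq_ltn_trans rV _; apply: rank_ltmx; rewrite ltmxE addsmxSl /=.
  by apply: contra bV => h; apply: submx_trans (addsmxSr _ _) h.
- exact: addsmxSr.
(* If y i in W i tends to w, the points x i + eps i y i remain in W i, hence in C, and their secants
   from v tend to b + w. The sign t = -1 repeats this at -v, which produces a linear space rather
   than a half-space. *)
have sgn (t : R) (w : 'rV[R]_n) : t ^+ 2 = 1 -> (w <= V)%MS ->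
    half_cone (GD C) (t *: (b + w)).
  move=> t1 wV; have [y hy yw] := hV w wV.
  have t0 : t != 0 by apply/eqP => E; move/eqP: t1; rewrite E expr0n /= eq_sym oner_eq0.
  have bw0 : t *: (b + w) != 0.
    rewrite scaler_eq0 negb_or t0 /=; apply: contra bV; rewrite addr_eq0 => /eqP ->.
    by rewrite eqmx_opp.
  apply/half_coneP; first exact: GD_unit.
  right; split=> //.
  apply: (@GD_tangent _ _ _ _ _ _ (t *: v) _ (fun i => t *: (x i + eps i *: y i)) eps) => //.
  - by apply: VC; rewrite scalemx_sub.
  - apply: ae_imp2 (ae_and h2 xn0) hy => i [/hW[_ g2 g3] g4] g5; apply: g3.
    rewrite scalemx_sub // addmx_sub ?scalemx_sub //.
    by rewrite -(unitvK g4) scalemx_sub.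
  - exact: ae_T.
  - have l1 : vlim U (fun i => t *: (unitv (x i - v) + y i)) (t *: (b + w)).
      by apply: vlim_scale; [exact: ulim_cst|exact: vlim_add].
    apply: vlim_eq l1 _; apply: ae_T => i.
    rewrite -scalerBr scalerA [_ * t]mulrC -scalerA; congr (_ *: _).
    rewrite addrAC scalerDr scalerA mulVf ?scale1r //.
    by rewrite gt_eqF.
move=> z /sub_addsmxP[[z1 z2] /= ->]; rewrite {z}.
have [s ->] : exists s : R, z2 *m b = s *: b.
  exists (z2 0 0); apply/rowP => j; rewrite !mxE big_ord1 //.
set w := z1 *m V; have wV : (w <= V)%MS by exact: submxMl.
have [->|s0] := eqVneq s 0.
  rewrite scale0r addr0; apply: half_coneS (VC _ wV); exact: GD_incr.
have w' : (s^-1 *: w <= V)%MS by rewrite scalemx_sub.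
have -> : w + s *: b = `|s| *: ((Num.sg s) *: (b + s^-1 *: w)).
  rewrite scalerA [`|s| * _]mulrC -numEsg scalerDr scalerA mulfV // scale1r addrC //.
by apply: half_coneZ => //; apply: sgn => //; rewrite sqr_sg s0.
Qed.

Theorem GDm_stable n m (A : set 'rV[R]_n) : (0 < m <= n)%N ->
  (forall a, GD A a -> framed m (half_cone (GD A)) a) ->
  forall K, (n - (m - 1) <= K)%N -> GDm K A = GDm K.+1 A.
Proof.
move=> /andP[m0 mn] hA K hK.
(* Index shift: the iterate of degree j + 1 is GD of [X j]. *)
pose X j := if j is j'.+1 then half_cone (GDm j'.+1 A) else A.
have GX j : GDm j.+1 A = GD (X j) by case: j.
have X1 j : X j.+1 = half_cone (GD (X j)) by rewrite -GX.
(* Elements new at stage j lie in a space of dimension m + j, written (m + j).-1.+1 to match the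
   successor in [GD_step]. At j = 0 there is no earlier stage and the hypothesis on [GD A] is
   used. *)
have H j : forall a, GD (X j) a -> (0 < j)%N /\ GD (X j.-1) a \/
    framed (m + j).-1.+1 (half_cone (GD (X j))) a.
  elim: j => [|j IH] a ha; first by right; rewrite addn0 prednK //; exact: hA.
  have hp : (0 < j)%N -> GD (half_cone (GD (X j.-1))) = GD (X j).
    by case: j {IH ha} => // j _; rewrite -X1.
  have := GD_step hp IH; rewrite -X1 => /(_ a ha) [h|h]; first by left.
  by right; move: h; rewrite prednK ?addn_gt0 ?m0 // addnS.
case: K hK => [|j] hK; first by lia.
rewrite !GX; apply/seteqP; split=> a; first by rewrite X1; exact: GD_incr.
move/H => [[_ //]|[W [rW _ _]]].
have := rank_leq_row W; lia.
Qed.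

End Stabilise.

(** * From power series to germs, and Lipschitz bounds *)

Section Analytic.
Context {R : realType}.
Implicit Types (r s C D e : R).

Lemma box_sub n r s (x y : 'rV[R]_n) : box r x -> box s y -> box (r + s) (x - y).
Proof.
move=> bx by_ i; rewrite !mxE; apply: le_trans (ler_normB _ _) _.
by apply: lerD; [exact: bx|exact: by_].
Qed.

Definition boxexp n N (b : {ffun 'I_n -> 'I_N}) : {ffun 'I_n -> nat} := [ffun i => val (b i)].

Lemma boxexp_inj n N : injective (@boxexp n N).
Proof.
by move=> b b' /ffunP h; apply/ffunP => i; have := h i; rewrite !ffunE => /val_inj.
Qed.

Lemma summable_box n (c : {ffun 'I_n -> nat} -> R) (w : {ffun 'I_n -> nat} -> R) :
  summable setT (fun al => (c al * w al)%:E) ->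
  exists C, forall N, \sum_(b : {ffun 'I_n -> 'I_N}) `|c (boxexp b) * w (boxexp b)| <= C.
Proof.
rewrite /summable; set S := (\esum_(_ in _) _)%E => hS.
have S0 : (0 <= S)%E by apply: esum_ge0.
exists (fine S) => N; rewrite -lee_fin fineK; last by rewrite ge0_fin_numE.
apply: esum_ge.
pose r := map (@boxexp n N) (enum {ffun 'I_n -> 'I_N}).
have ur : uniq r by rewrite map_inj_uniq ?enum_uniq //; exact: boxexp_inj.
exists [set` r]; first by split=> //; exact: finite_seq.
by rewrite -fsbig_seq // big_map big_enum /= -sumEFin.
Qed.

(** Absolute convergence at the corner (s, ..., s), with s half the given radius, bounds all norms.
    The partial sums over boxes of exponents are regrouped into the finite shells between
    consecutive boxes. *)
Lemma analytic_at_an n (f : 'rV[R]_n -> R) a : analytic_at f a -> an (fun x => f (a + x)).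
Proof.
move=> [c [r [r0 h]]]; pose s := r / 2.
have s0 : 0 < s by rewrite divr_gt0.
have sr : s < r by rewrite /s; lra.
have bs (x : 'rV[R]_n) : box s x -> forall i, `|(a + x) 0 i - a 0 i| < r.
  by move=> bx i; rewrite mxE addrAC subrr add0r; apply: le_lt_trans (bx i) sr.
have monE (x : 'rV[R]_n) (al : {ffun 'I_n -> nat}) : monomial (a + x - a) al = mon al x.
  by rewrite addrAC subrr add0r.
have [hs _] := h (a + const_mx s) (bs (const_mx s) (fun i => ltac:(by rewrite mxE gtr0_norm))).
have [C hC] := summable_box hs.
pose P N x := \sum_(b : {ffun 'I_n -> 'I_N}) c (boxexp b) * mon (boxexp b) x.
pose nrm (al : {ffun 'I_n -> nat}) := `|c al| * \prod_i s ^+ al i.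
pose Q N := \sum_(b : {ffun 'I_n -> 'I_N}) nrm (boxexp b).
have nrm0 al : 0 <= nrm al by rewrite mulr_ge0 // prod_exp_ge0 // ltW.
have QC N : Q N <= C.
  apply: le_trans (hC N); apply: ler_sum => b _; rewrite monE normrM ler_wpM2l //.
  by rewrite normr_prod; apply: ler_prod => i _; rewrite exprn_ge0 ?(ltW s0) //= mxE normrX gtr0_norm.
have ANm al : AN s (fun x : 'rV[R]_n => c al * mon al x) (nrm al).
  exact: (@AN_mono R n s _ (c al) al _ (lexx _) (fun x _ => erefl)).
have hP N : AN s (P N) (Q N) by apply: AN_sum => //; exact: ltW.
pose L N := map (@boxexp n N) (enum {ffun 'I_n -> 'I_N}).
have uL N : uniq (L N) by rewrite map_inj_uniq ?enum_uniq //; exact: boxexp_inj.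
have LP N al : (al \in L N) = [forall i, (al i < N)%N].
  apply/mapP/forallP => [[b _ ->] i|hh]; first by rewrite ffunE ltn_ord.
  exists [ffun i => Ordinal (hh i)]; first by rewrite mem_enum.
  by apply/ffunP => i; rewrite !ffunE.
pose D N := [seq al <- L N.+1 | al \notin L N].
have splitS (T : {ffun 'I_n -> nat} -> R) N : \sum_(b : {ffun 'I_n -> 'I_N.+1}) T (boxexp b) =
   \sum_(b : {ffun 'I_n -> 'I_N}) T (boxexp b) + \sum_(al <- D N) T al.
  have E M : \sum_(b : {ffun 'I_n -> 'I_M}) T (boxexp b) = \sum_(al <- L M) T al.
    by rewrite big_map big_enum.
  rewrite !E -big_cat; apply: perm_big.
  rewrite perm_sym; apply: perm_trans (_ : perm_eq _ ([seq al <- L N.+1 | al \in L N] ++ D N)) _; last first.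
    by apply/permPl; exact: (perm_filterC (fun al => al \in L N)).
  rewrite perm_cat2r perm_sym; apply: uniq_perm => //; first exact: filter_uniq.
  move=> al; rewrite mem_filter andb_idr // !LP => /forallP hh; apply/forallP => i.
  by have := hh i; lia.
pose F N x := \sum_(al <- D N) c al * mon al x.
pose K N := \sum_(al <- D N) nrm al.
have hF N : AN s (F N) (K N) by apply: AN_sum => //; exact: ltW.
have PS N x : P N.+1 x = P N x + F N x by exact: (splitS (fun al => c al * mon al x)).
have QS N : Q N.+1 = Q N + K N by exact: (splitS nrm).
have Q0 : 0 <= Q 0%N by apply: sumr_ge0.
have Ptel x N : \sum_(k < N) F k x = P N x - P 0%N x.
  elim: N => [|N IH]; first by rewrite big_ord0 subrr.
  by rewrite big_ord_recr /= IH PS; ring.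
have Qtel N : \sum_(k < N) K k = Q N - Q 0%N.
  elim: N => [|N IH]; first by rewrite big_ord0 subrr.
  by rewrite big_ord_recr /= IH QS; ring.
(* The sum over the box of size 0 can be nonzero only for n = 0, where that box holds the single
   empty exponent; it is treated apart. *)
have hser : AN s (fun x => f (a + x) - P 0%N x) C.
  apply: (AN_series hF) => [N|x bx]; first by rewrite Qtel; have := QC N; lra.
  under eq_fun do rewrite Ptel.
  apply: cvgB; last exact: cvg_cst.
  have [_] := h (a + x) (bs x bx); set X := (fun N => _); set Y := (fun N => P N x).
  suff -> : X = Y by [].
  apply/funext => N; rewrite /X /Y /P; apply: eq_bigr => b _.
  by rewrite monE.
apply: (an_AN s0 (AN_eq (AN_add (ltW s0) hser (hP 0%N)) _)) => x _.
by rewrite subrK.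
Qed.

Lemma an_lipschitz n (f : 'rV[R]_n -> R) : an f -> exists (L : nat) e, 0 < e /\
  forall x y d, 0 <= d -> box e x -> box e y -> box d (x - y) -> `|f x - f y| <= L%:R * d.
Proof.
move=> hf; have [H hH [e e0 he]] := @hadamard2 R 0 n f hf.
have [rho r0 hr] : exists2 e : R, 0 < e & forall k, AN e (fun x => H k x - H k 0) 1.
  apply: fin_radius => [k e1 e2 /ltW e20 e21|k]; first exact: AN_radius.
  by have [s s0 hs] := an_small (hH k) ltr01; exists s.
pose M := \sum_k (`|H k 0| + 1).
exists (Num.truncn M).+1, (Num.min e rho); split; first by rewrite lt_min e0.
move=> x y d d0 bx by_ bd.
have bxe : box e x by apply: box_le bx _; rewrite ge_min lexx.
have bye : box e y by apply: box_le by_ _; rewrite ge_min lexx.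
have bxr : box rho x by apply: box_le bx _; rewrite ge_min lexx orbT.
have byr : box rho y by apply: box_le by_ _; rewrite ge_min lexx orbT.
have b0 : box e (0 : 'rV[R]_0) by move=> [].
have r0x (z : 'rV[R]_n) : row_mx (0 : 'rV[R]_0) z = z.
  apply/rowP => i; have -> : i = rshift 0 i by apply/val_inj.
  by rewrite row_mxEr; congr (z _ _); apply/val_inj.
have := he 0 x y b0 bxe bye; rewrite !r0x => ->.
have M0 : M < ((Num.truncn M).+1)%:R by exact: truncnS_gt.
apply: (@le_trans _ _ (M * d)); last by rewrite ler_wpM2r // ltW.
apply: le_trans (ler_norm_sum _ _ _) _; rewrite mulr_suml; apply: ler_sum => k _.
rewrite normrM mulrC ler_pM //; last by have := bd k; rewrite !mxE.
have b0r : box rho (0 : 'rV[R]_0) by move=> [].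
have bw := box_row_mx b0r (box_row_mx bxr byr).
have := AN_bound (hr k) bw; set h := H k _; move=> h1.
rewrite (_ : h = (h - H k 0) + H k 0); last by ring.
by apply: le_trans (ler_normD _ _) _; lra.
Qed.

Lemma anmap_lipschitz n q (f : 'rV[R]_n -> 'rV[R]_q) : anmap f -> exists (L : nat) e, 0 < e /\
  forall x y d, 0 <= d -> box e x -> box e y -> box d (x - y) -> box (L%:R * d) (f x - f y).
Proof.
move=> hf; have /choice[L hL] j := an_lipschitz (hf j).
have [e e0 he] : exists2 e : R, 0 < e & forall j x y d, 0 <= d -> box e x -> box e y -> box d (x - y) ->
    `|f x 0 j - f y 0 j| <= (L j)%:R * d.
  apply: fin_radius => [j e1 e2 e20 e21 h x y d d0 bx by_|j].
    by apply: h => //; apply: box_le; eauto.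
  by have [e [e0 he]] := hL j; exists e.
exists (\sum_j L j)%N, e; split=> // x y d d0 bx by_ bd j; rewrite !mxE.
apply: le_trans (he j x y d d0 bx by_ bd) _; rewrite ler_wpM2r // ler_nat.
by rewrite (bigD1 j) //= leq_addr.
Qed.

End Analytic.

(** * Thin sets and local dimension *)

Section Thin.
Context {R : realType}.
Implicit Types (r s C D e : R).

(* Upper box-counting dimension at most m - 1. *)
Definition thin n m (E : set 'rV[R]_n) := exists C : nat, forall N, (0 < N)%N ->
  exists2 cs : seq 'rV[R]_n, (size cs <= C * N ^ m.-1)%N &
    forall x, E x -> exists2 c, c \in cs & box (N%:R^-1) (x - c).

Lemma thin0 n m : thin m (set0 : set 'rV[R]_n).
Proof. by exists 0%N => N _; exists [::]. Qed.

Lemma thinU n m (E F : set 'rV[R]_n) : thin m E -> thin m F -> thin m (E `|` F).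
Proof.
move=> [C hC] [D hD]; exists (C + D)%N => N N0.
have [cs h1 h2] := hC N N0; have [ds h3 h4] := hD N N0; exists (cs ++ ds).
  by rewrite size_cat mulnDl leq_add.
by move=> x [/h2[c cc bc]|/h4[c cc bc]]; exists c; rewrite // mem_cat cc ?orbT.
Qed.

Lemma thinS n m (E F : set 'rV[R]_n) : E `<=` F -> thin m F -> thin m E.
Proof.
move=> EF [C hC]; exists C => N /hC[cs h1 h2]; exists cs => // x /EF; exact: h2.
Qed.

(** A grid with (L + 1) N cells per axis has (L + 1)^d N^d cells, each sent into a box of radius 1 /
    N, and d <= m - 1. Each cell gets a representative in Q itself, since the Lipschitz bound holds
    only there. *)
Lemma thin_image n d m (g : 'rV[R]_d -> 'rV[R]_n) (Q : set 'rV[R]_d) (L : nat) : (d < m)%N ->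
  (forall x i, Q x -> 0 <= x 0 i < 1) ->
  (forall x y s, Q x -> Q y -> 0 <= s -> box s (x - y) -> box (L%:R * s) (g x - g y)) ->
  thin m (g @` Q).
Proof.
move=> dm hQ hL; exists (L.+1 ^ d)%N => N N0.
pose M := (L.+1 * N)%N; have M0 : (0 < M)%N by rewrite /M; nia.
have MR : (0 : R) < M%:R by rewrite ltr0n.
pose cell (t : {ffun 'I_d -> 'I_M}) (x : 'rV[R]_d) := forall i, (t i)%:R <= M%:R * x 0 i < (t i).+1%:R.
have /choice[pt hpt] (t : {ffun 'I_d -> 'I_M}) : exists x, forall y, Q y -> cell t y -> Q x /\ cell t x.
  have [[y [h1 h2]]|h] := pselect (exists y, Q y /\ cell t y); first by exists y.
  by exists 0 => y h1 h2; exfalso; apply: h; exists y.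
exists [seq g (pt t) | t <- enum {ffun 'I_d -> 'I_M}].
  rewrite size_map -cardE card_ffun !card_ord /M expnMn leq_mul2l; apply/orP; right.
  by rewrite leq_pexp2l //; lia.
move=> _ [x Qx <-].
have /choice[t ht] i : exists t : 'I_M, t%:R <= M%:R * x 0 i < t.+1%:R.
  have /andP[x0 x1] := hQ x i Qx.
  have y0 : 0 <= M%:R * x 0 i by rewrite mulr_ge0 // ltW.
  have /andP[h1 h2] := truncn_itv y0.
  have tM : (Num.truncn (M%:R * x 0 i)%R < M)%N.
    rewrite -(ltr_nat R); apply: le_lt_trans h1 _.
    by rewrite -[X in _ < X]mulr1 ltr_pM2l.
  by exists (Ordinal tM); rewrite h1 h2.
have ct : cell [ffun i => t i] x by move=> i; rewrite ffunE.
have [Qp cp] := hpt _ x Qx ct.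
exists (g (pt [ffun i => t i])); first by apply: map_f; rewrite mem_enum.
have MV : 0 <= (M%:R^-1 : R) by rewrite invr_ge0 ltW.
apply: box_le (hL _ _ M%:R^-1 Qx Qp MV _) _.
  move=> i; rewrite !mxE; have := ct i; have := cp i; rewrite ffunE -!natr1 => h1 h2.
  rewrite -(ler_pM2l MR) mulfV ?gt_eqF // -{1}(gtr0_norm MR) -normrM mulrBr ler_norml.
  by apply/andP; split; lra.
rewrite ler_pdivrMr // /M natrM mulrC mulrAC -mulrA mulVf ?mulr1 ?ler_nat ?leqnSn //.
by rewrite pnatr_eq0 -lt0n.
Qed.

(* Separated points of E are covered one at a time. *)
Lemma thin_packing n m k (E : set 'rV[R]_n) (L : nat) : (0 < m <= k)%N -> (0 < L)%N -> thin m E ->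
  (forall N : nat, (0 < N)%N -> exists y : {ffun 'I_k -> 'I_N} -> 'rV[R]_n,
     (forall t, E (y t)) /\
     forall t t' c, box ((L * N)%:R^-1) (y t - c) -> box ((L * N)%:R^-1) (y t' - c) -> t = t') ->
  False.
Proof.
move=> /andP[m0 mk] L0 [C hC] hE.
pose N := (C * L ^ m.-1).+1.
have N0 : (0 < N)%N by [].
have [y [Ey hy]] := hE N N0.
have LN : (0 < L * N)%N by rewrite muln_gt0 L0.
have [cs h1 h2] := hC _ LN.
have /choice[f hf] t : exists c, c \in cs /\ box ((L * N)%:R^-1) (y t - c).
  by have [c c1 c2] := h2 _ (Ey t); exists c.
have finj : injective f.
  by move=> t t' E1; apply: (hy t t' (f t)); [case: (hf t)|rewrite E1; case: (hf t')].
have : (size (map f (enum {ffun 'I_k -> 'I_N})) <= size cs)%N.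
  apply: uniq_leq_size; first by rewrite map_inj_uniq // enum_uniq.
  by move=> c /mapP[t _ ->]; case: (hf t).
rewrite size_map -cardE card_ffun !card_ord => /leq_trans /(_ h1).
rewrite expnMn mulnA => hle.
have : (N ^ m <= N ^ k)%N by rewrite leq_pexp2l.
move=> /leq_trans /(_ hle).
rewrite -{1}(prednK m0) expnS leq_pmul2r ?expn_gt0 ?N0 //.
by rewrite /N ltnn.
Qed.

(** A grid of N^k points in the chart goes to points of M that stay separated at scale 1 / N,
    because the straightening map h is Lipschitz; [thin_packing] excludes this. *)
Lemma submanifold_not_thin n m k (M : set 'rV[R]_n) : (0 < m <= k)%N -> M !=set0 ->
  analytic_submanifold k M -> ~ thin m M.
Proof.
move=> mk [p Mp] [kn hM] hthin.
have [Om [V [h [g [[oO Op oV] [[ah ag hg gh] hMO]]]]]] := hM p Mp.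
have [Vp ghp] := hg p Op.
have ah' : anmap (fun x => h (p + x)) by move=> j; exact: (analytic_at_an (ah j p Op)).
have ag' : anmap (fun x => g (h p + x) - p).
  move=> j; apply: an_ext (an_sub (analytic_at_an (ag j (h p) Vp)) (an_cst n (p 0 j))) _ => x.
  by rewrite !mxE.
have ag0 : g (h p + 0) - p = 0 by rewrite addr0 ghp subrr.
have [L [e [e0 hL]]] := anmap_lipschitz ah'.
have [s1 s10 hs1] := anmap_small ag' ag0 e0.
have [s2 /= s20 hs2] : exists2 e : R, 0 < e & forall y, box e (y - h p) -> V y.
  have /nbhs_ballP[d /= d0 hd] := open_nbhs_nbhs (conj oV Vp).
  exists (d / 2); first by rewrite divr_gt0.
  move=> y by_; apply: hd; apply/(ball_rV _ _ d0) => i; have := by_ i; rewrite !mxE distrC; lra.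
have m0 : 0 < Num.min s1 s2 by rewrite lt_min s10.
(* The grid lives in a box of side 1 / sg, small enough to stay in V and to be mapped by g to where
   h is Lipschitz. *)
pose sg := (Num.truncn (Num.min s1 s2)^-1).+1.
have sgV : (sg%:R^-1 : R) < Num.min s1 s2.
  by rewrite -[X in _ < X]invrK ltf_pV2 ?posrE ?invr_gt0 // /sg truncnS_gt.
have sg0 : (0 : R) < sg%:R by rewrite ltr0n.
apply: (@thin_packing _ _ k M (3 * L.+1 * sg) mk _ hthin); first by lia.
move=> N N0.
have NR : (0 : R) < N%:R by rewrite ltr0n.
pose Y (t : {ffun 'I_k -> 'I_N}) : 'rV[R]_n :=
  \row_j (if insub (val j) is Some i then (t i)%:R / (sg%:R * N%:R) else 0).
have bY t : box (sg%:R^-1) (Y t).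
  move=> j; rewrite mxE; case: insubP => [i _ _|_]; last by rewrite normr0 invr_ge0 ltW.
  rewrite ger0_norm ?divr_ge0 ?mulr_ge0 ?(ltW sg0) ?(ltW NR) //.
  rewrite invfM mulrCA -[X in _ <= X]mulr1 ler_wpM2l ?invr_ge0 ?(ltW sg0) //.
  by rewrite ler_pdivrMr // mul1r ler_nat ltnW.
have bY1 t : box s1 (Y t) by apply: box_le (bY t) _; apply: le_trans (ltW sgV) _; rewrite ge_min lexx.
have bY2 t : V (h p + Y t).
  apply: hs2; rewrite addrAC subrr add0r; apply: box_le (bY t) _.
  by apply: le_trans (ltW sgV) _; rewrite ge_min lexx orbT.
exists (fun t => g (h p + Y t)); split=> [t|t t' c b1 b2].
  have [Og hgy] := gh _ (bY2 t); apply/(hMO _ Og) => j kj; rewrite hgy !mxE.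
  have -> : h p 0 j = 0 by apply: (hMO _ Op).1.
  by case: insubP => [i ik _|_]; [move: ik; rewrite ltnNge kj|rewrite addr0].
pose G u := g (h p + Y u) - p.
have bG u : box e (G u) by move=> i; apply: AN_bound (hs1 i) (bY1 u).
have hG u : h (p + G u) = h p + Y u.
  by rewrite /G addrC subrK; have [_ ->] := gh _ (bY2 u).
(* Two points of M within w of a common c are at most 2 w apart, so their chart coordinates differ
   by at most 2 L w, less than the grid spacing 1 / (sg N); the factor 3 (L + 1) is chosen for
   this. *)
set w : R := (3 * L.+1 * sg * N)%:R^-1 in b1 b2.
have W0 : (0 : R) < (3 * L.+1 * sg * N)%:R by rewrite ltr0n; lia.
have w0 : 0 <= w by rewrite invr_ge0 ltW.
have bGG : box (2 * w) (G t - G t').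
  rewrite (_ : G t - G t' = (g (h p + Y t) - c) - (g (h p + Y t') - c)).
    by apply: box_le (box_sub b1 b2) _; lra.
  by apply/rowP => l; rewrite !mxE; ring.
have w20 : 0 <= 2 * w by rewrite mulr_ge0.
have := hL (G t) (G t') _ w20 (bG t) (bG t') bGG; rewrite !hG => bYY.
apply/ffunP => i; apply/val_inj.
have ikn : (i < n)%N by apply: leq_trans (ltn_ord i) kn.
have E u : Y u 0 (Ordinal ikn) = (u i)%:R / (sg%:R * N%:R).
  rewrite mxE; case: insubP => [j _ /= ji|/=]; last by rewrite ltn_ord.
  by congr ((u _)%:R / _); apply/val_inj.
have := bYY (Ordinal ikn).
have -> : h p + Y t - (h p + Y t') = Y t - Y t' by rewrite opprD addrACA subrr add0r.
have -> : (Y t - Y t') 0 (Ordinal ikn) = Y t 0 (Ordinal ikn) - Y t' 0 (Ordinal ikn).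
  by rewrite [LHS]mxE; congr (_ + _); rewrite [LHS]mxE.
rewrite !E -mulrBl.
have SN : (0 : R) < sg%:R * N%:R by rewrite mulr_gt0.
rewrite normrM [X in _ * X]gtr0_norm ?invr_gt0 // ler_pdivrMr // => hh.
have : `|(t i)%:R - (t' i)%:R| < (1 : R).
  apply: le_lt_trans hh _; rewrite /w.
  have -> : (3 * L.+1 * sg * N)%:R = 3 * L.+1%:R * (sg%:R * N%:R) :> R by rewrite !natrM; ring.
  rewrite (_ : _ * _ * _ = L%:R * 2 / (3 * L.+1%:R)); last first.
    by field; rewrite !gt_eqF ?ltr0n.
  rewrite ltr_pdivrMr ?mulr_gt0 ?ltr0n // mul1r -natr1; have : (0 : R) <= L%:R by rewrite ler0n.
  lra.
rewrite ltr_norml => /andP[h1 h2]; apply/eqP; rewrite eqn_leq; apply/andP; split.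
  by rewrite -ltnS -(ltr_nat R) -natr1; lra.
by rewrite -ltnS -(ltr_nat R) -natr1; lra.
Qed.

End Thin.

(** * Local dimension near 0 *)

Section LocalDim.
Context {R : realType}.

Lemma contains_submanifoldS n (A B : set 'rV[R]_n) k : A `<=` B ->
  contains_submanifold A k -> contains_submanifold B k.
Proof. by move=> AB [M [h1 h2 h3]]; exists M; split=> // x /h2; exact: AB. Qed.

Lemma sdimS n (A B : set 'rV[R]_n) : A `<=` B -> (sdim A <= sdim B)%N.
Proof.
move=> AB; apply/bigmax_leqP => k /asboolP hk; apply: (leq_bigmax_cond (F := fun k : 'I_n.+1 => k : nat)).
by apply/asboolP; exact: contains_submanifoldS hk.
Qed.

Lemma sdim_contains n (A : set 'rV[R]_n) : (0 < sdim A)%N -> contains_submanifold A (sdim A).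
Proof.
have : sdim A = 0%N \/ contains_submanifold A (sdim A).
  apply: (big_ind (fun v => v = 0%N \/ contains_submanifold A v)); first by left.
    by move=> x y hx hy; rewrite /maxn; case: ifP.
  by move=> k /asboolP hk; right.
by case=> [->|].
Qed.

(** The dimension in a ball does not increase as the ball shrinks, so its least value persists below
    some radius. *)
Lemma local_dim_exists n (A : set 'rV[R]_n) p : exists k, has_local_dim A p k.
Proof.
pose P k := exists2 e : R, 0 < e & sdim (A `&` eball p e) = k.
have ex : exists k, `[< P k >] by exists (sdim (A `&` eball p 1)); apply/asboolP; exists 1.
case: (ex_minnP ex) => k /asboolP[e0 e00 he0] hmin; exists k, e0 => // e ep ee0.
apply/eqP; rewrite eqn_leq; apply/andP; split.
  rewrite -he0; apply: sdimS => x [Ax bx]; split=> //; exact: lt_trans bx ee0.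
by apply: hmin; apply/asboolP; exists e.
Qed.

(** Positivity excludes the default value 0 of [xget]. *)
Lemma m0P n (A : set 'rV[R]_n) : (0 < m0 A)%N -> Lambda0 A (m0 A) /\ forall i, Lambda0 A i -> (m0 A <= i)%N.
Proof. by rewrite /m0; case: xgetP => // m -> h _. Qed.

(** The strata of index below [m0 A] are finitely many and none accumulates at 0. A positive
    dimension comes from an actual submanifold, whereas the value 0 of [sdim] may be the convention
    for the empty set. *)
Lemma local_dim_ge n (A : set 'rV[R]_n) : (0 < m0 A)%N -> exists2 e0 : R, 0 < e0 &
  forall p, A p -> box e0 p -> forall e : R, 0 < e ->
  exists2 k, (m0 A <= k)%N & contains_submanifold (A `&` eball p e) k.
Proof.
move=> mpos; have [[mA _] hmin] := m0P mpos.
have [e0 e00 he0] : exists2 e : R, 0 < e & forall i : 'I_(m0 A), forall x, local_dim_stratum A i x -> ~ box e x.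
  apply: fin_radius => [i e e' _ ee' h x hx bx|i]; first exact: h hx (box_le bx ee').
  have nL : ~ Lambda0 A i by move=> /hmin; rewrite leqNgt ltn_ord.
  apply: contrapT => hno; apply: nL; split; first by apply: leq_trans mA; exact: ltnW.
  apply/closure_rV => e ep; apply: contrapT => h2; apply: hno; exists e => // x hx bx.
  by apply: h2; exists x => //; rewrite subr0.
exists e0 => // p Ap bp e ep.
have [k hk] := local_dim_exists A p.
have mk : (m0 A <= k)%N.
  rewrite leqNgt; apply/negP => km; apply: (he0 (Ordinal km) p) => //.
have [e1 e10 he1] := hk.
pose e2 := Num.min (e1 / 2) e.
have e20 : 0 < e2 by rewrite lt_min divr_gt0.
have e21 : e2 < e1 by rewrite gt_min; apply/orP; left; lra.
exists k => //; apply: (@contains_submanifoldS _ (A `&` eball p e2)).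
  by move=> x [Ax bx]; split=> //; apply: lt_le_trans bx _; rewrite ge_min lexx orbT.
rewrite -(he1 e2 e20 e21); apply: sdim_contains; rewrite he1 //.
exact: leq_trans mpos mk.
Qed.

End LocalDim.

(** * Fibres of analytic maps *)

Section DD.
Context {R : realType}.
Implicit Types (r s C D e : R).

Lemma rVB n (x y : 'rV[R]_n) j : (x - y) 0 j = x 0 j - y 0 j.
Proof. by rewrite [LHS]mxE; congr (_ + _); rewrite [LHS]mxE. Qed.

Definition bAN n r (f : 'rV[R]_n -> R) := exists C, AN r f C.

Lemma bAN_eq n r (f g : 'rV[R]_n -> R) : bAN r f -> (forall x, box r x -> f x = g x) -> bAN r g.
Proof. by move=> [C hC] fg; exists C; apply: AN_eq hC fg. Qed.

Lemma bAN_cst n r c : bAN r (fun _ : 'rV[R]_n => c).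
Proof. by exists `|c|; exact: AN_cst. Qed.

Lemma bAN_coord n r i : bAN r (fun x : 'rV[R]_n => x 0 i).
Proof. by exists r; exact: AN_coord. Qed.

Lemma bAN_mul n r (f g : 'rV[R]_n -> R) : 0 <= r -> bAN r f -> bAN r g -> bAN r (fun x => f x * g x).
Proof. by move=> r0 [C hC] [D hD]; exists (C * D); exact: AN_mul. Qed.

Lemma bAN_add n r (f g : 'rV[R]_n -> R) : 0 <= r -> bAN r f -> bAN r g -> bAN r (fun x => f x + g x).
Proof. by move=> r0 [C hC] [D hD]; exists (C + D); exact: AN_add. Qed.

Lemma bAN_sum n r (I : Type) (t : seq I) (f : I -> 'rV[R]_n -> R) : 0 <= r ->
  (forall i, bAN r (f i)) -> bAN r (fun x => \sum_(i <- t) f i x).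
Proof. by move=> r0 /choice[C hC]; exists (\sum_(i <- t) C i); exact: AN_sum. Qed.

Lemma bAN_prod n r (I : Type) (t : seq I) (f : I -> 'rV[R]_n -> R) : 0 <= r ->
  (forall i, bAN r (f i)) -> bAN r (fun x => \prod_(i <- t) f i x).
Proof. by move=> r0 /choice[C hC]; exists (\prod_(i <- t) C i); exact: AN_prod. Qed.

Lemma bAN_radius n r s (f : 'rV[R]_n -> R) : 0 <= s -> s <= r -> bAN r f -> bAN s f.
Proof. by move=> s0 sr [C hC]; exists C; exact: AN_radius hC. Qed.

Lemma bAN_comp n k r s (f : 'rV[R]_n -> R) (q : 'rV[R]_k -> 'rV[R]_n) : 0 <= s -> bAN r f ->
  (forall i, AN s (fun x => q x 0 i) r) -> bAN s (fun x => f (q x)).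
Proof. by move=> s0 [C hC] hq; exists C; exact: AN_comp hC hq. Qed.

Lemma bAN_an n r r' (f : 'rV[R]_n -> R) w : 0 <= r' -> r' < r -> bAN r f -> box r' w ->
  an (fun x => f (w + x)).
Proof.
move=> r'0 rr [C hC] bw; apply: (@an_AN _ _ _ (r - r') C); first by rewrite subr_gt0.
apply: (AN_recenter (r := r')) bw; first by rewrite subr_ge0 ltW.
by rewrite addrC subrK.
Qed.

Definition anmx n p q (M : 'rV[R]_n -> 'M[R]_(p, q)) := forall i j, an (fun x => M x i j).
Definition bANmx n r p q (M : 'rV[R]_n -> 'M[R]_(p, q)) := forall i j, bAN r (fun x => M x i j).

Lemma anmx_mul n p q l (M : 'rV[R]_n -> 'M[R]_(p, q)) (N : 'rV[R]_n -> 'M[R]_(q, l)) :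
  anmx M -> anmx N -> anmx (fun x => M x *m N x).
Proof.
move=> hM hN i j; apply: an_ext (an_sum (index_enum _) (fun k => an_mul (hM i k) (hN k j))) _ => x.
by rewrite mxE.
Qed.

Lemma anmx_cst n p q (M : 'M[R]_(p, q)) : anmx (fun _ : 'rV[R]_n => M).
Proof. by move=> i j; exact: an_cst. Qed.

Lemma anmx_add n p q (M N : 'rV[R]_n -> 'M[R]_(p, q)) : anmx M -> anmx N -> anmx (fun x => M x + N x).
Proof. by move=> hM hN i j; apply: an_ext (an_add (hM i j) (hN i j)) _ => x; rewrite mxE. Qed.

Lemma anmx_sub n p q (M N : 'rV[R]_n -> 'M[R]_(p, q)) : anmx M -> anmx N -> anmx (fun x => M x - N x).
Proof. by move=> hM hN i j; apply: an_ext (an_sub (hM i j) (hN i j)) _ => x; rewrite !mxE. Qed.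

Lemma anmx_comp n k p q (M : 'rV[R]_n -> 'M[R]_(p, q)) (f : 'rV[R]_k -> 'rV[R]_n) :
  anmap f -> f 0 = 0 -> anmx M -> anmx (fun x => M (f x)).
Proof. by move=> hf f0 hM i j; exact: (an_comp hf f0 (hM i j)). Qed.

Lemma anmap_mx n p (f : 'rV[R]_n -> 'rV[R]_p) : anmap f <-> anmx f.
Proof. by split=> [h i j|h j]; rewrite ?ord1; exact: h. Qed.

Lemma bANmx_mul n r p q l (M : 'rV[R]_n -> 'M[R]_(p, q)) (N : 'rV[R]_n -> 'M[R]_(q, l)) : 0 <= r ->
  bANmx r M -> bANmx r N -> bANmx r (fun x => M x *m N x).
Proof.
move=> r0 hM hN i j; apply: bAN_eq (bAN_sum (index_enum _) r0 (fun k => bAN_mul r0 (hM i k) (hN k j))) _ => x _.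
by rewrite mxE.
Qed.

Lemma an_det n p (M : 'rV[R]_n -> 'M[R]_p) : anmx M -> an (fun x => \det (M x)).
Proof.
move=> hM; apply: an_sum => s; apply: an_mul; first exact: an_cst.
by apply: an_prod => i; exact: hM.
Qed.

Lemma bAN_det n r p (M : 'rV[R]_n -> 'M[R]_p) : 0 <= r -> bANmx r M -> bAN r (fun x => \det (M x)).
Proof.
move=> r0 hM; apply: bAN_sum => // s; apply: bAN_mul => //; first exact: bAN_cst.
by apply: bAN_prod => // i; exact: hM.
Qed.

Lemma AN_hadamard n r (f : 'rV[R]_n -> R) C (s : seq 'I_n) : 0 < r -> AN r f C -> uniq s ->
  exists2 g : 'I_n -> 'rV[R]_n -> R, forall i, AN r (g i) (C / r) &
    forall x, box r x -> f x - f (zs s x) = \sum_(i <- s) x 0 i * g i x.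
Proof.
move=> r0 hf; have C0 := AN_ge0 (ltW r0) hf; elim: s => [_|i s IH /= /andP[is_ us]].
  exists (fun _ _ => 0).
    by move=> _; apply: AN_le (AN_0 n r) _; rewrite divr_ge0 // ltW.
  move=> x _; rewrite big_nil (_ : zs _ _ = x) ?subrr //.
  by apply/rowP => j; rewrite mxE.
have [g hg h] := IH us; have [g0 hg0 h0] := AN_divc i r0 hf.
have bz x : box r x -> box r (zeroc i x).
  by move=> bx j; rewrite mxE; case: eqP => _ //; rewrite normr0 ltW.
exists (fun j => if j == i then g0 else fun x => g j (zeroc i x)).
  move=> j; case: eqP => // _; apply: (AN_comp (ltW r0) (hg j)) => l.
  case: (eqVneq l i) => [->|/negbTE li].
    by apply: AN_le (AN_eq (AN_0 n r) _) (ltW r0) => x _; rewrite mxE eqxx.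
  by apply: AN_eq (AN_coord r l) _ => x _; rewrite mxE li.
move=> x bx; rewrite big_cons eqxx -h0 //.
rewrite (_ : \sum_(j <- s) _ = \sum_(j <- s) zeroc i x 0 j * g j (zeroc i x)).
  rewrite -h; last exact: bz.
  rewrite addrA subrK; congr (_ - f _).
  by apply/rowP => j; rewrite !mxE inE; case: (j == i); case: (j \in s).
rewrite big_seq [RHS]big_seq; apply: eq_bigr => j js.
have /negbTE ji : j != i by apply: contraNneq is_ => <-.
by rewrite ji mxE ji.
Qed.

(* Hence K (row_mx x x) is the Jacobian matrix of g at x; no derivative is ever taken. *)
Definition DD d n r (g : 'rV[R]_d -> 'rV[R]_n) (K : 'rV[R]_(d + d) -> 'M[R]_(d, n)) :=
  bANmx r K /\ forall a b, box r a -> box r b -> g a - g b = (a - b) *m K (row_mx a b).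

(** Expanding g(x + h) in h needs x and h of radius r / 2; inserting h = a - b halves the radius
    again, hence r / 4. *)
Lemma DD_exists d n r (g : 'rV[R]_d -> 'rV[R]_n) : 0 < r ->
  (forall j, bAN r (fun x => g x 0 j)) -> exists K, DD (r / 4) g K.
Proof.
move=> r0 hg; have r2 : 0 < r / 2 by rewrite divr_gt0.
have r4 : 0 < r / 4 by rewrite divr_gt0.
pose ph j (w : 'rV[R]_(d + d)) := g (lsubmx w + rsubmx w) 0 j.
have hph j : bAN (r / 2) (ph j).
  apply: (bAN_comp (q := fun w : 'rV[R]_(d + d) => lsubmx w + rsubmx w) (ltW r2) (hg j)) => i.
  have := AN_add (ltW r2) (AN_coord (r / 2) (lshift d i)) (AN_coord (r / 2) (rshift d i)).
  rewrite (_ : r / 2 + r / 2 = r); last by lra.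
  by move/AN_eq; apply => x _; rewrite !mxE.
pose rs (k : 'I_d) : 'I_(d + d) := rshift d k.
have us : uniq (map rs (enum 'I_d)).
  by rewrite map_inj_uniq ?enum_uniq //; exact: rshift_inj.
have /choice[G hG] j : exists G : 'I_d -> 'rV[R]_(d + d) -> R, (forall k, bAN (r / 2) (G k)) /\
    forall x h, box (r / 2) x -> box (r / 2) h ->
      g (x + h) 0 j - g x 0 j = \sum_k h 0 k * G k (row_mx x h).
  have [C hC] := hph j; have [G hG1 hG2] := AN_hadamard r2 hC us.
  exists (fun k => G (rs k)); split; first by move=> k; eexists; exact: hG1.
  move=> x h bx bh; have := hG2 _ (box_row_mx bx bh); rewrite big_map big_enum /=.
  rewrite /ph !row_mxKl !row_mxKr => E.
  transitivity (\sum_i row_mx x h 0 (rs i) * G (rs i) (row_mx x h)); last first.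
    by apply: eq_bigr => k _; rewrite row_mxEr.
  rewrite -E; congr (_ - g _ 0 j); apply/rowP => k; rewrite !mxE.
  case: mapP => [[l _ /eqP]|_]; first by rewrite eq_lrshift.
  rewrite (_ : _ \in _ = true) ?addr0; last by apply: map_f; rewrite mem_enum.
  by have := row_mxEl x h 0 k; rewrite mxE.
pose K (w : 'rV[R]_(d + d)) : 'M[R]_(d, n) :=
  \matrix_(k, j) G j k (row_mx (rsubmx w) (lsubmx w - rsubmx w)).
exists K; split.
  move=> k j; have [h1 _] := hG j.
  apply: bAN_eq (bAN_comp (q := fun w : 'rV[R]_(d + d) => row_mx (rsubmx w) (lsubmx w - rsubmx w)) (ltW r4) (h1 k) _) _.
    apply: AN_row_mx => i.
      apply: AN_le (AN_eq (AN_coord (r / 4) (rshift d i)) _) _; first by move=> x _; rewrite mxE.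
      lra.
    have := AN_sub (ltW r4) (AN_coord (r / 4) (lshift d i)) (AN_coord (r / 4) (rshift d i)).
    rewrite (_ : r / 4 + r / 4 = r / 2); last by lra.
    by move/AN_eq; apply => x _; rewrite !mxE.
  by move=> x _; rewrite mxE.
move=> a b ba bb; apply/rowP => j; have [_ h2] := hG j.
have bb2 : box (r / 2) b by apply: box_le bb _; lra.
have bab : box (r / 2) (a - b) by apply: box_le (box_sub ba bb) _; lra.
have := h2 b (a - b) bb2 bab; rewrite subrKC => E.
rewrite rVB E mxE; apply: eq_bigr => k _.
by rewrite [K _ _ _]mxE row_mxKl row_mxKr.
Qed.

(** Cutting the segment from 0 to a into N + 1 steps bounds |f a - f 0| by |L| a^2 / (N + 1). *)
Lemma quad_const (f : R -> R) (L e : R) : 0 < e ->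
  (forall a b, `|a| <= e -> `|b| <= e -> `|f a - f b| <= L * (a - b) ^+ 2) ->
  forall a, `|a| <= e -> f a = f 0.
Proof.
move=> e0 h a ae_; apply/eqP; rewrite -subr_eq0 -normr_le0 leNgt; apply/negP => fa.
have bnd N : `|f a - f 0| * N.+1%:R <= `|L| * a ^+ 2.
  pose p k := (k%:R / N.+1%:R) * a.
  have N0 : (0 : R) < N.+1%:R by rewrite ltr0n.
  have pe k : (k <= N.+1)%N -> `|p k| <= e.
    move=> kN; rewrite normrM ger0_norm ?divr_ge0 // -[X in _ <= X]mul1r ler_pM ?divr_ge0 //.
    by rewrite ler_pdivrMr // mul1r ler_nat.
  have st k : (k <= N.+1)%N -> `|f (p k) - f 0| <= k%:R * (`|L| * (a / N.+1%:R) ^+ 2).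
    elim: k => [|k IH] kN; first by rewrite /p mul0r mul0r subrr normr0 mul0r.
    rewrite (_ : f (p k.+1) - f 0 = (f (p k.+1) - f (p k)) + (f (p k) - f 0)); last by ring.
    apply: le_trans (ler_normD _ _) _; rewrite -natr1 mulrDl mul1r addrC lerD ?IH ?(ltnW kN) //.
    apply: le_trans (h _ _ (pe _ kN) (pe _ (ltnW kN))) _.
    rewrite (_ : p k.+1 - p k = a / N.+1%:R); last by rewrite /p -[k.+1%:R]natr1; ring.
    by rewrite ler_wpM2r ?sqr_ge0 // ler_norm.
  have := st N.+1 (leqnn _); rewrite {1}/p divff ?gt_eqF // mul1r.
  rewrite -(ler_pM2r N0); set x := _ * _ * _ => hx; apply: le_trans hx _.
  rewrite /x le_eqVlt; apply/orP; left; apply/eqP; rewrite expr_div_n; field.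
  by rewrite gt_eqF.
have q0 : 0 <= `|L| * a ^+ 2 / `|f a - f 0|.
  by rewrite divr_ge0 // mulr_ge0 // sqr_ge0.
have := truncnS_gt (`|L| * a ^+ 2 / `|f a - f 0|); rewrite ltr_pdivrMr // => h1.
have := bnd (Num.truncn (`|L| * a ^+ 2 / `|f a - f 0|)); rewrite mulrC leNgt; by rewrite h1.
Qed.

(** An invertible Y J P forces J P to have rank q, at least that of J, so both have the same column
    space. *)
Lemma col_factor d n q (J : 'M[R]_(d, n)) (P : 'M[R]_(n, q)) (Y : 'M[R]_(q, d)) :
  (\rank J <= q)%N -> Y *m J *m P \in unitmx -> exists X, J = J *m P *m X.
Proof.
move=> rJ uY; have s1 : ((J *m P)^T <= J^T)%MS by rewrite trmx_mul submxMl.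
have r1 : (q <= \rank (J *m P))%N.
  have : \rank (Y *m J *m P) = q by apply: mxrank_unit.
  by move=> E; apply: leq_trans (mxrankM_maxr Y (J *m P)); rewrite mulmxA E.
have : (J^T <= (J *m P)^T)%MS.
  rewrite -(mxrank_leqif_sup s1).2 !mxrank_tr eqn_leq (leq_trans rJ r1) andbT.
  by have := mxrankS s1; rewrite !mxrank_tr.
move/submxP => [X hX]; exists X^T; by rewrite -[LHS]trmxK hX trmx_mul trmxK.
Qed.

End DD.

(** * Curves in the fibres of an analytic map *)

Section Fiber.
Context {R : realType}.
Implicit Types (r s C D e : R).

Lemma DD_recenter d n r r' (g : 'rV[R]_d -> 'rV[R]_n) K z : 0 <= r' -> r' < r -> box r' z -> DD r g K ->
  [/\ anmx (fun w => K (row_mx z z + w)), anmap (fun x => g (z + x)) &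
  forall a b, box (r - r') a -> box (r - r') b ->
    g (z + a) - g (z + b) = (a - b) *m K (row_mx z z + row_mx a b)].
Proof.
move=> r'0 rr bz [hK hg].
have bzz : box r' (row_mx z z) by exact: box_row_mx.
have hKz : anmx (fun w => K (row_mx z z + w)).
  by move=> i j; exact: (bAN_an r'0 rr (hK i j) bzz).
have bza a : box (r - r') a -> box r (z + a).
  move=> ba i; rewrite mxE; apply: le_trans (ler_normD _ _) _.
  by have := bz i; have := ba i; lra.
have id a b : box (r - r') a -> box (r - r') b ->
    g (z + a) - g (z + b) = (a - b) *m K (row_mx z z + row_mx a b).
  move=> ba bb; rewrite (hg _ _ (bza a ba) (bza b bb)) add_row_mx; congr (_ *m _).
  by rewrite opprD addrACA subrr add0r.
split=> //.
have rr0 : 0 < r - r' by rewrite subr_gt0.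
have hr : anmap (fun x : 'rV[R]_d => row_mx x (0 : 'rV[R]_d)).
  by apply: anmap_row_mx; [exact: anmap_id|exact: anmap_cst].
have h1 : anmx (fun x : 'rV[R]_d => g z + x *m K (row_mx z z + row_mx x 0)).
  apply: anmx_add; first exact: anmx_cst.
  apply: anmx_mul; first by apply/anmap_mx; exact: anmap_id.
  by apply: (anmx_comp hr _ hKz); rewrite row_mx0.
move=> j; apply: an_eq (h1 0 j) _; exists (r - r') => // x bx.
have := id x 0 bx (box0 (ltW rr0)); rewrite addr0 subr0 => E.
by rewrite -E addrC subrK.
Qed.

Lemma mulmx1_1 n (u : 'rV[R]_1) (w : 'rV[R]_n) : u *m w = u 0 0 *: w.
Proof. by apply/rowP => j; rewrite !mxE big_ord1. Qed.

Lemma near0_diag n (P : 'rV[R]_(n + n) -> Prop) : near0 P -> near0 (fun x : 'rV[R]_n => P (row_mx x x)).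
Proof.
apply: (near0_comp (q := fun x : 'rV[R]_n => row_mx x x)); last by rewrite row_mx0.
by apply: anmap_row_mx; exact: anmap_id.
Qed.

Lemma diff_nger0 : ~ ger0 (fun w : 'rV[R]_(1 + 1) => lsubmx w 0 0 - rsubmx w 0 0).
Proof.
move=> [e e0 h]; have := h (row_mx (const_mx e) 0); rewrite row_mxKl row_mxKr !mxE subr0 => hc.
suff: e = 0 by move/eqP; rewrite gt_eqF.
apply: hc; apply: box_row_mx; last exact/box0/ltW.
by move=> i; rewrite mxE gtr0_norm.
Qed.

Lemma cancel_diff (f : 'rV[R]_(1 + 1) -> R) : an f ->
  near0 (fun w : 'rV[R]_(1 + 1) => (lsubmx w 0 0 - rsubmx w 0 0) * f w = 0) -> near0 (fun w => f w = 0).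
Proof.
move=> hf h; have hd : an (fun w : 'rV[R]_(1 + 1) => lsubmx w 0 0 - rsubmx w 0 0).
  by apply: an_sub; [exact: (@anmap_lsubmx R 1 1 0)|exact: (@anmap_rsubmx R 1 1 0)].
by have [/diff_nger0|] := near0_domain hd hf h.
Qed.

Lemma an_dd p d (u : 'rV[R]_p -> 'rV[R]_d) : anmap u ->
  exists G : 'rV[R]_(p + p) -> 'M[R]_(p, d), anmx G /\ exists2 e : R, 0 < e &
    forall a b, box e a -> box e b -> u a - u b = (a - b) *m G (row_mx a b).
Proof.
move=> hu.
have [r r0 hr] : exists2 r : R, 0 < r & forall j, bAN r (fun x => u x 0 j).
  apply: fin_radius => [j e e' /ltW e'0 ee'|j]; first exact: bAN_radius.
  by have [r [C [r0 h]]] := hu j; exists r => //; exists C.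
have [K [hK id]] := DD_exists r0 hr; exists K; split.
  by move=> i j; have [C hC] := hK i j; apply: (an_AN _ hC); rewrite divr_gt0.
by exists (r / 4); first by rewrite divr_gt0.
Qed.

(* The velocity E of g along u satisfies E P = 0; the rank bound makes the Jacobian J factor
   through J P, so that E = 0. *)
Lemma const_along d n q r r' (g : 'rV[R]_d -> 'rV[R]_n) K (z : 'rV[R]_d) (P : 'M[R]_(n, q))
    (Y : 'M[R]_(q, d)) (u : 'rV[R]_1 -> 'rV[R]_d) : 0 <= r' -> r' < r -> box r' z -> DD r g K ->
  (exists2 e : R, 0 < e & forall x : 'rV[R]_d, box e x -> (\rank (K (row_mx (z + x) (z + x))) <= q)%N) ->
  Y *m (K (row_mx z z) *m P) = 1%:M -> anmap u -> u 0 = 0 ->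
  near0 (fun s : 'rV[R]_1 => (g (z + u s) - g z) *m P = 0) ->
  near0 (fun s : 'rV[R]_1 => g (z + u s) = g z).
Proof.
move=> r'0 rr bz hDD hrk YKP hu u0 hP.
have [hKz hgz id] := DD_recenter r'0 rr bz hDD.
have rr0 : 0 < r - r' by rewrite subr_gt0.
have [G [hG [e1 e10 idu]]] := an_dd hu.
pose J (w : 'rV[R]_(1 + 1)) := K (row_mx z z + row_mx (u (lsubmx w)) (u (rsubmx w))).
have hl := @anmap_lsubmx R 1 1; have hr := @anmap_rsubmx R 1 1.
have hul := anmap_comp hl (@lsubmx0 _ _ _) hu; have hur := anmap_comp hr (@rsubmx0 _ _ _) hu.
have huu : anmap (fun w : 'rV[R]_(1 + 1) => row_mx (u (lsubmx w)) (u (rsubmx w))).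
  exact: anmap_row_mx.
have hJ : anmx J.
  by apply: (anmx_comp huu _ hKz); rewrite lsubmx0 rsubmx0 u0 row_mx0.
pose E w := G w *m J w.
have hE : anmx E by exact: anmx_mul.
have nu : near0 (fun s : 'rV[R]_1 => box (r - r') (u s)) by apply: (near0_comp hu u0); exact: near0_box.
have nul := near0_comp hl (@lsubmx0 _ _ _) nu; have nur := near0_comp hr (@rsubmx0 _ _ _) nu.
have nb1 : near0 (fun w : 'rV[R]_(1 + 1) => box e1 (lsubmx w) /\ box e1 (rsubmx w)).
  apply: near0_and; [apply: near0_comp hl _ _|apply: near0_comp hr _ _];
    rewrite ?lsubmx0 ?rsubmx0 //; exact: near0_box.
have i1 : near0 (fun w : 'rV[R]_(1 + 1) => g (z + u (lsubmx w)) - g (z + u (rsubmx w)) =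
    (lsubmx w 0 0 - rsubmx w 0 0) *: E w).
  apply: near0_imp2 (near0_and nul nur) nb1 => w [b1 b2] [b3 b4].
  rewrite (id _ _ b1 b2) (idu _ _ b3 b4) hsubmxK -rVB -mulmx1_1 /E mulmxA //.
have i2 : near0 (fun w : 'rV[R]_(1 + 1) => E w *m P = 0).
  have hEP := anmx_mul hE (anmx_cst (1 + 1) P).
  have : near0 (fun w : 'rV[R]_(1 + 1) => forall j, (E w *m P) 0 j = 0).
    apply: near0_all => j; apply: cancel_diff; first exact: hEP.
    apply: near0_imp2 i1 (near0_and (near0_comp hl (@lsubmx0 _ _ _) hP) (near0_comp hr (@rsubmx0 _ _ _) hP)).
    move=> w F [F1 F2]; have := congr1 (fun M => (M *m P) 0 j) F.
    rewrite -scalemxAl [X in _ = X]mxE => <-.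
    rewrite (_ : _ - _ = (g (z + u (lsubmx w)) - g z) - (g (z + u (rsubmx w)) - g z)).
      by rewrite mulmxBl F1 F2 subrr mxE.
    by rewrite opprB addrA subrK.
  by apply: near0_imp => w h; apply/rowP => j; rewrite h mxE.
(* The rank bound concerns the Jacobian at a single point, so E = 0 is obtained on the diagonal
   only. *)
have i3 : near0 (fun b : 'rV[R]_1 => E (row_mx b b) = 0).
  have hY : an (fun b : 'rV[R]_1 => \det (Y *m J (row_mx b b) *m P)).
    apply: an_det; apply: anmx_mul; last exact: anmx_cst.
    apply: anmx_mul; first exact: anmx_cst.
    apply: (anmx_comp (f := fun b : 'rV[R]_1 => row_mx b b) _ _ hJ); last by rewrite row_mx0.
    by apply: anmap_row_mx; exact: anmap_id.
  have hY0 : \det (Y *m J (row_mx 0 0) *m P) != 0.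
    by rewrite /J row_mxKl row_mxKr u0 row_mx0 addr0 -mulmxA YKP det1 oner_neq0.
  have [e0 e00 hrk'] := hrk.
  have nu0 : near0 (fun s : 'rV[R]_1 => box e0 (u s)) by apply: (near0_comp hu u0); exact: near0_box.
  apply: near0_imp2 (near0_and (an_neq0 hY hY0) (near0_diag i2)) nu0 => b [d1 d2] d3.
  have rJ : (\rank (J (row_mx b b)) <= q)%N.
    by rewrite /J row_mxKl row_mxKr add_row_mx; exact: hrk'.
  have [|X hX] := @col_factor _ _ _ _ (J (row_mx b b)) P Y rJ.
    by rewrite unitmxE unitfE.
  by rewrite /E hX mulmxA [G _ *m _]mulmxA; move: d2; rewrite /E => ->; rewrite mul0mx.
have : near0 (fun s : 'rV[R]_1 => forall j, g (z + u s) 0 j = g z 0 j).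
  apply: near0_all => j.
  have [L [e2 [e20 hL]]] := an_lipschitz (hE 0 j).
  have [e3 e30 h3] := i1; have [e4 e40 h4] := i3.
  pose e := Num.min (Num.min e2 e3) e4.
  have ep : 0 < e by rewrite !lt_min e20 e30.
  exists e => // s bs; pose f t := g (z + u (const_mx t)) 0 j.
  have cs : const_mx (s 0 0) = s by apply/rowP => i; rewrite mxE ord1.
  have bc t : `|t| <= e -> box e (const_mx t : 'rV[R]_1) by move=> h i; rewrite mxE.
  have c0 : const_mx 0 = 0 :> 'rV[R]_1 by apply/rowP => i; rewrite !mxE.
  have : f (s 0 0) = f 0.
    apply: (quad_const (L := L%:R) ep); last exact: bs.
    move=> a b /bc ba /bc bb.
    have bw : box e (row_mx (const_mx a : 'rV[R]_1) (const_mx b : 'rV[R]_1)) by exact: box_row_mx.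
    have be2 : e <= e2 by rewrite /e !ge_min lexx.
    have be3 : e <= e3 by rewrite /e !ge_min lexx orbT.
    have be4 : e <= e4 by rewrite /e !ge_min lexx orbT.
    have := congr1 (fun M : 'rV[R]_n => M 0 j) (h3 _ (box_le bw be3)).
    rewrite /= rVB row_mxKl row_mxKr [in X in _ = X]mxE !mxE => ->.
    (* E is Lipschitz and vanishes on the diagonal, so E(a, b) is O(|a - b|) and the increments of g
       along the curve are quadratic, as [quad_const] requires. *)
    have hab : `|E (row_mx (const_mx a) (const_mx b)) 0 j| <= L%:R * `|a - b|.
      have := hL _ _ `|a - b| (normr_ge0 _) (box_le bw be2) (box_le (box_row_mx bb bb) be2).
      rewrite (h4 _ (box_le bb be4)) (_ : (0 : 'rV[R]_n) 0 j = 0) ?subr0; last by rewrite mxE.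
      apply.
      rewrite opp_row_mx add_row_mx subrr; apply: box_row_mx; last exact/box0/normr_ge0.
      by move=> i; rewrite rVB !mxE.
    rewrite normrM -(real_normK (num_real (a - b))) (_ : L%:R * _ = `|a - b| * (L%:R * `|a - b|)).
      by apply: ler_wpM2l => //; move: hab; rewrite /E mxE.
    by ring.
  by rewrite /f cs c0 u0 addr0.
by apply: near0_imp => s h; apply/rowP => j; rewrite h.
Qed.

Lemma anmap_mulr n p q (f : 'rV[R]_n -> 'rV[R]_p) (M : 'M[R]_(p, q)) : anmap f -> anmap (fun x => f x *m M).
Proof.
by move=> hf; apply/anmap_mx; apply: anmx_mul; [apply/anmap_mx|exact: anmx_cst].
Qed.

Lemma anmap_add n p (f g : 'rV[R]_n -> 'rV[R]_p) : anmap f -> anmap g -> anmap (fun x => f x + g x).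
Proof. by move=> /anmap_mx hf /anmap_mx hg; apply/anmap_mx; exact: anmx_add. Qed.

Lemma dd_curve d n r r' (g : 'rV[R]_d -> 'rV[R]_n) K z : 0 <= r' -> r' < r -> box r' z -> DD r g K ->
  exists J : 'rV[R]_d -> 'M[R]_(d, n), [/\ anmx J, J 0 = K (row_mx z z) &
    near0 (fun x : 'rV[R]_d => g (z + x) - g z = x *m J x)].
Proof.
move=> r'0 rr bz hD; have [hKz _ id] := DD_recenter r'0 rr bz hD.
have rr0 : 0 < r - r' by rewrite subr_gt0.
exists (fun x => K (row_mx z z + row_mx x 0)); split; last 1 first.
- exists (r - r') => // x bx.
  by have := id x 0 bx (box0 (ltW rr0)); rewrite addr0 subr0.
- apply: (anmx_comp (f := fun x : 'rV[R]_d => row_mx x 0) _ _ hKz); last by rewrite row_mx0.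
  by apply: anmap_row_mx; [exact: anmap_id|exact: anmap_cst].
- by rewrite row_mx0 addr0.
Qed.

(* When the gradient of hh is independent of the directions seen by g, the fibre of g through z
   contains an analytic curve with hh strictly increasing. *)
Lemma fiber_increase d n q r r' (g : 'rV[R]_d -> 'rV[R]_n) K (hh : 'rV[R]_d -> 'rV[R]_1) Kh
    (z : 'rV[R]_d) (P : 'M[R]_(n, q)) (S := row_mx (K (row_mx z z) *m P) (Kh (row_mx z z))) :
  0 <= r' -> r' < r -> box r' z -> DD r g K -> DD r hh Kh ->
  (exists2 e : R, 0 < e & forall x : 'rV[R]_d, box e x -> (\rank (K (row_mx (z + x) (z + x))) <= q)%N) ->
  \det (S^T *m S) != 0 ->
  forall e, 0 < e -> exists x, [/\ box e (x - z), g x = g z & hh z 0 0 < hh x 0 0].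
Proof.
move=> r'0 rr bz hg hh' hrk dS e e0.
(* Left inverse of S. Its last row v is a direction invisible to the selected components of g along
   which hh grows at unit rate; its first q rows Y are dual to these components and leave hh
   stationary to first order. *)
pose X := invmx (S^T *m S) *m S^T; have XS : X *m S = 1%:M.
  by rewrite -mulmxA mulVmx // unitmxE unitfE.
pose Y := usubmx X; pose v := dsubmx X.
have [YKP YKh vKP vKh] : [/\ Y *m (K (row_mx z z) *m P) = 1%:M, Y *m Kh (row_mx z z) = 0,
    v *m (K (row_mx z z) *m P) = 0 & v *m Kh (row_mx z z) = 1%:M].
  move: XS; rewrite -[X]vsubmxK mul_col_row scalar_mx_block.
  by move/eq_block_mx => [-> -> -> ->].
have [J [hJ J0 [e1 e10 idJ]]] := dd_curve r'0 rr bz hg.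
have [Jh [hJh Jh0 [e2 e20 idJh]]] := dd_curve r'0 rr bz hh'.
have [_ hgz _] := DD_recenter r'0 rr bz hg.
pose lin (w : 'rV[R]_(1 + q)) := lsubmx w *m v + rsubmx w *m Y.
have hlin : anmap lin.
  by apply: anmap_add; apply: anmap_mulr; [exact: (@anmap_lsubmx R 1 q)|exact: (@anmap_rsubmx R 1 q)].
have lin0 : lin 0 = 0 by rewrite /lin lsubmx0 rsubmx0 !mul0mx addr0.
(* A fixed point theta(s) keeps (g - g z) P at 0 along s v + theta(s) Y. Since Y K P = 1, the linear
   part in theta cancels, which gives the quadratic bound of [ift]. *)
pose Phi w := rsubmx w - (g (z + lin w) - g z) *m P.
have hPhi : anmap Phi.
  apply/anmap_mx; apply: anmx_sub; first by apply/anmap_mx; exact: (@anmap_rsubmx R 1 q).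
  apply: anmx_mul; last exact: anmx_cst.
  apply: anmx_sub; last exact: anmx_cst.
  by apply/anmap_mx; exact: (anmap_comp hlin lin0 hgz).
have [||theta [htheta theta0 eqt]] := ift hPhi.
- by rewrite /Phi lin0 addr0 subrr mul0mx subr0 rsubmx0.
- move=> j k.
  pose y : 'rV[R]_d := delta_mx 0 k *m Y.
  have hy : anmap (fun s : 'rV[R]_1 => s *m y) by apply: anmap_mulr; exact: anmap_id.
  have hphi : an (fun s : 'rV[R]_1 => (Y *m J (s *m y) *m P) k j).
    apply: anmx_mul; last exact: anmx_cst.
    apply: anmx_mul; first exact: anmx_cst.
    by apply: (anmx_comp hy _ hJ); rewrite mul0mx.
  have [L [e3 [e30 hL]]] := an_lipschitz hphi.
  have [e4 e40 h4] := near0_comp hy (mul0mx _ _) (near0_box _ e10).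
  exists L%:R, (Num.min e3 e4); split; first by rewrite lt_min e30.
  move=> t; rewrite le_min => /andP[t3 t4].
  have bt (s : R) : `|t| <= s -> box s (const_mx t : 'rV[R]_1) by move=> h i; rewrite mxE.
  have cy : (const_mx t : 'rV[R]_1) *m y = t *: y by rewrite mulmx1_1 mxE.
  have ty : t *: delta_mx 0 k *m Y = t *: y by rewrite -scalemxAl.
  have E1 : Phi (row_mx 0 (t *: delta_mx 0 k)) 0 j =
      t * ((Y *m J ((0 : 'rV[R]_1) *m y) *m P) k j - (Y *m J ((const_mx t : 'rV[R]_1) *m y) *m P) k j).
    rewrite /Phi /lin row_mxKl row_mxKr mul0mx add0r ty rVB idJ; last first.
      by rewrite -cy; apply: h4; exact: bt.
    rewrite cy mul0mx J0 -[Y *m _ *m P]mulmxA YKP mulrBr; congr (_ - _).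
      by rewrite !mxE eqxx eq_sym.
    rewrite -!scalemxAl [LHS]mxE; congr (_ * _).
    by rewrite /y -!mulmxA -[delta_mx 0 k *m (_ *m (_ *m _))]rowE [LHS]mxE.
  rewrite E1 normrM (_ : L%:R * _ = `|t| * (L%:R * `|t|)); last first.
    by rewrite -(real_normK (num_real t)); ring.
  apply: ler_wpM2l => //; apply: hL => //; [exact/box0/ltW|exact: bt|].
  by rewrite sub0r => i; rewrite !mxE normrN.
have [G [hG [e5 e50 idG]]] := an_dd htheta.
pose v1 (s : 'rV[R]_1) := v + G (row_mx s 0) *m Y.
have hv1 : anmx v1.
  apply: anmx_add; first exact: anmx_cst.
  apply: anmx_mul; last exact: anmx_cst.
  apply: (anmx_comp (f := fun s : 'rV[R]_1 => row_mx s 0) _ _ hG); last by rewrite row_mx0.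
  by apply: anmap_row_mx; [exact: anmap_id|exact: anmap_cst].
pose u (s : 'rV[R]_1) := lin (row_mx s (theta s)).
have hu : anmap u.
  apply: (anmap_comp (q := fun s : 'rV[R]_1 => row_mx s (theta s)) _ _ hlin); last by rewrite theta0 row_mx0.
  by apply: anmap_row_mx; first exact: anmap_id.
have u0 : u 0 = 0 by rewrite /u theta0 row_mx0.
have uE : near0 (fun s : 'rV[R]_1 => u s = s *m v1 s).
  exists e5 => // s bs; rewrite /u /lin row_mxKl row_mxKr.
  have := idG s 0 bs (box0 (ltW e50)); rewrite theta0 !subr0 => ->.
  by rewrite /v1 mulmxDr mulmxA.
(* Along the curve the q selected components are constant by construction, and the rank bound makes
   all of g constant. *)
have hc : near0 (fun s : 'rV[R]_1 => g (z + u s) = g z).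
  apply: (const_along r'0 rr bz hg hrk YKP hu u0).
  apply: near0_imp eqt => s; rewrite /Phi row_mxKr => /eqP.
  by rewrite eq_sym -subr_eq0 addrAC subrr add0r oppr_eq0 => /eqP.
(* At s = 0 the growth rate of hh is v Kh = 1, the correction along Y contributing 0. *)
have hpos : near0 (fun s : 'rV[R]_1 => 0 < (v1 s *m Jh (u s)) 0 0).
  apply: an_gt0.
    by apply: anmx_mul => //; exact: (anmx_comp hu u0 hJh).
  by rewrite u0 Jh0 /v1 mulmxDl vKh -mulmxA YKh mulmx0 addr0 mxE.
have [e6 e60 h6] := near0_and (near0_and hc hpos) uE.
have ee : 0 < Num.min e e2 by rewrite lt_min e0.
have [e7 e70 h7] := near0_comp hu u0 (near0_box _ ee).
pose s : 'rV[R]_1 := const_mx (Num.min e6 e7).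
have s0 : 0 < Num.min e6 e7 by rewrite lt_min e60.
have bs (t : R) : Num.min e6 e7 <= t -> box t s by move=> h i; rewrite mxE gtr0_norm.
have [[c1 c2] c3] : (g (z + u s) = g z /\ 0 < (v1 s *m Jh (u s)) 0 0) /\ u s = s *m v1 s.
  by apply: h6; apply: bs; rewrite ge_min lexx.
have c4 : box (Num.min e e2) (u s) by apply: h7; apply: bs; rewrite ge_min lexx orbT.
exists (z + u s); split=> //.
  by rewrite addrAC subrr add0r; apply: box_le c4 _; rewrite ge_min lexx.
rewrite -subr_gt0 -rVB idJh; last by apply: box_le c4 _; rewrite ge_min lexx orbT.
by rewrite {1}c3 -mulmxA mulmx1_1 !mxE mulr_gt0 //; move: c2; rewrite mxE.
Qed.

End Fiber.

(** * Rank of an analytic map on a cube *)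

Section FullRank.
Context {R : realType}.
Implicit Types (r s del e : R).

(** The base point 0 of the germs is a corner and not the centre: signs are controlled on the
    positive orthant only. *)
Definition cube d del (x : 'rV[R]_d) := forall k, 0 < x 0 k < del.
Definition ccube d del (x : 'rV[R]_d) := forall k, 0 <= x 0 k <= del.

Lemma cubeW d del (x : 'rV[R]_d) : cube del x -> ccube del x.
Proof. by move=> h k; have /andP[/ltW -> /ltW ->] := h k. Qed.

Lemma ccube_box d del (x : 'rV[R]_d) : ccube del x -> box del x.
Proof. by move=> h k; have /andP[x0 xd] := h k; rewrite ger0_norm. Qed.

Lemma cube_open d del (x : 'rV[R]_d) : cube del x ->
  exists2 e : R, 0 < e & forall y, box e (y - x) -> cube del y.
Proof.
move=> cx; have [e e0 he] : exists2 e : R, 0 < e & forall k : 'I_d, e < x 0 k /\ e < del - x 0 k.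
  apply: fin_radius => [k e1 e2 _ e21 [h1 h2]|k]; first by split; apply: le_lt_trans e21 _.
  have /andP[x0 xd] := cx k; exists (Num.min (x 0 k) (del - x 0 k) / 2).
    by rewrite divr_gt0 // lt_min x0 subr_gt0.
  have m0 : 0 < Num.min (x 0 k) (del - x 0 k) by rewrite lt_min x0 subr_gt0.
  by split; (apply: (@lt_le_trans _ _ (Num.min (x 0 k) (del - x 0 k)));
    [rewrite gtr_pMr // invf_lt1 // ltr1n|rewrite ge_min lexx ?orbT]).
exists e => // y hy k; have := hy k; rewrite rVB ler_norml => /andP[h1 h2].
by have [h3 h4] := he k; apply/andP; split; lra.
Qed.

Lemma gram_det p q (S : 'M[R]_(p, q)) : (forall u : 'cV_q, S *m u = 0 -> u = 0) -> \det (S^T *m S) != 0.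
Proof.
move=> h; apply/det0P => -[u u0 hu]; move/eqP: u0; apply.
rewrite -[u]trmxK (h u^T) ?trmx0 //; apply: trmx_inj; rewrite trmx_mul trmxK trmx0.
apply/eqP; rewrite -enorm_eq0 -sqrf_eq0 -mulmxtr_enorm trmx_mul trmxK mulmxA.
by rewrite -[u *m _ *m _]mulmxA hu mul0mx mxE.
Qed.

(** The product p of the x_k (del - x_k) is positive inside the cube and zero on its boundary. If
    its derivative at w0 along v is 0, the factor 1 + x_k, with v_k nonzero, adds the term v_k
    p(w0). *)
Lemma bump d r del (v w0 : 'rV[R]_d) : 0 < r -> cube del w0 -> v != 0 ->
  exists (hh : 'rV[R]_d -> 'rV[R]_1) Kh, [/\ DD r hh Kh, (forall x, cube del x -> 0 < hh x 0 0),
    (forall x, ccube del x -> 0 < hh x 0 0 -> cube del x) & v *m Kh (row_mx w0 w0) != 0].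
Proof.
move=> r0 cw v0; pose p (x : 'rV[R]_d) := \prod_k (x 0 k * (del - x 0 k)).
pose h0 (x : 'rV[R]_d) : 'rV[R]_1 := const_mx (p x).
have bp s : 0 <= s -> bAN s p.
  move=> s0; apply: bAN_prod => // k; apply: bAN_mul => //; first exact: bAN_coord.
  apply: (bAN_eq (bAN_add s0 (bAN_cst _ _ del) (bAN_mul s0 (bAN_cst _ _ (-1)) (bAN_coord _ k)))) => x _.
  by rewrite mulN1r.
have pp x : cube del x -> 0 < p x.
  move=> cx; apply: prodr_gt0 => k _; have /andP[x0 xd] := cx k.
  by rewrite mulr_gt0 // subr_gt0.
have pn x : ccube del x -> p x != 0 -> cube del x.
  move=> cx /prodf_neq0 h k.
  have /andP[x0 xd] := cx k; move: (h k isT); rewrite mulf_eq0 negb_or => /andP[h1 h2].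
  rewrite !lt_neqAle x0 xd eq_sym h1 /= andbT; apply: contraNneq h2 => ->.
  by rewrite subrr.
have [K0 hK0] : exists K0, DD r h0 K0.
  have r4 : 0 < 4 * r by rewrite mulr_gt0.
  have hb (j : 'I_1) : bAN (4 * r) (fun x => h0 x 0 j).
    by apply: (bAN_eq (bp (4 * r) (ltW r4))) => x _; rewrite mxE.
  by have [K hK] := DD_exists r4 hb; exists K; move: hK; rewrite mulrAC mulfV ?mul1r // pnatr_eq0.
have [E|n0] := eqVneq (v *m K0 (row_mx w0 w0)) 0; last first.
  exists h0, K0; split=> // [x /pp|x cx]; first by rewrite mxE.
  by rewrite mxE => /lt0r_neq0; exact: pn.
have [k vk] : exists k, v 0 k != 0.
  apply: contrapT => /forallNP h; move/eqP: v0; apply; apply/rowP => k.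
  by rewrite [RHS]mxE; apply/eqP; have /negP := h k; rewrite negbK.
pose h1 (x : 'rV[R]_d) : 'rV[R]_1 := (1 + x 0 k) *: h0 x.
pose K1 (y : 'rV[R]_(d + d)) := (1 + lsubmx y 0 k) *: K0 y + h0 (rsubmx y) 0 0 *: delta_mx k 0.
have [bK0 id0] := hK0.
exists h1, K1; split.
- split=> [i j|a b ba bb].
    have r0' := ltW r0.
    have hl : bAN r (fun y : 'rV[R]_(d + d) => lsubmx y 0 k).
      by apply: (bAN_eq (bAN_coord r (lshift d k))) => y _; rewrite mxE.
    have hp : bAN r (fun y : 'rV[R]_(d + d) => p (rsubmx y)).
      apply: (bAN_comp r0' (bp r r0')) => l.
      by apply: (AN_eq (AN_coord r (rshift d l))) => y _; rewrite mxE.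
    apply: (bAN_eq (bAN_add r0' (bAN_mul r0' (bAN_add r0' (bAN_cst _ _ 1) hl) (bK0 i j))
      (bAN_mul r0' hp (bAN_cst _ _ (delta_mx k 0 i j))))) => y _.
    by rewrite [RHS]mxE [(_ *: K0 y) i j]mxE [(_ *: delta_mx k 0) i j]mxE [h0 _ 0 0]mxE.
  rewrite /K1 row_mxKl row_mxKr mulmxDr -!scalemxAr -id0 // -colE.
  apply/rowP => j; rewrite !mxE; ring.
- by move=> x cx; rewrite /h1 !mxE mulr_gt0 ?pp // addr_gt0 //; have /andP[] := cx k.
- move=> x cx; rewrite /h1 !mxE => h; apply: pn => //.
  by apply: contraTneq h => ->; rewrite mulr0 ltxx.
rewrite /K1 row_mxKl row_mxKr mulmxDr -!scalemxAr E scaler0 add0r -colE scaler_eq0 negb_or.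
rewrite mxE gt_eqF ?pp //=; apply: contra vk => /eqP/matrixP/(_ 0 0); rewrite !mxE => ->.
exact: eqxx.
Qed.

Lemma nat_ultra : exists2 U : set_system nat, UltraFilter U & \oo `<=` U.
Proof. by have [U [UF h]] := ultraFilterLemma (F := \oo) _; exists U. Qed.

Lemma DD_lip d n r (g : 'rV[R]_d -> 'rV[R]_n) K : 0 <= r -> DD r g K ->
  exists2 L : R, 0 <= L & forall a b D, 0 <= D -> box r a -> box r b -> box D (a - b) -> box (L * D) (g a - g b).
Proof.
move=> r0 [bK id].
have /choice[C hC] (ij : 'I_d * 'I_n) : exists C, AN r (fun w => K w ij.1 ij.2) C by exact: bK.
have C0 ij : 0 <= C ij by exact: AN_ge0 (hC ij).
exists (\sum_j \sum_i C (i, j)); first by do 2! (apply: sumr_ge0 => ? _).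
move=> a b D D0 ba bb bD j; rewrite id // mxE (bigD1 j) //= mulrDl.
apply: le_trans (_ : (\sum_i C (i, j)) * D <= _); last first.
  by rewrite lerDl mulr_ge0 //; do 2! (apply: sumr_ge0 => ? _).
apply: le_trans (ler_norm_sum _ _ _) _; rewrite mulr_suml; apply: ler_sum => i _.
rewrite normrM [X in _ <= X]mulrC; apply: ler_pM => //.
by apply: (AN_bound (hC (i, j))); exact: box_row_mx.
Qed.

Section Limits.
Context {I : Type} (U : set_system I) {UF : UltraFilter U}.

Lemma DD_vlim d n r (g : 'rV[R]_d -> 'rV[R]_n) K (x : I -> 'rV[R]_d) l : 0 <= r -> DD r g K ->
  ae U (fun i => box r (x i)) -> box r l -> vlim U x l -> vlim U (fun i => g (x i)) (g l).
Proof.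
move=> r0 hD bx bl xl; have [L L0 hL] := DD_lip r0 hD; apply: vlimP => e e0.
have e1 : 0 < e / (L + 1) by rewrite divr_gt0 // ltr_wpDl.
apply: ae_imp2 bx (vlim_box (UF := UF) xl e1) => i b1 b2; apply: box_le (hL _ _ _ (ltW e1) b1 bl b2) _.
by rewrite mulrA ler_pdivrMr ?ltr_wpDl // mulrC ler_pM2l // lerDl.
Qed.

Lemma ccube_vlim d del (x : I -> 'rV[R]_d) l : ae U (fun i => ccube del (x i)) -> vlim U x l -> ccube del l.
Proof.
move=> hx xl k; apply/andP; split.
  by apply: ulim_ge (xl k) _; apply: ae_imp hx => i /(_ k)/andP[].
rewrite -lerN2; apply: ulim_ge (ulim_opp (xl k)) _.
by apply: ae_imp hx => i /(_ k)/andP[_]; rewrite lerN2.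
Qed.

Lemma vlim_ex d C (x : I -> 'rV[R]_d) : ae U (fun i => box C (x i)) -> exists l, vlim U x l.
Proof.
move=> hx; have /choice[l hl] k : exists l, ulim U (fun i => x i 0 k) l.
  by apply: (ulim_ex (C := C)); apply: ae_imp hx => i; exact.
by exists (\row_k l k) => k; rewrite mxE.
Qed.
End Limits.

(** Compactness by ultrafilter: a maximising sequence in the closed cube has a limit, which stays in
    the cube and in the fibre. *)
Lemma max_fiber d n r del (g : 'rV[R]_d -> 'rV[R]_n) K (hh : 'rV[R]_d -> 'rV[R]_1) Kh z :
  0 <= del <= r -> DD r g K -> DD r hh Kh -> ccube del z ->
  exists x, [/\ ccube del x, g x = g z & forall y, ccube del y -> g y = g z -> hh y 0 0 <= hh x 0 0].
Proof.
move=> /andP[del0 dr] hg hh' cz; have r0 := le_trans del0 dr.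
have cb x : ccube del x -> box r x by move=> cx; apply: box_le (ccube_box cx) dr.
pose S := [set t : R | exists y, [/\ ccube del y, g y = g z & t = hh y 0 0]].
have [L L0 hL] := DD_lip r0 hh'.
have hS : has_sup S.
  split; first by exists (hh z 0 0), z.
  exists (hh z 0 0 + L * (r + r)) => t [y [cy gy ->]].
  have := hL y z (r + r) (addr_ge0 r0 r0) (cb _ _ cy) (cb _ _ cz) (box_sub (cb _ _ cy) (cb _ _ cz)) 0.
  by rewrite rVB -lerBlDl; apply: le_trans (ler_norm _).
have [U UF hU] := nat_ultra.
have /choice[y hy] (i : nat) : exists y, [/\ ccube del y, g y = g z & sup S - i.+1%:R^-1 < hh y 0 0].
  have i0 : (0 : R) < i.+1%:R^-1 by rewrite invr_gt0.
  by have [t [y [cy gy ->]] h] := sup_adherent i0 hS; exists y.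
have ay : ae U (fun i => ccube del (y i)) by apply: ae_T => i; have [] := hy i.
have by_ : ae U (fun i => box r (y i)) by apply: ae_imp ay => i; exact: cb.
have [x yx] := vlim_ex (UF := UF) by_.
have cx := ccube_vlim (UF := UF) ay yx.
exists x; split=> //.
  apply: (vlim_unique (UF := UF) (DD_vlim (UF := UF) r0 hg by_ (cb _ _ cx) yx)).
  by apply: vlim_eq (vlim_cst _) _; apply: ae_T => i; have [_ ->] := hy i.
move=> w cw gw; apply: le_trans (_ : sup S <= _).
  by apply: (ub_le_sup hS.2); exists w.
rewrite -subr_ge0.
have h1 := ulim_add (ulim_add (DD_vlim (UF := UF) r0 hh' by_ (cb _ _ cx) yx 0) (ulim_eps (R := R) UF hU)) (ulim_cst (UF := UF) (- sup S)).
have := ulim_ge (UF := UF) (a := 0) (h1 UF UF); rewrite addr0; apply; apply: ae_T => i.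
by have [_ _] := hy i; rewrite subr_ge0 -lerBlDr => /ltW.
Qed.

(** The use of resolution: for non-degenerate z, F becomes a monomial times a unit, which is nonzero
    at parameters with positive coordinates. *)
Lemma nondeg_nonzero (I : Type) (U : set_system I) {UF : UltraFilter U} d (z : I -> 'rV[R]_d)
    (F : 'rV[R]_d -> R) : infi U z -> an F -> ~ ger0 F -> ae U (fun i => F (z i) = 0) -> deg U z.
Proof.
move=> hz hF nF h0; apply: contrapT => nz.
have [q [w [[hq q0 hw zw] pw [m [u [hu u0 E]]]]]] := @resolve R I U UF d z F hz nz hF nF.
apply: (ae_contra (UF := UF) (P := fun i => F (z i) = 0) h0).
have h1 := inf_near0 (UF := UF) hw (near0_and E (an_neq0 hu u0)).
apply: ae_imp2 (ae_and (UF := UF) h1 pw) zw => i [[E1 n1] p1] ->; rewrite E1; apply/eqP.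
by rewrite mulf_neq0 // gt_eqF // mon_gt0.
Qed.

(* Either g is an immersion somewhere on the cube, or the points z can be moved along the fibres
   of g onto a proper analytic subset, which lowers the number of parameters. *)
Lemma full_rank_or_deg (I : Type) (U : set_system I) {UF : UltraFilter U} d n r del
    (g : 'rV[R]_d -> 'rV[R]_n) K (z : I -> 'rV[R]_d) : 0 < del < r -> DD r g K ->
  ae U (fun i => cube del (z i)) ->
  (exists2 w, cube del w & \rank (K (row_mx w w)) = d) \/
  exists c zs, [/\ box del c, ae U (fun i => cube del (zs i) /\ g (zs i) = g (z i)),
    infi U (fun i => zs i - c) & deg U (fun i => zs i - c)].
Proof.
move=> /andP[del0 dr] hg az; have [i0 cz0] := ae_ex az.
have r0 := lt_trans del0 dr.
pose Pr k := `[< exists2 w, cube del w & \rank (K (row_mx w w)) = k >].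
have exP : exists k, Pr k by exists (\rank (K (row_mx (z i0) (z i0)))); apply/asboolP; exists (z i0).
have bP k : Pr k -> (k <= d)%N by move=> /asboolP[w _ <-]; exact: rank_leq_row.
(* q is the largest rank of the Jacobian on the open cube, so the rank is at most q around each of
   its points. *)
have [q /asboolP[w0 cw0 rk0] qmax] := ex_maxnP exP bP.
have rkle w : cube del w -> (\rank (K (row_mx w w)) <= q)%N.
  by move=> cw; apply: qmax; apply/asboolP; exists w.
have [qd|qd] := eqVneq q d; first by left; exists w0 => //; apply: etrans rk0 qd.
right; have qd1 : (q < d)%N by rewrite ltn_neqAle qd -rk0 rank_leq_row.
pose K0 := K (row_mx w0 w0).
have [v [v0 vK]] : exists v : 'rV_d, v != 0 /\ v *m K0 = 0.
  have : kermx K0 != 0 by rewrite -mxrank_eq0 mxrank_ker -lt0n rk0 subn_gt0.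
  move/rowV0Pn => [v vk v0]; exists v; split=> //; exact/sub_kermxP.
have [hh [Kh [hh' hpos hcube vKh]]] := bump r0 cw0 v0.
(* K0 P is [col_base K0], of q independent columns: P selects q combinations of the components of g
   that carry the rank at w0. *)
pose P := pinvmx (row_base K0).
have KP : K0 *m P = col_base K0.
  apply: etrans (congr1 (fun M => M *m P) (esym (mulmx_base K0))) _.
  by rewrite -mulmxA mulmxVp ?row_base_free // mulmx1.
pose S w := row_mx (K (row_mx w w) *m P) (Kh (row_mx w w)).
(* F is nonzero exactly where the gradient of hh and the q selected gradients are independent. At a
   maximum of hh on a fibre it must vanish, or [fiber_increase] would give a larger value. *)
pose F w := \det ((S w)^T *m S w).
have [bK _] := hg; have [bKh _] := hh'.
have r0' := ltW r0.
have bd p (M : 'rV[R]_(d + d) -> 'M[R]_(d, p)) : bANmx r M -> bANmx r (fun w => M (row_mx w w)).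
  move=> hM i j; apply: (bAN_comp r0' (hM i j)) => k; case: (split_ordP k) => l ->.
    by apply: (AN_eq (AN_coord r l)) => x _; rewrite row_mxEl.
  by apply: (AN_eq (AN_coord r l)) => x _; rewrite row_mxEr.
have bS : bANmx r S.
  move=> i k; case: (split_ordP k) => l ->.
    apply: (bAN_eq (bANmx_mul r0' (bd _ _ bK) (fun a b => bAN_cst _ _ (P a b)) i l)) => x _.
    by rewrite row_mxEl.
  by apply: (bAN_eq (bd _ _ bKh i l)) => x _; rewrite row_mxEr.
have bF : bAN r F.
  apply: bAN_det => //; apply: bANmx_mul => // i j.
  by apply: (bAN_eq (bS j i)) => x _; rewrite [RHS]mxE.
have F0 : F w0 != 0.
  apply: gram_det => u; rewrite -[u]vsubmxK mul_row_col KP => E.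
  have u2 : dsubmx u = 0.
    have /eqP : v *m (col_base K0 *m usubmx u + Kh (row_mx w0 w0) *m dsubmx u) = 0 by rewrite E mulmx0.
    rewrite -KP mulmxDr !mulmxA vK !mul0mx add0r mulmx1_1 scaler_eq0.
    case/orP => [/eqP h|/eqP//]; case/negP: vKh; apply/eqP/matrixP => a b.
    by rewrite !ord1 h mxE.
  move: E; rewrite u2 mulmx0 addr0 => E; have /row_fullP[B hB] := col_base_full K0.
  have -> : usubmx u = 0 by rewrite -[usubmx u]mul1mx -hB -mulmxA E mulmx0.
  by rewrite col_mx0.
have zsP i : cube del (z i) -> exists x, [/\ cube del x, g x = g (z i) & F x = 0].
  move=> cz; have dd : 0 <= del <= r by rewrite !ltW.
  have [x [cx gx xmax]] := max_fiber dd hg hh' (cubeW cz).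
  (* hh is positive at z i, hence also at the maximum, which [hcube] then places in the open
     cube. *)
  have cux : cube del x.
    by apply: hcube cx _; apply: lt_le_trans (hpos _ cz) (xmax _ (cubeW cz) erefl).
  exists x; split=> //; apply: contrapT => /eqP Fx.
  have [e e0 he] := cube_open cux.
  have rk : exists2 e : R, 0 < e & forall y : 'rV_d, box e y -> (\rank (K (row_mx (x + y) (x + y))) <= \rank K0)%N.
    exists e => // y ye; rewrite [X in (_ <= X)%N]rk0; apply/rkle/he; by rewrite addrAC subrr add0r.
  have [y [ye gy]] := fiber_increase (ltW del0) dr (ccube_box cx) hg hh' rk Fx e0.
  rewrite ltNge => /negP; apply; apply: xmax; last by rewrite gy.
  exact/cubeW/he.
have /choice[zs hzs] i : exists x, cube del (z i) -> [/\ cube del x, g x = g (z i) & F x = 0].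
  have [/zsP[x hx]|nc] := pselect (cube del (z i)); first by exists x.
  by exists 0 => /nc.
have azs : ae U (fun i => [/\ cube del (zs i), g (zs i) = g (z i) & F (zs i) = 0]).
  by apply: ae_imp az => i /hzs.
have bzs : ae U (fun i => box del (zs i)) by apply: ae_imp azs => i [/cubeW/ccube_box].
have [c hc] := vlim_ex (UF := UF) bzs.
have cc : ccube del c by apply: (ccube_vlim (UF := UF) _ hc); apply: ae_imp azs => i [/cubeW].
have bc := ccube_box cc.
have ic : infi U (fun i => zs i - c) by move=> e e0; exact: (vlim_box (UF := UF) hc e0).
exists c, zs; split=> //; first by apply: ae_imp azs => i [].
apply: (@nondeg_nonzero I U UF d _ (fun x => F (c + x))) => //.
- exact: (bAN_an (ltW del0) dr bF bc).
(* A zero germ at c would make F vanish on the whole polydisc, and so at w0. *)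
- move=> [e e0 h]; case/eqP: F0; have [C hC] := bF.
  apply: (@AN_ident R d r F C c e r0 hC e0).
  + by move=> k; apply: le_lt_trans (bc k) dr.
  + by move=> x bx; rewrite -[x](subrK c) addrC; exact: h.
  + by move=> k; apply: le_lt_trans (ccube_box (cubeW cw0) k) dr.
by apply: ae_imp azs => i [_ _]; rewrite addrC subrK.
Qed.

End FullRank.

(** * Analytic charts in a given direction *)

Section Cone.
Context {R : realType}.
Implicit Types (r s C D e eta : R).

Definition dotp n (x y : 'rV[R]_n) : R := \sum_k x 0 k * y 0 k.

(* Quadratic form of the condition that x - p is nearly parallel to a, hence polynomial in x. *)
Definition pcone n (p a : 'rV[R]_n) eta (x : 'rV[R]_n) :=
  0 < dotp (x - p) a /\ 0 < dotp (x - p) a ^+ 2 - (1 - eta) * dotp (x - p) (x - p).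

Lemma dotpE n (x : 'rV[R]_n) : dotp x x = enorm x ^+ 2.
Proof. by rewrite enorm_sqr; apply: eq_bigr => k _; rewrite expr2. Qed.

Lemma dotpZ n t (x y : 'rV[R]_n) : dotp (t *: x) y = t * dotp x y.
Proof. by rewrite mulr_sumr; apply: eq_bigr => k _; rewrite mxE mulrA. Qed.

Lemma dotpB n (x y : 'rV[R]_n) : dotp (x - y) (x - y) = dotp x x - 2 * dotp x y + dotp y y.
Proof.
rewrite mulr_sumr -sumrB -big_split; apply: eq_bigr => k _; rewrite /= rVB; ring.
Qed.

Lemma pcone_eq n (p a : 'rV[R]_n) eta x (t := dotp (unitv (x - p)) a) : x != p ->
  pcone p a eta x <-> 0 < t /\ 1 - eta < t ^+ 2.
Proof.
move=> xp; have y0 : x - p != 0 by rewrite subr_eq0.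
have N0 := enorm_gt0 y0.
have E : dotp (x - p) a = enorm (x - p) * t by rewrite -dotpZ unitvK.
rewrite /pcone E dotpE exprMn pmulr_rgt0 // [(1 - eta) * _]mulrC -mulrBr pmulr_rgt0 ?exprn_gt0 //.
by rewrite subr_gt0.
Qed.

Lemma pcone_neq n (p a : 'rV[R]_n) eta x : pcone p a eta x -> x != p.
Proof.
case=> h _; apply: contraTneq h => ->; rewrite subrr /dotp big1 ?ltxx // => k _.
by rewrite mxE mul0r.
Qed.

Lemma pcone_near n (p a : 'rV[R]_n) eta x : 0 < eta -> enorm a = 1 -> pcone p a eta x ->
  enorm (unitv (x - p) - a) ^+ 2 <= 2 * eta.
Proof.
move=> eta0 ua h; have xp := pcone_neq h; move/(pcone_eq a eta xp): h => [t0 t1].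
rewrite -dotpE dotpB !dotpE ua enorm_unitv ?subr_eq0 // !expr1n; move: t0 t1.
set t := dotp _ _ => t0 t1; nra.
Qed.

Lemma an_dotp n k (f g : 'rV[R]_k -> 'rV[R]_n) : anmap f -> anmap g -> an (fun x => dotp (f x) (g x)).
Proof. by move=> hf hg; apply: an_sum => i; exact: an_mul. Qed.

Lemma an_pcone n k (p a : 'rV[R]_n) eta (f : 'rV[R]_k -> 'rV[R]_n) : anmap f ->
  an (fun x => dotp (f x - p) a) /\
  an (fun x => dotp (f x - p) a ^+ 2 - (1 - eta) * dotp (f x - p) (f x - p)).
Proof.
move=> hf; have hfp : anmap (fun x => f x - p) by apply: anmap_add; [|exact: anmap_cst].
have h1 := an_dotp hfp (@anmap_cst R k n a); split=> //; apply: an_sub; first exact: an_exp.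
by apply: an_mul; [exact: an_cst|exact: an_dotp].
Qed.

Lemma pcone_open n (p a : 'rV[R]_n) eta x : pcone p a eta x ->
  exists2 e : R, 0 < e & forall y, box e (y - x) -> pcone p a eta y.
Proof.
move=> [h1 h2]; have ht : anmap (fun w : 'rV[R]_n => x + w) by apply: anmap_add; [exact: anmap_cst|exact: anmap_id].
have [a1 a2] := an_pcone p a eta ht.
have b1 : near0 (fun w => 0 < dotp (x + w - p) a) by apply: an_gt0 a1 _; rewrite addr0.
have b2 : near0 (fun w => 0 < dotp (x + w - p) a ^+ 2 - (1 - eta) * dotp (x + w - p) (x + w - p)).
  by apply: an_gt0 a2 _; rewrite addr0.
have [e e0 he] := near0_and b1 b2.
by exists e => // y /he; rewrite [x + _]addrC subrK.
Qed.

Lemma ulim_dotp (I : Type) (U : set_system I) {UF : UltraFilter U} n (x y : I -> 'rV[R]_n) l m :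
  vlim U x l -> vlim U y m -> ulim U (fun i => dotp (x i) (y i)) (dotp l m).
Proof. by move=> hx hy; apply: ulim_sum => k; exact: ulim_mul (hx k) (hy k). Qed.

Lemma direction_pcone n (A : set 'rV[R]_n) p a eta e : direction_set A p a -> 0 < eta -> 0 < e ->
  exists x, [/\ A x, box e (x - p) & pcone p a eta x].
Proof.
move=> hd eta0 e0; have [ua _] := hd; have [U UF hU] := nat_ultra.
have [x [Ax xp xl xa]] := direction_seq UF hU hd.
have := ulim_dotp (UF := UF) xa (vlim_cst (UF := UF) a); rewrite dotpE ua expr1n => ht.
pose D : R := Num.min (2^-1) (eta / 4).
have D0 : 0 < D by rewrite lt_min invr_gt0 ltr0n divr_gt0.
have [i [b1 b2]] := ae_ex (ae_and (vlim_box (UF := UF) xl e0) (ht _ D0)).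
exists (x i); split=> //; apply/pcone_eq => //; move: b2; set t := dotp _ _.
have [d1 d2] : D <= 2^-1 /\ D <= eta / 4 by rewrite /D !ge_min !lexx orbT.
move: (D) D0 d1 d2 => D' D0 d1 d2; rewrite ler_norml => /andP[b2 b3].
have t1 : 1 - D' <= t by lra.
split; first lra.
have : (1 - D') ^+ 2 <= t ^+ 2 by rewrite ler_sqr ?nnegrE //; lra.
by move=> h; apply: lt_le_trans h; nra.
Qed.

(** The filter of points of A near p, inside the cone and off a thin set, is proper: the cone is
    open, and around any of its points in A there is a submanifold of dimension at least m, which no
    thin set covers. *)
Lemma cone_ultra n m (A : set 'rV[R]_n) p a eta : (0 < m)%N -> 0 < eta -> direction_set A p a ->
  (exists2 e0 : R, 0 < e0 & forall x, A x -> box e0 (x - p) -> forall e : R, 0 < e ->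
    exists2 k, (m <= k)%N & contains_submanifold (A `&` eball x e) k) ->
  exists2 U : set_system 'rV[R]_n, UltraFilter U &
    [/\ ae U A, ae U (pcone p a eta), vlim U id p & forall T, thin m T -> ae U (fun x => ~ T x)].
Proof.
move=> m0 eta0 hd [e0 e00 hA].
pose G : set_system 'rV[R]_n := [set E | exists e T, [/\ 0 < e, thin m T &
  forall x, A x -> box e (x - p) -> pcone p a eta x -> ~ T x -> E x]].
have GF : ProperFilter G.
  apply: Build_ProperFilter_ex.
    move=> E [e [T [ep hT hE]]]; have ee : 0 < Num.min e e0 / 2 by rewrite divr_gt0 // lt_min ep.
    have [x [Ax bx cx]] := direction_pcone hd eta0 ee.
    have ee' : Num.min e e0 / 2 <= e0 by have := ee; rewrite ler_pdivrMr // => _; rewrite ge_min; apply/orP; right; lra.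
    have [e1 e10 he1] := pcone_open cx.
    have ee1 : 0 < Num.min e1 (Num.min e e0 / 2) by rewrite lt_min e10.
    have [k mk [M [M0 MA hM]]] := hA x Ax (box_le bx ee') _ ee1.
    apply: contrapT => /forallNP hn.
    apply: (@submanifold_not_thin R n m k M _ M0 hM); first by rewrite m0.
    apply: thinS hT => y My; have [Ay yx] := MA y My.
    have yx' (s : R) : Num.min e1 (Num.min e e0 / 2) <= s -> box s (y - x).
      by move=> h j; apply: le_trans (enorm_coord _ _) _; apply: le_trans (ltW yx) h.
    apply: contrapT => nT; apply: (hn y); apply: hE => //.
      have := box_sub (yx' (Num.min e e0 / 2) _) (_ : box (Num.min e e0 / 2) (p - x)).
      rewrite opprB addrA subrK -splitr => h; apply: box_le (h _ _) _; rewrite ?ge_min ?lexx ?orbT //.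
      by move=> j; rewrite rVB distrC -rVB.
    by apply: he1; apply: yx'; rewrite ge_min lexx.
  split.
  - by exists 1, set0; split=> //; exact: thin0.
  - move=> E F [e [T [e_0 hT hE]]] [e' [T' [e'0 hT' hF]]].
    exists (Num.min e e'), (T `|` T'); split; [by rewrite lt_min e_0|exact: thinU|].
    move=> x Ax bx cx nT; split.
      by apply: hE => //; [apply: box_le bx _; rewrite ge_min lexx|move=> Tx; apply: nT; left].
    by apply: hF => //; [apply: box_le bx _; rewrite ge_min lexx orbT|move=> Tx; apply: nT; right].
  - move=> E F EF [e [T [e_0 hT hE]]]; exists e, T; split=> // x Ax bx cx nT.
    exact/EF/hE.
have [U [UF GU]] := ultraFilterLemma GF; exists U => //; split.
- by apply: GU; exists 1, set0; split=> //; exact: thin0.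
- by apply: GU; exists 1, set0; split=> //; exact: thin0.
- by apply: vlimP => e ep; apply: GU; exists e, set0; split=> //; exact: thin0.
- by move=> T hT; apply: GU; exists 1, T; split.
Qed.
End Cone.

(** * Analytic pieces of a subanalytic set *)

Section Chart.
Context {R : realType}.
Implicit Types (r s C D e eta : R).

Lemma anmap_near n k (q : 'rV[R]_n -> 'rV[R]_k) e : anmap q -> 0 < e -> near0 (fun x => box e (q x - q 0)).
Proof.
move=> hq e0; have := near0_all (fun j => an_cont (hq j) e0).
by apply: near0_imp => x h j; rewrite rVB; exact: ltW (h j).
Qed.

Lemma open_near0 n k (q : 'rV[R]_n -> 'rV[R]_k) (V : set 'rV[R]_k) : anmap q -> open V -> V (q 0) ->
  near0 (fun x => V (q x)).
Proof.
move=> hq oV Vq; have /nbhs_ballP[e /= e0 eV] : nbhs (q 0) V by exact: open_nbhs_nbhs.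
have e2 : 0 < e / 2 by rewrite divr_gt0.
apply: near0_imp (anmap_near hq e2) => x bx; apply: eV; apply/(ball_rV _ _ e0) => j.
by have := bx j; rewrite rVB distrC; move: (`|_|) => t; lra.
Qed.

(** On the positive orthant near 0 the sign is that of the unit at 0, and it can be read off along
    U. *)
Lemma mono_pos (I : Type) (U : set_system I) {UF : UltraFilter U} d (w : I -> 'rV[R]_d)
    (F : 'rV[R]_d -> R) : infi U w -> pos U w -> mono F -> ae U (fun i => 0 < F (w i)) ->
  near0 (fun x => (forall k, 0 < x 0 k) -> 0 < F x).
Proof.
move=> hw pw [m [u [hu u0 E]]] hF.
have u1 : 0 < u 0.
  rewrite lt_neqAle eq_sym u0 leNgt /=; apply/negP => un.
  have un' : near0 (fun x => 0 < - u x) by apply: an_gt0; [exact: an_opp|rewrite oppr_gt0].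
  have [i [[E1 n1] [p1 F1]]] := ae_ex (ae_and (inf_near0 (UF := UF) hw (near0_and E un')) (ae_and pw hF)).
  by have := mulr_gt0 (mon_gt0 m p1) n1; move: F1; rewrite E1 mulrN oppr_gt0 => /lt_gtF ->.
apply: near0_imp2 E (an_gt0 hu u1) => x -> h p1; apply: mulr_gt0 => //; exact: mon_gt0.
Qed.

Section Rep.
Variables (n k : nat) (U : set_system 'rV[R]_n) (UF : UltraFilter U) (B : set 'rV[R]_(n + k)).

(* Almost every x is the projection of a point of B on an analytic piece in d variables. *)
Definition rep d (sg : 'rV[R]_d -> 'rV[R]_(n + k)) (z : 'rV[R]_n -> 'rV[R]_d) :=
  [/\ anmap sg, infi U z & ae U (fun x => B (sg (z x)) /\ lsubmx (sg (z x)) = x)].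

(** Relative compactness gives the lifts a limit b along U; translation by b is a first piece, in n
    + k variables. *)
Lemma rep_exists : compact (closure B) -> ae U (@lsubmx R 1 n k @` B) ->
  exists sg z, @rep (n + k) sg z.
Proof.
move=> cB hB.
have /choice[y hy] x : exists y : 'rV[R]_(n + k), (@lsubmx R 1 n k @` B) x -> B y /\ lsubmx y = x.
  have [[y By yx]|nB] := pselect ((@lsubmx R 1 n k @` B) x); first by exists y.
  by exists 0 => /nB.
have [C hC] : exists C, forall y, B y -> box C y.
  have [M [_ hM]] := compact_bounded cB; exists (M + 1) => v Bv j.
  have := hM (M + 1) _ v (subset_closure Bv); rewrite ltrDl ltr01 => /(_ isT).
  by apply: le_trans; rewrite [leRHS]/Num.Def.normr /= mx_normrE; apply/bigmax_geP; right; exists (0, j).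
have [b hb] : exists b, vlim U y b.
  by apply: (vlim_ex (C := C) (UF := UF)); apply: ae_imp hB => x /hy[/hC].
exists (fun w => b + w), (fun x => y x - b); split.
- by apply: anmap_add; [exact: anmap_cst|exact: anmap_id].
- by move=> e e0; exact: (vlim_box (UF := UF) hb e0).
- by apply: ae_imp hB => x /hy; rewrite addrC subrK.
Qed.

Variable (d : nat).
Hypothesis dmin : forall d' sg z, @rep d' sg z -> (d <= d')%N.

Lemma rep_nondeg sg z : @rep d sg z -> ~ deg U z.
Proof.
move=> [hs hz hB] [d' [q [w [dd hq q0 hw zw]]]].
suff /dmin : rep (fun x => sg (q x)) w by rewrite leqNgt dd.
by split=> //; [exact: anmap_comp|apply: ae_imp2 hB zw => x + E; rewrite E].
Qed.

(** After resolution the equations of B hold identically and the inequalities, together with the two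
    defining the cone, hold on the whole positive orthant near 0 and not just along U. *)
Lemma rep_orthant p a eta sg z : semianalytic B -> ae U (pcone p a eta) -> @rep d sg z ->
  exists sg' w, [/\ @rep d sg' w, pos U w &
    near0 (fun x => (forall j, 0 < x 0 j) -> B (sg' x) /\ pcone p a eta (lsubmx (sg' x)))].
Proof.
move=> sB hcone hrep; have nz := rep_nondeg hrep; have [hs hz hB] := hrep.
have [V [oV Vb [pp [qq [f [sn [hf hV]]]]]]] := sB (sg 0).
have Vz := inf_near0 (UF := UF) hz (open_near0 hs oV Vb).
(* The ultrafilter selects one of the finitely many basic sets that describe B near sg 0. *)
have [i hi] : exists i, ae U (fun x => forall j, if sn i j then f i j (sg (z x)) = 0 else 0 < f i j (sg (z x))).
  by apply: (ae_exfin (UF := UF)); apply: ae_imp2 Vz hB => x /hV h [/h].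
pose c1 w := dotp (lsubmx (sg w) - p) a.
pose c2 w := c1 w ^+ 2 - (1 - eta) * dotp (lsubmx (sg w) - p) (lsubmx (sg w) - p).
have hls : anmap (fun w => lsubmx (sg w)).
  by move=> j; apply: (an_ext (hs (lshift k j))) => w; rewrite mxE.
have [ac1 ac2] := an_pcone p a eta hls.
pose F (j : option (option 'I_qq)) := match j with
  None => c1 | Some None => c2 | Some (Some j) => fun w => f i j (sg w) end.
pose P (j : option (option 'I_qq)) := if j is Some (Some j) then ~~ sn i j else true.
have aF j : an (F j).
  case: j => [[j|]|] //=.
  have hsg : anmap (fun w => sg w - sg 0) by apply: anmap_add; [exact: hs|exact: anmap_cst].
  apply: (an_ext (an_comp hsg (subrr _) (analytic_at_an (hf i j _ Vb)))) => w.
  by rewrite addrC subrK.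
have Fpos j : P j -> ae U (fun x => 0 < F j (z x)).
  case: j => [[j|]|] /= Pj.
  - by apply: ae_imp hi => x /(_ j); rewrite (negbTE Pj).
  - by apply: ae_imp2 hcone hB => x [_ h] [_ E]; rewrite /c2 /c1 E.
  - by apply: ae_imp2 hcone hB => x [h _] [_ E]; rewrite /c1 E.
have nF j : P j -> ~ ger0 (F j).
  move=> /Fpos h1 /(inf_near0 (UF := UF) hz) h2.
  by have [x [h3 h4]] := ae_ex (ae_and h1 h2); move: h3; rewrite h4 ltxx.
(* A nonzero germ vanishing along U would make z degenerate, against the minimality of d. *)
have Fzero j : sn i j -> ger0 (F (Some (Some j))).
  move=> Pj; apply: contrapT => h; apply: nz.
  apply: (nondeg_nonzero (UF := UF) hz (aF _) h).
  by apply: ae_imp hi => x /(_ j); rewrite Pj.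
have [|q [w [[hq q0 hw zw] pw hm]]] := resolve_seq (s := [seq j <- enum {: option (option 'I_qq)} | P j])
    (resolve (UF := UF) (n := d)) hz nz aF.
  by move=> j; rewrite mem_filter => /andP[/nF].
exists (fun x => sg (q x)), w; split=> //.
  by split=> //; [exact: anmap_comp|apply: ae_imp2 hB zw => x + E; rewrite E].
have h1 j : P j -> near0 (fun x => (forall k, 0 < x 0 k) -> 0 < F j (q x)).
  move=> Pj; apply: (mono_pos (UF := UF) hw pw).
    by apply: hm; rewrite mem_filter Pj mem_enum.
  by apply: ae_imp2 (Fpos _ Pj) zw => x + E; rewrite E.
have h2 : near0 (fun x => forall j, if sn i j then f i j (sg (q x)) = 0 else
    (forall k, 0 < x 0 k) -> 0 < f i j (sg (q x))).
  apply: near0_all => j; case E: (sn i j); first exact: (near0_comp hq q0 (Fzero j E)).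
  by apply: (h1 (Some (Some j))); rewrite /= E.
have h3 := near0_comp hq q0 (open_near0 hs oV Vb).
apply: near0_imp2 (near0_and h2 h3) (near0_and (h1 None isT) (h1 (Some None) isT)) => x [g1 g2] [g3 g4] px.
split; last by split; [exact: g3|exact: g4].
apply/hV => //; exists i => j; have := g1 j; case: (sn i j) => //; exact.
Qed.

End Rep.
End Chart.

Section ChartExists.
Context {R : realType}.
Implicit Types (r s C D e eta del : R).

Lemma open_ae n (U : set_system 'rV[R]_n) {UF : UltraFilter U} (V : set 'rV[R]_n) p : open V -> V p ->
  vlim U id p -> ae U V.
Proof.
move=> oV Vp hp; have ht : anmap (fun w : 'rV[R]_n => p + w).
  by apply: anmap_add; [exact: anmap_cst|exact: anmap_id].
have hV : near0 (fun w : 'rV[R]_n => V (p + w)) by apply: (open_near0 ht oV); rewrite addr0.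
have [e e0 he] := hV; apply: ae_imp (vlim_box (UF := UF) hp e0) => x /he.
by rewrite addrC subrK.
Qed.

Lemma cube_ae (I : Type) (U : set_system I) {UF : UltraFilter U} d del (w : I -> 'rV[R]_d) :
  infi U w -> pos U w -> 0 < del -> ae U (fun i => cube del (w i)).
Proof.
move=> hw pw del0; have d2 : 0 < del / 2 by rewrite divr_gt0.
apply: ae_imp2 pw (hw _ d2) => i h1 h2 k; have := h1 k; have := h2 k => h3 h4; rewrite h4 /=.
by have := ler_norm (w i 0 k); lra.
Qed.

Definition chart_at n (A : set 'rV[R]_n) p a eta d r del (g : 'rV[R]_d -> 'rV[R]_n) K w0 :=
  [/\ 0 < del < r, DD r g K & g 0 = p] /\
  [/\ cube del w0, \rank (K (row_mx w0 w0)) = d & forall x, cube del x -> A (g x) /\ pcone p a eta (g x)].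

Theorem chart n m (A : set 'rV[R]_n) p a eta : (0 < m)%N -> 0 < eta -> subanalytic A -> direction_set A p a ->
  (exists2 e0 : R, 0 < e0 & forall x, A x -> box e0 (x - p) -> forall e : R, 0 < e ->
    exists2 k, (m <= k)%N & contains_submanifold (A `&` eball x e) k) ->
  exists d r del (g : 'rV[R]_d -> 'rV[R]_n) K w0, (m <= d)%N /\ chart_at A p a eta r del g K w0.
Proof.
move=> m0 eta0 sA hd hA.
have [U UF [UA Uc Up Ut]] := cone_ultra m0 eta0 hd hA.
have [V [oV Vp [k [B [sB cB AB]]]]] := sA p.
have UB : ae U (@lsubmx R 1 n k @` B).
  by rewrite -AB; apply: ae_imp2 UA (open_ae (UF := UF) oV Vp Up).
(* d is the least number of variables among all pieces carrying lifts of almost every x. *)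
pose Pd d := `[< exists sg z, @rep R n k U B d sg z >].
have exP : exists d, Pd d by exists (n + k)%N; apply/asboolP; exact: (rep_exists UF cB UB).
have [d /asboolP[sg0 [z0 hrep0]] dmin'] := ex_minnP exP.
have dmin d' sg z : @rep R n k U B d' sg z -> (d <= d')%N.
  by move=> h; apply: dmin'; apply/asboolP; exists sg, z.
have [sg [w [hrep pw [e1 e10 he1]]]] := rep_orthant UF dmin sB Uc hrep0.
have [hs hw hB] := hrep; pose g x := lsubmx (sg x) : 'rV[R]_n.
have [r1 r10 hr1] : exists2 r : R, 0 < r & forall j, bAN r (fun x => sg x 0 j).
  apply: fin_radius => [j e e' /ltW e'0 ee'|j]; first exact: bAN_radius.
  by have [r [C [r0 h]]] := hs j; exists r => //; exists C.
have bg j : bAN r1 (fun x => g x 0 j) by apply: (bAN_eq (hr1 (lshift k j))) => x _; rewrite mxE.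
have [K hK] := DD_exists r10 bg; pose r := r1 / 4.
have r0 : 0 < r by rewrite divr_gt0.
have hg : anmap g by move=> j; have [C hC] := bg j; exact: an_AN hC.
have [L [e2 [e20 hL]]] := anmap_lipschitz hg.
(* The bounds are, in order: validity of the orthant statement, the Lipschitz bound of g, room
   inside the domain of g, and a cube within [0, 1) as [thin_image] asks. *)
pose del := Num.min (Num.min e1 e2) (Num.min (r / 2) (2^-1)).
have del0 : 0 < del by rewrite !lt_min e10 e20 divr_gt0 // invr_gt0 ltr0n.
have d1 : del <= e1 by rewrite /del !ge_min lexx.
have d2 : del <= e2 by rewrite /del !ge_min lexx orbT.
have d3 : del < r.
  by apply: le_lt_trans (_ : r / 2 < r); [rewrite /del !ge_min lexx !orbT|rewrite ltr_pdivrMr // mulr_natr mulr2n ltrDl].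
have d4 : del < 1.
  by apply: le_lt_trans (_ : 2^-1 < 1); [rewrite /del !ge_min lexx !orbT|rewrite invf_lt1 ?ltr1n].
have cB' x : cube del x -> B (sg x) /\ pcone p a eta (g x).
  move=> cx; apply: he1; first exact: box_le (ccube_box (cubeW cx)) d1.
  by move=> j; have /andP[] := cx j.
have cA x : cube del x -> A (g x) /\ pcone p a eta (g x).
  move=> /cB'[Bx cx]; split=> //; have : (A `&` V) (g x) by rewrite AB; exists (sg x).
  by case.
have cw := cube_ae (UF := UF) hw pw del0.
have g0 : g 0 = p.
  apply: (vlim_unique (UF := UF) _ Up); apply: (vlimP (UF := UF)) => e e0.
  apply: ae_imp2 hB (inf_near0 (UF := UF) hw (anmap_near hg e0)) => x [_ E].
  by rewrite /g E.
have dr : 0 < del < r by rewrite del0.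
(* For d < m the image of the cube would be thin, but U avoids thin sets while almost every x is in
   that image. *)
have md : (m <= d)%N.
  rewrite leqNgt; apply/negP => dm.
  have thg : thin m (g @` [set x | cube del x]).
    apply: (thin_image (L := L) dm) => [x i /(_ i)/andP[x0 xd]|x y s cx cy s0 bs].
      by rewrite ltW //= (lt_trans xd).
    apply: hL => //; [exact: box_le (ccube_box (cubeW cx)) d2|exact: box_le (ccube_box (cubeW cy)) d2].
  have := ae_and (UF := UF) (Ut _ thg) (ae_and (UF := UF) cw hB).
  by case/(ae_ex (UF := UF)) => x [nT [cx [_ E]]]; apply: nT; exists (w x).
have [[w0 cw0 rk]|[c [zs [bc hzs iz [d' [q [v [dd hq q0 hv zv]]]]]]]] := full_rank_or_deg (UF := UF) dr hK cw.
  by exists d, r, del, g, K, w0.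
(* Moving along the fibres of g does not change x, and the cube is mapped into B, so the moved
   points still lift x to B; being degenerate, they yield a piece in d' < d variables. *)
suff : (d <= d')%N by rewrite leqNgt dd.
apply: (dmin d' (fun x => sg (c + q x)) v); split=> //.
- have dr1 : del < r1 by apply: lt_trans d3 _; rewrite /r; lra.
  have hsc : anmap (fun x => sg (c + x)) by move=> j; exact: (bAN_an (ltW del0) dr1 (hr1 j) bc).
  exact: (anmap_comp hq q0 hsc).
- apply: ae_imp2 (ae_and (UF := UF) hzs hB) zv => x [[cz gz] [_ E]] zE.
  rewrite -zE addrC subrK; split; first by have [] := cB' _ cz.
  by move: gz; rewrite /g E.
Qed.
End ChartExists.

(** * Velocity and rank along a ray of a chart *)

Section Ray.
Context {R : realType}.
Implicit Types (r C D e eta del : R).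

(** A vector of the image of the Jacobian is the limit of rescaled secants of g on a segment from w,
    which stays in the open cube. *)
Lemma tangent_directions d n (A : set 'rV[R]_n) r del (g : 'rV[R]_d -> 'rV[R]_n) K w y : 0 < del < r -> DD r g K ->
  (forall x, cube del x -> A (g x)) -> cube del w -> (y <= K (row_mx w w))%MS -> y != 0 ->
  direction_set A (g w) (unitv y).
Proof.
move=> /andP[del0 dr] hg hA cw /submxP[x hx] y0; have [U UF hU] := nat_ultra.
have [J [hJ J0 hid]] := dd_curve (ltW del0) dr (ccube_box (cubeW cw)) hg.
pose h i : 'rV[R]_d := i.+1%:R^-1 *: x.
have hl : infi U h.
  move=> e e0; have := vlim_scale (UF := UF) (ulim_eps (R := R) UF hU) (vlim_cst (UF := UF) x).
  by rewrite scale0r => /(vlim_box (UF := UF))/(_ e0); apply: ae_imp => i; rewrite subr0.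
apply: (@direction_tangent R nat U UF n A (g w) y (fun i => g (w + h i)) (fun i => i.+1%:R^-1) y0).
- have [e e0 he] := cube_open cw; apply: ae_imp (hl e e0) => i bi; apply/hA/he.
  by rewrite addrAC subrr add0r.
- by apply: ae_T => i; rewrite invr_gt0.
- exact: (ulim_eps UF hU).
apply: (vlimP (UF := UF)) => e e0.
have hxJ : anmap (fun v => x *m J v) by apply/anmap_mx; apply: anmx_mul => //; exact: anmx_cst.
apply: ae_imp2 (inf_near0 (UF := UF) hl hid) (inf_near0 (UF := UF) hl (anmap_near hxJ e0)) => i -> .
by rewrite J0 -hx -scalemxAl scalerA mulVf ?scale1r // gt_eqF.
Qed.

Lemma order1 (f : 'rV[R]_1 -> R) : an f -> ~ ger0 f ->
  exists k u, [/\ an u, u 0 != 0 & near0 (fun x => f x = x 0 0 ^+ k * u x)].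
Proof.
move=> [r [C [r0 hf]]] nf; have [h|[k [u [hu u0 E]]]] := AN_order1 r0 hf.
  exfalso; apply: nf; have r2 : 0 < r / 2 by rewrite divr_gt0.
  exists (r / 2) => // x bx; apply: h; apply: le_lt_trans (bx 0) _.
  by rewrite ltr_pdivrMr // mulr_natr mulr2n ltrDl.
by exists k, u; split=> //; [exact: an_AN hu|exists r].
Qed.

(** The power taken out is the least order among the components that are not identically zero. *)
Lemma vec_order1 n (f : 'rV[R]_1 -> 'rV[R]_n) : anmap f -> ~ near0 (fun s : 'rV[R]_1 => f s = 0) ->
  exists k P, [/\ anmap P, P 0 != 0 & near0 (fun s : 'rV[R]_1 => f s = s 0 0 ^+ k *: P s)].
Proof.
move=> hf nf.
pose Z j := ger0 (fun s : 'rV[R]_1 => f s 0 j).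
have /choice[k hk] j : exists k : nat, ~ Z j ->
    exists u, [/\ an u, u 0 != 0 & near0 (fun x : 'rV[R]_1 => f x 0 j = x 0 0 ^+ k * u x)].
  have [Zj|nZ] := pselect (Z j); first by exists 0%N.
  by have [k hk] := order1 (hf j) nZ; exists k.
have /choice[u hu] j : exists u : 'rV[R]_1 -> R, ~ Z j ->
    [/\ an u, u 0 != 0 & near0 (fun x : 'rV[R]_1 => f x 0 j = x 0 0 ^+ (k j) * u x)].
  have [Zj|nZ] := pselect (Z j); first by exists (fun=> 0).
  by have [u h] := hk j nZ; exists u.
have [|l /asboolP[j0 nZ0 kl] lmin] := @ex_minnP (fun l => `[< exists2 j, ~ Z j & k j = l >]).
  apply: contrapT => /forallNP h; apply: nf.
  have : near0 (fun s : 'rV[R]_1 => forall j, f s 0 j = 0).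
    apply: near0_all => j; apply: contrapT => nZ; apply: (h (k j)); apply/asboolP.
    by exists j.
  by apply: near0_imp => s hs; apply/rowP => j; rewrite hs mxE.
pose P (s : 'rV[R]_1) := \row_j if `[< Z j >] then 0 else s 0 0 ^+ (k j - l) * u j s.
have hPj j : ~ Z j -> forall s : 'rV[R]_1, P s 0 j = s 0 0 ^+ (k j - l) * u j s.
  by move=> /asboolPn/negbTE h s; rewrite mxE h.
have hP0 j : Z j -> forall s : 'rV[R]_1, P s 0 j = 0 by move=> /asboolP h s; rewrite mxE h.
exists l, P; split.
- move=> j; have [Zj|nZ] := pselect (Z j).
    by apply: (an_ext (an_cst 1 0)) => s; rewrite hP0.
  have [hu1 _ _] := hu j nZ.
  by apply: (an_ext (an_mul (an_exp (k j - l) (an_coord 0)) hu1)) => s; rewrite hPj.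
- apply/eqP => /rowP/(_ j0); rewrite hPj // [RHS]mxE kl subnn expr0 mul1r => /eqP.
  by have [_ /negbTE -> _] := hu j0 nZ0.
have : near0 (fun s : 'rV[R]_1 => forall j, f s 0 j = s 0 0 ^+ l * P s 0 j).
  apply: near0_all => j; have [Zj|nZ] := pselect (Z j).
    by apply: (near0_imp _ Zj) => s ->; rewrite hP0 ?mulr0.
  have [_ _] := hu j nZ; apply: near0_imp => s ->; rewrite hPj // mulrA -exprD subnKC //.
  by apply: lmin; apply/asboolP; exists j.
by apply: near0_imp => s hs; apply/rowP => j; rewrite hs [RHS]mxE.
Qed.

Lemma DD_bAN d n r (g : 'rV[R]_d -> 'rV[R]_n) K j : 0 <= r -> DD r g K -> bAN r (fun x => g x 0 j).
Proof.
move=> r0 [hK id].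
have bx i : bAN r (fun x : 'rV[R]_d => K (row_mx x 0) i j).
  apply: (bAN_comp r0 (hK i j)) => k; case: (split_ordP k) => l ->.
    by apply: (AN_eq (AN_coord r l)) => x _; rewrite row_mxEl.
  by apply: (AN_le (AN_eq (AN_0 d r) _) r0) => x _; rewrite row_mxEr mxE.
apply: (bAN_eq (bAN_add r0 (bAN_cst _ _ (g 0 0 j)) (bAN_sum (index_enum _) r0 (fun i => bAN_mul r0 (bAN_coord r i) (bx i))))) => x bx'.
have := congr1 (fun v : 'rV_n => v 0 j) (id x 0 bx' (box0 r0)).
by rewrite /= subr0 rVB [X in _ = X]mxE => <-; rewrite addrC subrK.
Qed.

Lemma rank_gram d n (J : 'M[R]_(d, n)) : (\det (J *m J^T) != 0) = (\rank J == d).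
Proof.
apply/idP/idP => [h|/eqP h].
  rewrite eqn_leq rank_leq_row /=; apply: leq_trans (mxrankM_maxl J J^T).
  by rewrite mxrank_unit // unitmxE unitfE.
have := @gram_det R n d J^T; rewrite trmxK; apply=> u hu.
have /row_freeP[X hX] : row_free J by apply/eqP.
have : u^T *m J = 0 by rewrite -[J]trmxK -trmx_mul hu trmx0.
move=> h1; apply: trmx_inj; rewrite trmx0 -[u^T]mulmx1 -hX mulmxA h1 mul0mx //.
Qed.

Section ChartRay.
Variables (d n : nat) (r del : R) (g : 'rV[R]_d -> 'rV[R]_n) (K : 'rV[R]_(d + d) -> 'M[R]_(d, n)) (w0 : 'rV[R]_d).
Hypotheses (hdel : 0 < del < r) (hg : DD r g K) (cw0 : cube del w0).

Let gam (s : 'rV[R]_1) := s 0 0 *: w0.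
Let rho := r / del.

Let del0 : 0 < del. Proof. by case/andP: hdel. Qed.
Let r0 : 0 < r. Proof. by case/andP: hdel => /lt_trans h /h. Qed.
Let rho1 : 1 < rho. Proof. by rewrite /rho ltr_pdivlMr // mul1r; case/andP: hdel. Qed.
Let rho0 : 0 < rho. Proof. exact: lt_trans ltr01 rho1. Qed.

Let AN_gam k : AN rho (fun s => gam s 0 k) r.
Proof.
have h := AN_scale (w0 0 k) (AN_coord rho (0 : 'I_1)).
apply: AN_le (AN_eq h _) _ => [s _|]; first by rewrite mxE mulrC.
have /andP[w00 wd] := cw0 k; rewrite gtr0_norm // /rho mulrA ler_pdivrMr // mulrC ler_wpM2l //.
  exact: ltW.
exact: ltW.
Qed.

Let anmap_gam : anmap gam.
Proof. by move=> k; exact: an_AN rho0 (AN_gam k). Qed.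

Let gam0 : gam 0 = 0. Proof. by rewrite /gam mxE scale0r. Qed.

Lemma gam_cube (t : R) : 0 < t <= 1 -> cube del (gam (const_mx t)).
Proof.
move=> /andP[t0 t1] k; rewrite /gam !mxE; have /andP[h1 h2] := cw0 k.
by rewrite mulr_gt0 //=; apply: le_lt_trans h2; rewrite ger_pMl.
Qed.

(** Along the ray the Gram determinant is analytic in s up to the radius rho = r / del > 1, and it
    is nonzero at s = 1. Its germ at 0 therefore has a finite order, hence no zeros for small s >
    0. *)
Lemma ray_rank : \rank (K (row_mx w0 w0)) = d ->
  near0 (fun s : 'rV[R]_1 => 0 < s 0 0 -> \rank (K (row_mx (gam s) (gam s))) = d).
Proof.
move=> rk; pose D s := \det (K (row_mx (gam s) (gam s)) *m (K (row_mx (gam s) (gam s)))^T).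
have [bK _] := hg; have p0 := ltW rho0.
have bKg : bANmx rho (fun s => K (row_mx (gam s) (gam s))).
  move=> i j; apply: (bAN_comp p0 (bK i j)) => k; case: (split_ordP k) => l ->.
    by apply: (AN_eq (AN_gam l)) => x _; rewrite row_mxEl.
  by apply: (AN_eq (AN_gam l)) => x _; rewrite row_mxEr.
have [C hC] : bAN rho D.
  apply: bAN_det => //; apply: bANmx_mul => // i j.
  by apply: (bAN_eq (bKg j i)) => x _; rewrite [RHS]mxE.
have D1 : D (const_mx 1) != 0.
  by rewrite /D (_ : gam _ = w0) ?rank_gram ?rk // /gam mxE scale1r.
have nD : ~ ger0 D.
  move=> [e e0 h]; case/eqP: D1; apply: (AN_ident (w := 0) rho0 hC e0) => [i|x bx|i].
  - by rewrite mxE normr0.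
  - by apply: h; rewrite subr0 in bx.
  - by rewrite mxE normr1.
have [k [u [hu u0 E]]] := order1 (an_AN rho0 hC) nD.
apply: near0_imp2 E (an_neq0 hu u0) => s Es us s0; apply/eqP; rewrite -rank_gram -/(D s) Es.
by rewrite mulf_neq0 // expf_neq0 // gt_eqF.
Qed.

(** As g(s w0) - g 0 = s^k P(s) with P(0) nonzero, the velocity is s^(k-1) (k P + s P'), and its
    direction has the same limit as that of the secants. The diagonal of the difference quotient G
    of P serves as P'. *)
Lemma ray_velocity : (forall x, cube del x -> g x != g 0) ->
  exists P V, [/\ anmap P, anmap V, P 0 != 0, (exists2 c : R, 0 < c & V 0 = c *: P 0) &
    near0 (fun s : 'rV[R]_1 => 0 < s 0 0 -> exists a b : R,
      [/\ 0 < a, 0 < b, g (gam s) - g 0 = a *: P s & w0 *m K (row_mx (gam s) (gam s)) = b *: V s])].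
Proof.
move=> hne; have [bK id] := hg.
have hgm : anmap g by move=> j; have [C hC] := DD_bAN j (ltW r0) hg; exact: an_AN hC.
pose psi s := g (gam s) - g 0.
have hpsi : anmap psi.
  by apply: anmap_add; [exact: (anmap_comp anmap_gam gam0 hgm)|exact: anmap_cst].
have [|k [P [hP P0 EP]]] := vec_order1 hpsi.
  move=> [e e0 h]; pose t := Num.min e 1; have t0 : 0 < t by rewrite lt_min e0 ltr01.
  have ct : cube del (gam (const_mx t)) by apply: gam_cube; rewrite t0 ge_min lexx orbT.
  have /eqP := hne _ ct; apply; apply/eqP; rewrite -subr_eq0; apply/eqP; apply: h => i.
  by rewrite mxE gtr0_norm // ge_min lexx.
have k0 : (0 < k)%N.
  rewrite lt0n; apply: contraNneq P0 => k0; have := near0_0 EP.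
  by rewrite /psi gam0 subrr k0 expr0 scale1r => <-.
have [G [hG [e1 e10 idG]]] := an_dd hP.
have hl := @anmap_lsubmx R 1 1; have hr := @anmap_rsubmx R 1 1.
have hKg : anmx (fun w : 'rV[R]_(1 + 1) => w0 *m K (row_mx (gam (lsubmx w)) (gam (rsubmx w)))).
  apply: anmx_mul; first exact: anmx_cst.
  have hKa : anmx K by move=> i j; have [C hC] := bK i j; exact: an_AN hC.
  apply: (anmx_comp _ _ hKa); last by rewrite lsubmx0 rsubmx0 gam0 row_mx0.
  apply: anmap_row_mx; [exact: (anmap_comp hl (@lsubmx0 _ _ _) anmap_gam)|].
  exact: (anmap_comp hr (@rsubmx0 _ _ _) anmap_gam).
(* S is (x^k - y^k) / (x - y), and T the difference quotient of s^k P(s). *)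
pose S (w : 'rV[R]_(1 + 1)) := \sum_(i < k) lsubmx w 0 0 ^+ (k.-1 - i) * rsubmx w 0 0 ^+ i.
have hS : an S.
  apply: an_sum => i; apply: an_mul; first exact: (an_exp _ (hl 0)).
  exact: (an_exp _ (hr 0)).
pose T (w : 'rV[R]_(1 + 1)) := S w *: P (lsubmx w) + rsubmx w 0 0 ^+ k *: G w.
have hT : anmx T.
  apply: anmx_add.
    move=> i j; rewrite ord1; apply: (an_ext (an_mul hS (anmap_comp hl (@lsubmx0 _ _ _) hP j))) => w.
    by rewrite [RHS]mxE.
  move=> i j; rewrite ord1; apply: (an_ext (an_mul (an_exp k (hr 0)) (hG 0 j))) => w.
  by rewrite [RHS]mxE.
have key : near0 (fun w : 'rV[R]_(1 + 1) => w0 *m K (row_mx (gam (lsubmx w)) (gam (rsubmx w))) = T w).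
  have : near0 (fun w : 'rV[R]_(1 + 1) => forall j,
      (w0 *m K (row_mx (gam (lsubmx w)) (gam (rsubmx w))) - T w) 0 j = 0).
    apply: near0_all => j; apply: cancel_diff; first exact: (anmx_sub hKg hT 0 j).
    have nl := near0_comp hl (@lsubmx0 _ _ _) EP; have nr := near0_comp hr (@rsubmx0 _ _ _) EP.
    have ng : near0 (fun s : 'rV[R]_1 => box r (gam s)) by apply: (near0_comp anmap_gam gam0); exact: near0_box.
    have gl := near0_comp hl (@lsubmx0 _ _ _) ng; have gr := near0_comp hr (@rsubmx0 _ _ _) ng.
    have bl := near0_comp hl (@lsubmx0 _ _ _) (near0_box _ e10).
    have br := near0_comp hr (@rsubmx0 _ _ _) (near0_box _ e10).
    apply: near0_imp2 (near0_and nl nr) (near0_and (near0_and gl gr) (near0_and bl br)) => w [E1 E2] [[b1 b2] [b3 b4]].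
    rewrite -[RHS](_ : (0 : 'rV[R]_n) 0 j = 0); last by rewrite mxE.
    have -> (M : 'rV[R]_n) (c : R) : c * M 0 j = (c *: M) 0 j by rewrite [RHS]mxE.
    congr (fun_of_matrix _ 0 j); apply/eqP; rewrite scalerBr subr_eq0; apply/eqP.
    have -> : (lsubmx w 0 0 - rsubmx w 0 0) *: (w0 *m K (row_mx (gam (lsubmx w)) (gam (rsubmx w)))) =
        psi (lsubmx w) - psi (rsubmx w).
      by rewrite /psi opprB addrA subrK id // scalemxAl scalerBl.
    rewrite E1 E2 /T scalerDr !scalerA /S -subrXX.
    have E3 : P (lsubmx w) = P (rsubmx w) + (lsubmx w 0 0 - rsubmx w 0 0) *: G w.
      have := idG _ _ b3 b4; rewrite hsubmxK => /eqP; rewrite subr_eq addrC => /eqP ->.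
      by rewrite mulmx1_1 rVB.
    move: (lsubmx w 0 0) (rsubmx w 0 0) (P (lsubmx w)) (P (rsubmx w)) (G w) E3 => x y pl pr v ->.
    by apply/rowP => i; rewrite !mxE; ring.
  by apply: near0_imp => w h; apply/rowP => j; apply/eqP; rewrite -subr_eq0 -rVB h.
pose V s := k%:R *: P s + s 0 0 *: G (row_mx s s).
have hGd : anmx (fun s : 'rV[R]_1 => G (row_mx s s)).
  by apply: (anmx_comp _ _ hG); [apply: anmap_row_mx; exact: anmap_id|rewrite row_mx0].
exists P, V; split=> //.
- apply: anmap_add => j.
    by apply: (an_ext (an_mul (an_cst 1 k%:R) (hP j))) => s; rewrite [RHS]mxE.
  by apply: (an_ext (an_mul (an_coord 0) (hGd 0 j))) => s; rewrite [RHS]mxE.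
- by exists k%:R; rewrite ?ltr0n // /V mxE scale0r addr0.
apply: near0_imp2 EP (near0_diag key) => s E1; rewrite row_mxKl row_mxKr => E2 s0.
exists (s 0 0 ^+ k), (s 0 0 ^+ k.-1); split; rewrite ?exprn_gt0 //.
rewrite E2 /T /S /V row_mxKl row_mxKr scalerDr !scalerA -exprSr prednK //; congr (_ *: _ + _).
rewrite (eq_bigr (fun=> s 0 0 ^+ k.-1)); first by rewrite sumr_const card_ord mulr_natr.
by move=> i _; rewrite -exprD subnK // -ltnS prednK.
Qed.
End ChartRay.

Lemma vlim_anmap (I : Type) (U : set_system I) {UF : UltraFilter U} d n (s : I -> 'rV[R]_d) (f : 'rV[R]_d -> 'rV[R]_n) :
  infi U s -> anmap f -> vlim U (fun i => f (s i)) (f 0).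
Proof.
move=> hs hf; apply: (vlimP (UF := UF)) => e e0.
exact: (inf_near0 (UF := UF) hs (anmap_near hf e0)).
Qed.

Lemma chart_ray d n m (A : set 'rV[R]_n) p a e r del (g : 'rV[R]_d -> 'rV[R]_n) K w0 : (m <= d)%N ->
  enorm a = 1 -> 0 < e -> chart_at A p a (e ^+ 2 / 2) r del g K w0 ->
  exists q y (W : 'M[R]_n), [/\ A q, box e (q - p) & (m <= \rank W)%N] /\
    [/\ (y <= W)%MS, enorm y = 1, box (3 * e) (y - a) &
      forall v : 'rV[R]_n, (v <= W)%MS -> v != 0 -> direction_set A q (unitv v)].
Proof.
move=> md ua e0 [[hdel hg gp] [cw0 rk hA]]; have /andP[del0 dr] := hdel.
have r0 := lt_trans del0 dr.
have hne x : cube del x -> g x != g 0 by rewrite gp => /hA[_ /pcone_neq].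
have [P [V [hP hV P0 [c c0 V0] hPV]]] := ray_velocity hdel hg cw0 hne.
have hr := ray_rank hdel hg cw0 rk.
have [U UF hU] := nat_ultra.
pose t i : R := i.+1%:R^-1; pose s i : 'rV[R]_1 := const_mx (t i).
pose gam (s : 'rV[R]_1) := s 0 0 *: w0.
have t0 i : 0 < t i by rewrite invr_gt0.
have hs : infi U s.
  move=> e' e'0; apply: ae_imp (ulim_eps (R := R) UF hU e'0) => i h j.
  by rewrite mxE; rewrite subr0 in h.
have V00 : V 0 != 0 by rewrite V0 scaler_eq0 negb_or gt_eqF.
have hPl := vlim_unitv (UF := UF) (vlim_anmap (UF := UF) hs hP) P0.
have hVl := vlim_unitv (UF := UF) (vlim_anmap (UF := UF) hs hV) V00.
rewrite V0 unitvZ // in hVl.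
have hgam : anmap (fun s => g (gam s)).
  have hgm : anmap g by move=> j; have [C hC] := DD_bAN j (ltW r0) hg; exact: an_AN hC.
  apply: (anmap_comp (q := gam) _ _ hgm); last by rewrite /gam mxE scale0r.
  by move=> j; apply: (an_ext (an_mul (an_cst 1 (w0 0 j)) (an_coord 0))) => x; rewrite mxE mulrC.
have hq := vlim_anmap (UF := UF) hs hgam; rewrite {2}/gam mxE scale0r gp in hq.
have [i [[h1 h2] [h3 [h4 h5]]]] := ae_ex (ae_and (inf_near0 (UF := UF) hs (near0_and hPV hr))
  (ae_and (vlim_box (UF := UF) hPl e0) (ae_and (vlim_box (UF := UF) hVl e0) (vlim_box (UF := UF) hq e0)))).
have si : 0 < s i 0 0 by rewrite mxE.
have [al [b [a0 b0 hgP hK]]] := h1 si; have {}h2 := h2 si.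
pose w := gam (s i); rewrite -/(gam (s i)) -/w in hgP hK h2.
have cw : cube del w.
  by apply: (gam_cube cw0); rewrite t0 invf_le1 ?ler1n.
have [Aq cq] := hA w cw.
have hy : (V (s i) <= K (row_mx w w))%MS.
  by rewrite -[V (s i)](scalerK (lt0r_neq0 b0)) -hK scalemx_sub ?submxMl.
have Pn : P (s i) != 0.
  have := hne w cw; rewrite -subr_eq0 hgP scaler_eq0 negb_or => /andP[]//.
have Vn : V (s i) != 0.
  have : w0 *m K (row_mx w w) != 0.
    apply: contraNneq P0 => w0K.
    have /row_freeP[X hX] : row_free (K (row_mx w w)) by rewrite /row_free h2.
    have w00 : w0 = 0 by rewrite -[w0]mulmx1 -hX mulmxA w0K mul0mx.
    have := hne w cw; rewrite /w /gam w00 scaler0 eqxx //.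
  by rewrite hK scaler_eq0 negb_or => /andP[].
exists (g w), (unitv (V (s i))), <<K (row_mx w w)>>%MS; split; split=> //.
- by rewrite mxrank_gen h2.
- by rewrite genmxE scalemx_sub.
- exact: enorm_unitv.
(* The cone opening e^2 / 2 puts the secant direction within e of a. Secant and velocity are each
   within e of their common limit, which accounts for 3 e. *)
- have h6 : box e (unitv (P (s i)) - a).
    have e2 : 0 < e ^+ 2 / 2 by rewrite divr_gt0 // exprn_gt0.
    have := pcone_near e2 ua cq; rewrite -gp hgP unitvZ // [2 * _]mulrC divfK ?pnatr_eq0 //.
    rewrite ler_pXn2r ?nnegrE ?enorm_ge0 ?(ltW e0) // => h k.
    exact: le_trans (enorm_coord _ _) h.
  move=> k; have := h3 k; have := h4 k; have := h6 k; rewrite !rVB !ler_norml.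
  by move=> /andP[? ?] /andP[? ?] /andP[? ?]; apply/andP; split; lra.
move=> v; rewrite genmxE => vK v0; apply: (tangent_directions hdel hg _ cw vK v0) => x cx.
by have [] := hA x cx.
Qed.

End Ray.

(** * Linear spaces through the elements of GD *)

Section Final.
Context {R : realType}.
Implicit Types (r C D e eta del : R).

(** A diagonal approximation: the direction b i of A at p i is replaced, up to 3 / (i + 1), by a
    vector y i of a space W i of directions of A at a point q i within 1 / (i + 1) of p i. The
    dimension bound is uniform in i and passes to the limit space, whose unit vectors are limits of
    directions at points tending to 0. *)
Lemma GD_framed n (A : set 'rV[R]_n) a : subanalytic A -> (0 < m0 A)%N -> GD A a ->
  framed (m0 A) (half_cone (GD A)) a.
Proof.
move=> sA mpos hGD; have [U UF hU] := nat_ultra; have [e0 e00 hdim] := local_dim_ge mpos.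
have e2 : 0 < e0 / 2 by rewrite divr_gt0.
have [p [b [Ap dp pl bl]]] := GD_seq UF hU hGD.
pose good i (t : 'rV[R]_n * 'rV[R]_n * 'M[R]_n) := let: (q, y, W) := t in
  [/\ A q, box (i.+1%:R^-1) (q - p i) & (m0 A <= \rank W)%N] /\
  [/\ (y <= W)%MS, enorm y = 1, box (3 * i.+1%:R^-1) (y - b i) &
    forall v : 'rV[R]_n, (v <= W)%MS -> v != 0 -> direction_set A q (unitv v)].
have /choice[t ht] i : exists t, box (e0 / 2) (p i) -> good i t.
  have [bp|nb] := pselect (box (e0 / 2) (p i)); last by exists (0, 0, 0).
  have i0 : (0 : R) < i.+1%:R^-1 by rewrite invr_gt0.
  have eta0 : (0 : R) < i.+1%:R^-1 ^+ 2 / 2 by rewrite divr_gt0 ?exprn_gt0.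
  have [|d [r [del [g [K [w0 [md hch]]]]]]] := chart mpos eta0 sA (dp i).
    exists (e0 / 2) => // x Ax bx; apply: hdim => // k.
    have := ler_normD (x 0 k - p i 0 k) (p i 0 k); rewrite subrK => /le_trans; apply.
    by have := bx k; have := bp k; rewrite rVB; lra.
  have [q [y [W h]]] := chart_ray md (proj1 (dp i)) i0 hch.
  by exists (q, y, W).
pose q i := (t i).1.1; pose y i := (t i).1.2; pose W i := (t i).2.
have hgood : ae U (fun i => good i (q i, y i, W i)).
  apply: ae_imp (vlim_box (UF := UF) pl e2) => i; rewrite subr0 => /ht.
  by rewrite /q /y /W; case: (t i) => [[]].
have squeeze (x z : nat -> 'rV[R]_n) l (c : R) : 0 < c -> ae U (fun i => box (c * i.+1%:R^-1) (x i - z i)) ->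
    vlim U z l -> vlim U x l.
  move=> c0 hx hz; apply: (vlimP (UF := UF)) => e ep; have ec : 0 < e / 2 / c by rewrite !divr_gt0.
  have e2' : 0 < e / 2 by rewrite divr_gt0.
  apply: ae_imp2 (ae_and (UF := UF) hx (ulim_eps (R := R) UF hU ec)) (vlim_box (UF := UF) hz e2').
  move=> i [h1 h2] h3 k; have := h1 k; have := h3 k; rewrite !rVB => h4 h5.
  have h6 : c * i.+1%:R^-1 <= e / 2.
    by move: h2; rewrite subr0 ger0_norm ?invr_ge0 // ler_pdivlMr // mulrC.
  have := ler_normD (x i 0 k - z i 0 k) (z i 0 k - l 0 k); rewrite addrA subrK => /le_trans; apply.
  by rewrite [e]splitr; apply: lerD h4; exact: le_trans h5 h6.
have ql : vlim U q 0.
  by apply: (squeeze _ p _ 1 ltr01 _ pl); apply: ae_imp hgood => i [[_ h _] _]; rewrite mul1r.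
have yl : vlim U y a.
  by apply: (squeeze _ b _ 3 _ _ bl); rewrite ?ltr0n //; apply: ae_imp hgood => i [_ []].
have [V [rV aV hV]] : exists V : 'M[R]_n, [/\ (m0 A <= \rank V)%N, (a <= V)%MS &
    forall x : 'rV[R]_n, (x <= V)%MS -> exists2 v : nat -> 'rV[R]_n, ae U (fun i => (v i <= W i)%MS) & vlim U v x].
  rewrite -(prednK mpos); apply: (lim_framed (UF := UF) _ yl); apply: ae_imp hgood => i [[_ _ rW] [yW uy _ _]].
  by split=> //; rewrite prednK.
exists V; split=> // x /hV[v vW vx].
have [->|x0] := eqVneq x 0; first by exists 0, a; rewrite scale0r.
exists (enorm x), (unitv x); rewrite enorm_ge0 unitvK //; split=> //.
have vn : ae U (fun i => v i != 0).
  have [//|h] := ae_em (UF := UF) (fun i => v i != 0).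
  case/eqP: x0; apply: (vlim_unique (UF := UF) vx); apply: vlim_eq (vlim_cst (UF := UF) 0) _.
  by apply: ae_imp h => i /negP; rewrite negbK => /eqP.
apply/GDP; split=> [|e ep]; first exact: enorm_unitv.
have [i [[h1 h2] [[h3 h4] h5]]] := ae_ex (ae_and (ae_and (vlim_box (UF := UF) ql ep)
  (vlim_box (UF := UF) (vlim_unitv (UF := UF) vx x0) ep)) (ae_and (ae_and hgood vW) vn)).
exists (q i), (unitv (v i)); rewrite subr0 in h1; case: h3 => [[Aq _ _] [_ _ _ hd]]; split=> //.
exact: hd.
Qed.

End Final.

Theorem proposition3p20 (R : realType) (n : nat) (A : set 'rV[R]_n)
    (hn : (3 <= n)%N) (hA : subanalytic A) (h0 : closure A 0)
    (hm0 : (2 <= m0 A <= n)%N) :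
  let d := (n - (m0 A - 1))%N in
  forall k : nat, (d <= k)%N -> GDm k A = GDm k.+1 A.
Proof.
move=> d k dk; have /andP[m2 mn] := hm0; have mpos := ltnW m2.
have [U UF hU] := @nat_ultra; apply: (GDm_stable UF hU (m := m0 A)) dk; first by rewrite mpos.
by move=> a; exact: GD_framed.
Qed.
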